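(* Let $r\ge1$ and let $n_1,\ldots,n_r\ge2$ be integers. Then, with $q=e^{2\pi\sqrt{-1}\tau}$, \[ G^{\mathrm{sh}}_{n_1,\ldots,n_r}(q)=G_{n_1,\ldots,n_r}(\tau). \]
   Context: Hopf algebra. Let $\mathcal{I}_\bullet$ be the $\mathbb{Q}$-vector space spanned by symbols $\mathbb{I}(a_0;a_1,\ldots,a_N;a_{N+1})$ ($N\ge 0$, $a_i\in\{0,1\}$) subject to: (I1) $\mathbb{I}(a;\emptyset;b)=1$; (I2) the product is the shuffle product: $\mathbb{I}(a_0;a_1,\ldots,a_N;a_{N+N'+1})\,\mathbb{I}(a_0;a_{N+1},\ldots,a_{N+N'};a_{N+N'+1})=\sum_{\sigma\in\Sigma(N,N')}\mathbb{I}(a_0;a_{\sigma^{-1}(1)},\ldots,a_{\sigma^{-1}(N+N')};a_{N+N'+1})$, $\Sigma(N,N')$ being the $\sigma\in\mathfrak{S}_{N+N'}$ with $\sigma(1)<\cdots<\sigma(N)$, $\sigma(N+1)<\cdots<\sigma(N+N')$; (I3) for $x\in\{0,1\}$, $\mathbb{I}(a_0;a_1,\ldots,a_N;a_{N+1})=\sum_{k=0}^N\mathbb{I}(a_0;a_1,\ldots,a_k;x)\mathbb{I}(x;a_{k+1},\ldots,a_N;a_{N+1})$; (I4) $\mathbb{I}(a;a_1,\ldots,a_N;a)=0$ for $N\ge1$. It is a commutative graded Hopf algebra with Goncharov coproduct $\Delta\,\mathbb{I}(a_0;a_1,\ldots,a_N;a_{N+1})=\sum_{k=0}^{N}\sum_{0=i_0<i_1<\cdots<i_k<i_{k+1}=N+1}\prod_{p=0}^k\mathbb{I}(a_{i_p};a_{i_p+1},\ldots,a_{i_{p+1}-1};a_{i_{p+1}})\otimes\mathbb{I}(a_0;a_{i_1},\ldots,a_{i_k};a_{N+1})$.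 Let $\mathcal{I}^1_\bullet=\mathcal{I}_\bullet/\mathbb{I}(0;0;1)\mathcal{I}_\bullet$ (a quotient Hopf algebra, $\mathbb{I}(0;0;1)$ being primitive), $I(\cdots)$ the images, $\Delta$ the induced coproduct. Put $I(n_1,\ldots,n_r)=I(0;1,0^{n_1-1},\ldots,1,0^{n_r-1};1)$ ($n_i\ge1$, $0^m$ = $m$ zeros), $I()=1$; these form a $\mathbb{Q}$-basis of $\mathcal{I}^1_\bullet$. Regularised MZVs. $\zeta(n_1,\ldots,n_r)=\sum_{0<m_1<\cdots<m_r}m_1^{-n_1}\cdots m_r^{-n_r}$ ($n_r\ge2$). In $\mathfrak{H}=\mathbb{Q}\langle\mathbf{0},\mathbf{1}\rangle$ with shuffle product, $\mathfrak{H}^1=\mathbb{Q}+\mathbf{1}\mathfrak{H}$, $\mathfrak{H}^0=\mathbb{Q}+\mathbf{1}\mathfrak{H}\mathbf{0}$, $\mathbf{n}=\mathbf{1}\mathbf{0}^{n-1}$; $Z:\mathfrak{H}^0\to\mathbb{R}$, $\mathbf{n}_1\cdots\mathbf{n}_r\mapsto\zeta(n_1,\ldots,n_r)$, is a shuffle-algebra homomorphism, and $Z^{\mathrm{sh}}:\mathfrak{H}^1\to\mathbb{R}[T]$ is the unique shuffle-algebra homomorphism extending $Z$ with $\mathbf{1}\mapsto T$. $\zeta^{\mathrm{sh}}(n_1,\ldots,n_r)$ is the constant term of $Z^{\mathrm{sh}}(\mathbf{n}_1\cdots\mathbf{n}_r)$; $\mathfrak{z}^{\mathrm{sh}}:\mathcal{I}^1_\bullet\to\mathbb{R}$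 is the $\mathbb{Q}$-linear map $I(n_1,\ldots,n_r)\mapsto\zeta^{\mathrm{sh}}(n_1,\ldots,n_r)$, $1\mapsto1$. The map $\mathfrak{g}^{\mathrm{sh}}$. For positive integers $n_i$ and variables $x_i$, let $H\binom{n_1,\ldots,n_r}{x_1,\ldots,x_r}=\sum_{0<u_1<\cdots<u_r}\prod_{j=1}^r e^{u_jx_j}\big(\frac{q^{u_j}}{1-q^{u_j}}\big)^{n_j}\in\mathbb{Q}[[q]][[x_1,\ldots,x_r]]$. Let $h(x_1,\ldots,x_r)=\sum_{(i_1,\ldots,i_m)}\frac{1}{i_1!\cdots i_m!}H\binom{i_1,\ldots,i_m}{y_1,\ldots,y_m}$, summed over all compositions $i_1+\cdots+i_m=r$ ($i_j\ge1$), where $y_1=x_1+\cdots+x_{i_1}$, $y_2=x_{i_1+1}+\cdots+x_{i_1+i_2}$, ..., $y_m=x_{i_1+\cdots+i_{m-1}+1}+\cdots+x_r$. Let $g_{\mathrm{sh}}(x_1,\ldots,x_r)=h(x_r-x_{r-1},\ldots,x_2-x_1,x_1)$ and let $g^{\mathrm{sh}}_{n_1,\ldots,n_r}(q)$ be the coefficient of $x_1^{n_1-1}\cdots x_r^{n_r-1}$ in $g_{\mathrm{sh}}(-2\pi\sqrt{-1}x_1,\ldots,-2\pi\sqrt{-1}x_r)$. Define $\mathfrak{g}^{\mathrm{sh}}:\mathcal{I}^1_\bullet\to\mathbb{C}[[q]]$ $\mathbb{Q}$-linearly by $I(n_1,\ldots,n_r)\mapsto g^{\mathrm{sh}}_{n_1,\ldots,n_r}(q)$,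 $1\mapsto 1$. Regularised multiple Eisenstein series: $G^{\mathrm{sh}}_{n_1,\ldots,n_r}(q)=(\mathfrak{z}^{\mathrm{sh}}\otimes\mathfrak{g}^{\mathrm{sh}})\circ\Delta(I(n_1,\ldots,n_r))$, where $(\mathfrak{z}^{\mathrm{sh}}\otimes\mathfrak{g}^{\mathrm{sh}})(a\otimes b)=\mathfrak{z}^{\mathrm{sh}}(a)\mathfrak{g}^{\mathrm{sh}}(b)$. Multiple Eisenstein series. For $\tau$ in the upper half-plane, $l\tau+m\succ0$ ($l,m\in\mathbb{Z}$) iff $l>0$, or $l=0$ and $m>0$; $\lambda\succ\lambda'$ iff $\lambda-\lambda'\succ0$. For $n_i\ge2$, $G_{n_1,\ldots,n_r}(\tau)=\lim_{L\to\infty}\lim_{M\to\infty}\sum\lambda_1^{-n_1}\cdots\lambda_r^{-n_r}$ over $0\prec\lambda_1\prec\cdots\prec\lambda_r$, $\lambda_i=l_i\tau+m_i$, $|l_i|\le L$, $|m_i|\le M$.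
   Formalization: g^sh_{n_1,...,n_r}(q) is taken as the coefficient in (-2πi)^r g_sh(-2πi x_1,...,-2πi x_r); without the factor (-2πi)^r the claim fails already for r=1, n=2 (coefficient of q: -2πi instead of (-2πi)^2). *)

(* Defs.v *)
From HB Require Import structures.
From mathcomp Require Import all_boot all_order all_algebra.
From mathcomp Require Import finmap.
From mathcomp Require Import all_classical all_reals all_analysis.
From mathcomp Require Import complex.
(* The notations of these two files clash with those of the analysis library. *)
From mathcomp Require Import -(notations) mpoly monalg.

Set Implicit Arguments.
Unset Strict Implicit.
Unset Printing Implicit Defensive.

Import Order.TTheory GRing.Theory Num.Theory numFieldNormedType.Exports.

Local Open Scope ring_scope.
Local Open Scope quotient_scope.
Local Open Scope classical_set_scope.
Local Open Scope complex_scope.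

(** * Words in the letters 0 = [false] and 1 = [true] *)

Definition word := seq bool.

(* All the shuffles of two words, with multiplicity. *)
Fixpoint shuffle (u : word) : word -> seq word :=
  fix shuffle_u (v : word) : seq word :=
    match u, v with
    | [::], _ => [:: v]
    | _, [::] => [:: u]
    | x :: u', y :: v' =>
        map (cons x) (shuffle u' v) ++ map (cons y) (shuffle_u v')
    end.

(* 1 0^(n_1 - 1) ... 1 0^(n_r - 1) *)
Definition index_word (n : seq nat) : word :=
  flatten [seq true :: nseq k.-1 false | k <- n].

(** * The algebra I_*, as a quotient of Q[symbols] *)

Definition isymbol := (bool * word * bool)%type.

Definition Ifree : comAlgType rat := malg (cmonom isymbol) rat.

HB.lock Definition Isym (a : bool) (w : word) (b : bool) : Ifree :=
  mkmalgU (ucm (a, w, b)) 1.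

Inductive Irel : Ifree -> Prop :=
| Irel_I1 a b : Irel (Isym a [::] b - 1)
| Irel_I2 a b u v :
    Irel (Isym a u b * Isym a v b - \sum_(w <- shuffle u v) Isym a w b)
| Irel_I3 a b x w :
    Irel (Isym a w b
          - \sum_(k < (size w).+1) Isym a (take k w) x * Isym x (drop k w) b)
| Irel_I4 a w : w != [::] -> Irel (Isym a w a).

Section GeneratedIdeal.
Variables (A : comNzRingType) (S : A -> Prop).

Inductive ideal_gen : A -> Prop :=
| ideal_gen0 : ideal_gen 0
| ideal_genD a s x : S s -> ideal_gen x -> ideal_gen (a * s + x).

Definition idealb (x : A) : bool := `[< ideal_gen x >].

Lemma idealb_closed : ~ ideal_gen 1 -> idealr_closed idealb.
Proof.
move=> nS1; split.
- exact/asboolP/ideal_gen0.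
- by apply/asboolP.
move=> a x y /asboolP gx /asboolP gy; apply/asboolP.
elim: gx => [|b s z Ss _ IH]; first by rewrite mulr0 add0r.
by rewrite mulrDr mulrA -addrA; apply: ideal_genD.
Qed.

Lemma ideal_gen_ind_rmorph (B : comNzRingType) (f : {rmorphism A -> B}) :
  (forall s, S s -> f s = 0) -> forall x, ideal_gen x -> f x = 0.
Proof.
move=> fS x; elim=> [|a s y Ss _ IH]; first exact: rmorph0.
by rewrite rmorphD rmorphM (fS s Ss) mulr0 IH addr0.
Qed.

End GeneratedIdeal.

HB.lock Definition quot_map (A : comNzRingType) (I : idealr A) :
    {rmorphism A -> {ideal_quot I}} :=
  \pi_{ideal_quot I}.

Lemma quot_map_eq (A : comNzRingType) (I : idealr A) (x y : A) :
  (quot_map I x == quot_map I y) = (x - y \in I).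
Proof. by rewrite quot_map.unlock -Quotient.idealrBE. Qed.

Lemma quot_map_surj (A : comNzRingType) (I : idealr A) (y : {ideal_quot I}) :
  exists x, y = quot_map I x.
Proof. by exists (repr y); rewrite quot_map.unlock /= reprK. Qed.

(* {ideal_quot _} needs a proper ideal; the augmentation
   I(a; w; b) |-> [w is empty] shows that the two ideals below are proper. *)
Section Augmentation.

Let aug_monom (m : cmonom isymbol) : rat :=
  \prod_(s <- finsupp m) ((s.1.2 == [::])%:R ^+ m s).

Let aug_monomE (m : cmonom isymbol) (d : {fset isymbol}) :
  (finsupp m `<=` d)%fset ->
  aug_monom m = \prod_(s <- d) ((s.1.2 == [::])%:R ^+ m s).
Proof.
move=> le; rewrite /aug_monom (big_fset_incl _ le) // => s _.
by rewrite -cmE_eq0 => /eqP ->.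
Qed.

Let aug_mmorphism : mmorphism aug_monom.
Proof.
split=> [m1 m2|]; last by rewrite /aug_monom mdom1 big_seq_fset0.
rewrite (@aug_monomE (mul m1 m2) (finsupp m1 `|` finsupp m2)%fset); last first.
  by rewrite mdomD fsubset_refl.
rewrite (@aug_monomE m1 (finsupp m1 `|` finsupp m2)%fset) ?fsubsetUl //.
rewrite (@aug_monomE m2 (finsupp m1 `|` finsupp m2)%fset) ?fsubsetUr //.
by rewrite -big_split; apply: eq_bigr => s _; rewrite cmM exprD.
Qed.

HB.instance Definition _ := isMultiplicative.Build _ _ aug_monom aug_mmorphism.

Lemma augmentation_ex : exists f : {rmorphism Ifree -> rat},
  forall a w b, f (Isym a w b) = (w == [::])%:R.
Proof.
exists (mmap (idfun : rat -> rat) aug_monom) => a w b.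
rewrite Isym.unlock /= mmapU mul1r (@aug_monomE _ [fset (a, w, b)]%fset) ?mdomU ?fsubset_refl //.
by rewrite big_seq_fset1 cmUU expr1.
Qed.

End Augmentation.

Lemma augmentation_rel (f : {rmorphism Ifree -> rat}) :
  (forall a w b, f (Isym a w b) = (w == [::])%:R) -> forall x, Irel x -> f x = 0.
Proof.
move=> Iaug_sym x.
case=> {x}[a b|a b u v|a b x w|a w w0].
- by rewrite rmorphB rmorph1 Iaug_sym subrr.
- rewrite rmorphB rmorphM rmorph_sum /= !Iaug_sym.
  apply/eqP; rewrite subr_eq0; apply/eqP.
  have sz w : w \in shuffle u v -> size w = (size u + size v)%N.
    elim: u v w => [|x u IHu] v w; first by case: v => [|y v]; rewrite inE => /eqP->.
    elim: v w => [|y v IHv] w /=; first by rewrite inE => /eqP->; rewrite addn0.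
    rewrite mem_cat => /orP[] /mapP[w' w'in ->] /=.
      by rewrite (IHu _ _ w'in).
    by rewrite (IHv _ w'in) addnS.
  case: u sz => [|x u] sz; first by case: v {sz} => [|y v]; rewrite big_seq1 Iaug_sym mul1r.
  rewrite mul0r big_seq big1 // => w /sz; rewrite Iaug_sym.
  by case: w.
- rewrite rmorphB rmorph_sum /= Iaug_sym.
  under eq_bigr do rewrite rmorphM /= !Iaug_sym.
  apply/eqP; rewrite subr_eq0; apply/eqP.
  case: w => [|y w]; first by rewrite big_ord1 mul1r.
  rewrite big1 // => -[k lek] _ /=.
  case: k lek => [|k] _ /=; first by rewrite mulr0.
  by rewrite mul0r.
- by rewrite Iaug_sym (negbTE w0).
Qed.

Lemma Irel_proper : ~ ideal_gen Irel 1.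
Proof.
have [f /augmentation_rel fE] := augmentation_ex.
move=> /(ideal_gen_ind_rmorph fE) /eqP.
by rewrite rmorph1 oner_eq0.
Qed.

Definition Iideal : {pred Ifree} := idealb Irel.

HB.instance Definition _ :=
  isIdealr.Build Ifree Iideal (idealb_closed Irel_proper).

Definition Ialg : comNzRingType := {ideal_quot Iideal}.

Definition Ialg_gen (a : bool) (w : word) (b : bool) : Ialg :=
  quot_map Iideal (Isym a w b).

(** * The quotient I^1_* of I_* by the ideal generated by I(0; 0; 1) *)

Definition I1rel (x : Ialg) : Prop := x = Ialg_gen false [:: false] true.

Lemma I1rel_proper : ~ ideal_gen I1rel 1.
Proof.
have [f fsym] := augmentation_ex.
have frel := augmentation_rel fsym.
pose e (y : Ialg) : rat := f (repr y).
have piK (x : Ialg) : quot_map Iideal (repr x) = x.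
  by rewrite quot_map.unlock /= reprK.
have eE x : e (quot_map Iideal x) = f x.
  apply/eqP; rewrite -subr_eq0 -rmorphB.
  apply/eqP; apply: (ideal_gen_ind_rmorph frel); apply/asboolP.
  have := quot_map_eq Iideal (repr (quot_map Iideal x)) x.
  by rewrite piK eqxx.
suff h x : ideal_gen I1rel x -> e x = 0.
  by move=> /h; rewrite -(rmorph1 (quot_map Iideal)) eE rmorph1 => /eqP; rewrite oner_eq0.
elim=> [|a s {}x -> _].
  by rewrite -(rmorph0 (quot_map Iideal)) eE rmorph0.
rewrite -[a]piK -[x]piK /Ialg_gen eE -rmorphM -rmorphD eE rmorphD rmorphM.
by rewrite fsym mulr0 add0r.
Qed.

Definition I1ideal : {pred Ialg} := idealb I1rel.

HB.instance Definition _ :=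
  isIdealr.Build Ialg I1ideal (idealb_closed I1rel_proper).

Definition I1 := {ideal_quot I1ideal}.

HB.instance Definition _ := GRing.ComNzRing.on I1.

Definition I1_map : {rmorphism Ifree -> I1} :=
  (quot_map I1ideal \o quot_map Iideal)%FUN.

Section ScaleByMorphism.
Variables (A : comAlgType rat) (B : comNzRingType) (f : {rmorphism A -> B}).

Definition mor_scale (c : rat) (x : B) : B := f c%:A * x.

Lemma mor_scaleA c d x : mor_scale c (mor_scale d x) = mor_scale (c * d) x.
Proof. by rewrite /mor_scale mulrA -rmorphM -scalerAl mul1r scalerA. Qed.

Lemma mor_scale1 : left_id 1 mor_scale.
Proof. by move=> x; rewrite /mor_scale scale1r rmorph1 mul1r. Qed.

Lemma mor_scaleDr : right_distributive mor_scale +%R.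
Proof. by move=> c x y; rewrite /mor_scale mulrDr. Qed.

Lemma mor_scaleDl x : {morph mor_scale^~ x : c d / c + d}.
Proof. by move=> c d; rewrite /mor_scale scalerDl rmorphD mulrDl. Qed.

Lemma mor_scaleAl c x y : mor_scale c (x * y) = mor_scale c x * y.
Proof. exact: mulrA. Qed.

End ScaleByMorphism.

HB.instance Definition _ := GRing.Zmodule_isLmodule.Build rat I1
  (mor_scaleA I1_map) (mor_scale1 I1_map)
  (mor_scaleDr I1_map) (mor_scaleDl I1_map).

HB.instance Definition _ :=
  GRing.Lmodule_isLalgebra.Build rat I1 (mor_scaleAl I1_map).
HB.instance Definition _ := GRing.Lalgebra_isComAlgebra.Build rat I1.

(* I(a; w; b) in I^1_* *)
Definition I1_gen (a : bool) (w : word) (b : bool) : I1 :=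
  quot_map I1ideal (Ialg_gen a w b).

(* I(n_1, ..., n_r) *)
Definition I1_index (n : seq nat) : I1 := I1_gen false (index_word n) true.

(** * Tensor products of Q-vector spaces *)

Definition tensor_free (M N : lmodType rat) : lmodType rat :=
  malg (M * N)%type rat.

HB.lock Definition tensor_sym (M N : lmodType rat) (m : M) (n : N) :
    tensor_free M N :=
  mkmalgU (m, n) 1.

Section Tensor.
Variables M N : lmodType rat.
Local Notation tensor_free := (tensor_free M N).

Inductive tensor_rel : tensor_free -> Prop :=
| tensor_relDl m m' n :
    tensor_rel (tensor_sym (m + m') n - (tensor_sym m n + tensor_sym m' n))
| tensor_relDr m n n' :
    tensor_rel (tensor_sym m (n + n') - (tensor_sym m n + tensor_sym m n'))
| tensor_relZl c m n :
    tensor_rel (tensor_sym (c *: m) n - c *: tensor_sym m n)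
| tensor_relZr c m n :
    tensor_rel (tensor_sym m (c *: n) - c *: tensor_sym m n).

Inductive tensor_span : tensor_free -> Prop :=
| tensor_span0 : tensor_span 0
| tensor_spanD c s x :
    tensor_rel s -> tensor_span x -> tensor_span (c *: s + x).

Lemma tensor_spanZD c x y :
  tensor_span x -> tensor_span y -> tensor_span (c *: x + y).
Proof.
move=> sx sy; elim: sx => [|d s z rs _ IH]; first by rewrite scaler0 add0r.
by rewrite scalerDr scalerA -addrA; apply: tensor_spanD.
Qed.

Definition tensor_spanb : {pred tensor_free} := fun x => `[< tensor_span x >].

Lemma tensor_spanb_closed : zmod_closed tensor_spanb.
Proof.
split=> [|x y /asboolP sx /asboolP sy]; first exact/asboolP/tensor_span0.
by apply/asboolP; rewrite addrC -scaleN1r; apply: tensor_spanZD.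
Qed.

HB.instance Definition _ :=
  GRing.isZmodClosed.Build tensor_free tensor_spanb tensor_spanb_closed.

Definition tensor := Quotient.quot tensor_spanb.

HB.instance Definition _ := GRing.Zmodule.on tensor.

Definition tensor_pi (x : tensor_free) : tensor :=
  \pi_(Quotient.quot tensor_spanb) x.

Lemma tensor_piP x y : (tensor_pi x = tensor_pi y) <-> tensor_span (x - y).
Proof.
have e : (x - y \in tensor_spanb) = (tensor_pi x == tensor_pi y).
  exact: Quotient.idealrBE.
by split=> [/eqP|sxy]; [rewrite -e => /asboolP|apply/eqP; rewrite -e; apply/asboolP].
Qed.

Lemma tensor_piD x y : tensor_pi (x + y) = tensor_pi x + tensor_pi y.
Proof. by rewrite /tensor_pi !piE. Qed.

Definition tensor_scale (c : rat) (t : tensor) : tensor :=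
  tensor_pi (c *: repr t).

Lemma tensor_piK (t : tensor) : tensor_pi (repr t) = t.
Proof. exact: reprK. Qed.

Lemma tensor_piZ c x : tensor_pi (c *: x) = tensor_scale c (tensor_pi x).
Proof.
apply/tensor_piP; rewrite -scalerBr -[_ *: _]addr0.
apply: tensor_spanZD; last exact: tensor_span0.
by apply/tensor_piP; rewrite tensor_piK.
Qed.

Lemma tensor_scaleA c d t :
  tensor_scale c (tensor_scale d t) = tensor_scale (c * d) t.
Proof. by rewrite -[t]tensor_piK -!tensor_piZ scalerA. Qed.

Lemma tensor_scale1 : left_id 1 tensor_scale.
Proof. by move=> t; rewrite -[t]tensor_piK -tensor_piZ scale1r. Qed.

Lemma tensor_scaleDr : right_distributive tensor_scale +%R.
Proof.
move=> c t u; rewrite -[t]tensor_piK -[u]tensor_piK.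
by rewrite -tensor_piD -!tensor_piZ -tensor_piD scalerDr.
Qed.

Lemma tensor_scaleDl t : {morph tensor_scale^~ t : c d / c + d}.
Proof.
by move=> c d; rewrite -[t]tensor_piK -!tensor_piZ -tensor_piD scalerDl.
Qed.

HB.instance Definition _ := GRing.Zmodule_isLmodule.Build rat tensor
  tensor_scaleA tensor_scale1 tensor_scaleDr tensor_scaleDl.

Definition tens (m : M) (n : N) : tensor := tensor_pi (tensor_sym m n).

(* (f \otimes g) (sum_i c_i m_i \otimes n_i) = sum_i c_i f(m_i) g(n_i), computed on a
   representative; see [tensor_evalE]. The series in q are given by their
   coefficients. *)
Definition tensor_eval (R : realType) (f : M -> R) (g : N -> nat -> R[i])
    (t : tensor) : nat -> R[i] :=
  fun k => \sum_(p <- msupp (repr t : malg (M * N)%type rat))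
             ratr (mcoeff p (repr t : malg (M * N)%type rat))
             * ((f p.1)%:C * g p.2 k).

End Tensor.

Lemma tensor_evalE (R : realType) (M N : lmodType rat)
    (f : {linear M -> R | ratr \; *%R})
    (g : {linear N -> (nat -> R[i]) | ratr \; *:%R}) (m : M) (n : N) (k : nat) :
  tensor_eval f g (tens m n) k = (f m)%:C * g n k.
Proof.
pose h (p : (M * N)%type) : R[i] := (f p.1)%:C * g p.2 k.
pose ev : {additive tensor_free M N -> R[i]} :=
  mmap (ratr : {rmorphism rat -> R[i]}) h.
have evU a b : ev (tensor_sym a b) = h (a, b).
  rewrite tensor_sym.unlock /ev /= mmapU -[RHS]mul1r; congr (_ * _).
  exact: (rmorph1 (ratr : {rmorphism rat -> R[i]})).
have evZ c x : ev (c *: x) = ratr c * ev x.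
  rewrite /ev /= (mmapEw (msuppZ_le c x)) mmapE mulr_sumr.
  apply: eq_bigr => p _; rewrite mcoeffZ [RHS]mulrA; congr (_ * _).
  exact: (rmorphM (ratr : {rmorphism rat -> R[i]})).
have evrel x : tensor_rel x -> ev x = 0.
  have ratrC (c : rat) : (ratr c : R)%:C = ratr c :> R[i].
    exact: (fmorph_rat (real_complex R)).
  have realM (y z : R) : (y * z)%:C = y%:C * z%:C :> R[i].
    exact: (rmorphM (real_complex R)).
  have evB y z : ev y = ev z -> ev (y - z) = 0 by move=> e; rewrite raddfB e subrr.
  case=> {x} [a a' b|a b b'|c a b|c a b]; apply: evB.
  - by rewrite (raddfD ev) !evU /h /= raddfD rmorphD mulrDl.
  - by rewrite (raddfD ev) !evU /h /= (raddfD g) /= mulrDr.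
  - by rewrite evZ !evU /h /= linearZ /= -ratrC realM mulrA.
  - by rewrite evZ !evU /h /= linearZ /= mulrCA.
have evspan x : tensor_span x -> ev x = 0.
  elim=> [|c s {}x rs _ IH]; first exact: raddf0.
  by rewrite raddfD evZ (evrel s rs) mulr0 add0r.
have := tensor_piK (tens m n); rewrite {2}/tens => /tensor_piP /evspan.
by rewrite raddfB evU => /eqP; rewrite subr_eq0 => /eqP.
Qed.

(* The class of the Goncharov coproduct of I(a; w; b). With c = a w b, a choice
   0 = i_0 < i_1 < ... < i_k < i_{k+1} = N + 1 is the list [ix] below, and the
   p-th factor is I(c_{i_p}; c_{i_p + 1}, ..., c_{i_{p+1} - 1}; c_{i_{p+1}}). *)
Definition goncharov (a : bool) (w : word) (b : bool) : tensor I1 I1 :=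
  let c := a :: rcons w b in
  \sum_(k < (size w).+1)
    \sum_(i : k.-tuple 'I_(size w).+1 | path ltn 0 (map val i))
      let ix := 0%N :: rcons (map val i) (size w).+1 in
      tens (\prod_(p < k.+1)
              I1_gen (nth false c (nth 0%N ix p))
                     (drop (nth 0%N ix p).+1 (take (nth 0%N ix p.+1) c))
                     (nth false c (nth 0%N ix p.+1)))
           (I1_gen a [seq nth false c j | j <- map val i] b).

(** * Shuffle regularised multiple zeta values *)

(* sum_{0 < m_1 < ... < m_r <= B} m_1^(-n_1) ... m_r^(-n_r) *)
Definition zeta_partial (R : realType) (n : seq nat) (B : nat) : R :=
  \sum_(m : (size n).-tuple 'I_B.+1 | path ltn 0 (map val m))
    \prod_(j < size n) ((tnth m j)%:R ^- nth 0%N n j).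

Definition zeta (R : realType) (n : seq nat) : R :=
  limn (zeta_partial R n).

(* The words spanning H^1 = Q + 1 H. *)
Definition H1_word (u : word) : bool := head true u.

Definition is_index (n : seq nat) : bool := all (leq 1) n.

(* The indices of the words spanning H^0; () is one of them. *)
Definition is_admissible (n : seq nat) : bool :=
  is_index n && (2 <= last 2 n)%N.

(* Z^sh, a Q-linear map on H^1 being given by its values on words. *)
Record is_shuffle_regularisation (R : realType) (Zsh : word -> {poly R}) :
    Prop := {
  Zsh_1 : Zsh [::] = 1;
  Zsh_M : forall u v, H1_word u -> H1_word v ->
    Zsh u * Zsh v = \sum_(w <- shuffle u v) Zsh w;
  Zsh_zeta : forall n, is_admissible n -> Zsh (index_word n) = (zeta R n)%:P;
  Zsh_T : Zsh [:: true] = 'X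
}.

(** * The q-series g^sh *)

(* Q[[q]][[x_1, ..., x_r]]: coefficient of x^alpha q^k. *)
Definition qxseries (r : nat) := mpoly.multinom r -> nat -> rat.

Definition xvar (r : nat) (i : 'I_r) : mpoly.mpoly r rat :=
  mpoly.mpolyX rat (mpoly.mnm1 i).

(* F(L_1, ..., L_m), for linear forms L_j in x_1, ..., x_r: a monomial of
   degree d of F contributes only to the degree d part of the result, so the sum
   over the monomials of degree at most |alpha| is the full coefficient. *)
Definition qx_subst (m r : nat) (F : qxseries m)
    (L : 'I_m -> mpoly.mpoly r rat) : qxseries r :=
  fun alpha k =>
    \sum_(beta : mpoly.bmultinom m (mpoly.mdeg alpha).+1)
      F (mpoly.bmnm beta) k
      * mpoly.mcoeff alpha (\prod_(j < m) L j ^+ mpoly.bmnm beta j).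

(* H(n; x) = sum_{0 < u_1 < ... < u_m} prod_j e^(u_j x_j) (q^(u_j) / (1 - q^(u_j)))^(n_j),
   with q^u / (1 - q^u) = q^u + q^(2u) + ... Up to q^k, the terms with u_m > k and
   the powers q^(d u) with d > k do not contribute. *)
Definition Hseries (m : nat) (n : m.-tuple nat) : qxseries m :=
  fun beta k =>
    \sum_(u : m.-tuple 'I_k.+1 | path ltn 0 (map val u))
      (\prod_(j < m) ((tnth u j)%:R ^+ beta j / (beta j)`!%:R))
      * (\prod_(j < m)
           (\sum_(1 <= d < k.+1) 'X^(d * tnth u j)) ^+ tnth n j : {poly rat})`_k.

(* h(x_1, ..., x_r): sum over the compositions i of r, the j-th block of
   variables having the (0-based) indices l with i_1 + ... + i_{j-1} <= l and
   l < i_1 + ... + i_j. *)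
Definition hseries (r : nat) : qxseries r :=
  fun alpha k =>
    \sum_(m < r.+1)
      \sum_(i : m.-tuple 'I_r.+1 |
              all (leq 1) (map val i) && (sumn (map val i) == r))
        (\prod_(j < m) (tnth i j)`!%:R)^-1
        * qx_subst (Hseries [tuple of map val i])
            (fun j : 'I_m =>
               \sum_(l < r | (sumn (take j (map val i)) <= l
                              < sumn (take j.+1 (map val i)))%N) xvar l)
            alpha k.

(* g_sh(x_1, ..., x_r) = h(x_r - x_{r-1}, ..., x_2 - x_1, x_1) *)
Definition g_sh (r : nat) : qxseries r :=
  qx_subst (@hseries r)
    (fun j : 'I_r =>
       xvar (rev_ord j)
       - \sum_(l < r | l.+1 == rev_ord j :> nat) xvar l).

Definition two_pi_i (R : realType) : R[i] := 0 +i* (2 * pi).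

(* The coefficient of x_1^(n_1 - 1) ... x_r^(n_r - 1) in
   (-2 pi i)^r g_sh(-2 pi i x_1, ..., -2 pi i x_r), as a series in q. The factor
   (-2 pi i)^r cannot be dropped: depth one must agree with the Lipschitz formula
   sum_m (tau + m)^(-n) = (-2 pi i)^n / (n - 1)! sum_{u > 0} u^(n - 1) q^u. *)
Definition g_sh_coef (R : realType) (n : seq nat) : nat -> R[i] :=
  fun k =>
    (- two_pi_i R) ^+ size n
    * (- two_pi_i R) ^+ sumn (map predn n)
    * ratr (g_sh (mpoly.Multinom [tuple (nth 0%N n j).-1 | j < size n]) k).

(** * Regularised multiple Eisenstein series *)

Definition Gsh (R : realType) (Delta : I1 -> tensor I1 I1) (zsh : I1 -> R)
    (gsh : I1 -> nat -> R[i]) (n : seq nat) : nat -> R[i] :=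
  tensor_eval zsh gsh (Delta (I1_index n)).

(** * Multiple Eisenstein series *)

Definition cexp (R : realType) (z : R[i]) : R[i] :=
  (expR (complex.Re z))%:C * (cos (complex.Im z) +i* sin (complex.Im z)).

(* l tau + m is encoded by (l, m). *)
Definition lattice_pos (x : int * int) : bool :=
  (0 < x.1) || ((x.1 == 0) && (0 < x.2)).

Definition lattice_lt (x y : int * int) : bool :=
  lattice_pos (y.1 - x.1, y.2 - x.2).

Definition lattice_val (R : realType) (tau : R[i]) (x : int * int) : R[i] :=
  x.1%:~R * tau + x.2%:~R.

(* The pairs (l, m) with |l| <= L and |m| <= M. *)
Definition box_val (L M : nat) (x : 'I_(L.*2.+1) * 'I_(M.*2.+1)) : int * int :=
  ((x.1 : nat)%:Z - L%:Z, (x.2 : nat)%:Z - M%:Z).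

Definition G_partial (R : realType) (n : seq nat) (tau : R[i]) (L M : nat) :
    R[i]^o :=
  \sum_(x : (size n).-tuple ('I_(L.*2.+1) * 'I_(M.*2.+1))%type |
          path lattice_lt (0, 0) (map (@box_val L M) x))
    \prod_(j < size n)
      (lattice_val tau (box_val (tnth x j)) ^- nth 0%N n j).

Definition G_inner (R : realType) (n : seq nat) (tau : R[i]) (L : nat) :
    R[i]^o :=
  limn (G_partial n tau L).

Definition G (R : realType) (n : seq nat) (tau : R[i]) : R[i]^o :=
  limn (G_inner n tau).

(* Main.v *)
Require Import Defs.
From HB Require Import structures.
From mathcomp Require Import all_boot all_order all_algebra.
From mathcomp Require Import all_classical all_reals all_analysis.
From mathcomp Require Import complex.
From mathcomp Require Import -(notations) mpoly monalg.
From mathcomp Require Import ring lra zify.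

Set Implicit Arguments.
Unset Strict Implicit.
Unset Printing Implicit Defensive.

Import Order.TTheory GRing.Theory Num.Theory numFieldNormedType.Exports.

Local Open Scope ring_scope.
Local Open Scope classical_set_scope.
Local Open Scope complex_scope.

(* Both sides are brought to the form
     sum_j zeta(n_1, ..., n_j) * B_j,
   where B_j cuts (n_{j+1}, ..., n_r) into blocks and replaces each block m by
     sum_{k >= 2} K(m, k) * (an entry k),
   K(m, k) being the partial fraction coefficients of prod_i (x + s_i)^(-m_i),
   summed over the increasing s: sums of products of iterated integrals
   I(1; .., 0) I(0; ..; 1).
   For G^sh the factors I(a; w; a) of the Goncharov coproduct vanish, which
   leaves, since n_i >= 2, the words without 11; the coefficients are the K(m, k),
   and K(m, 1) = 0 by path composition of a loop.
   For G the summation over the rows l of the lattice produces the zeta value of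
   the row l = 0 and a multitangent function of l tau for every block; these
   reduce to the monotangents of weight k >= 2 by partial fractions, with an
   error controlled by the rate of convergence of the truncated zeta values.
   It remains to identify sum_{0 < l_1 < ... < l_s} prod_i Psi_{k_i}(l_i tau),
   Psi_k the monotangents, with g^sh_{k_1, ..., k_s}. By the Lipschitz formula
   this is a power series in q with the coefficients
     sum over (l, w), sum_i l_i w_i = N, of prod_i w_i^(k_i - 1) / (k_i - 1)!.
   On the side of g^sh only the composition (1, ..., 1) contributes to h, because
   k_i - 1 > 0, and the change of variables w = the differences of the u_j,
   l = the partial sums of the d_j gives the same coefficients. *)

(** * Sums over increasing sequences *)

(* The sum of f over the increasing sequences of length r in [lo, hi). *)
Fixpoint csum (V : nmodType) (r lo hi : nat) (f : seq nat -> V) : V :=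
  if r is r'.+1 then
    \sum_(lo <= j < hi) csum r' j.+1 hi (fun s => f (j :: s))
  else f [::].

Section ChainSums.
Variable V : nmodType.
Implicit Types (f g : seq nat -> V).

Lemma eq_csum r lo hi f g :
  (forall s, size s = r -> all (fun j => lo <= j < hi)%N s -> sorted ltn s ->
     f s = g s) ->
  csum r lo hi f = csum r lo hi g.
Proof.
elim: r lo f g => [|r IH] lo f g fg /=; first exact: fg.
rewrite !big_nat; apply: eq_bigr => j /andP[loj jhi]; apply: IH => s szs alls srt.
apply: fg => /=.
- by rewrite szs.
- rewrite loj jhi /=; apply: sub_all alls => i /andP[ji ->].
  by rewrite (leq_trans loj (ltnW ji)).
- by case: s {szs} alls srt => //= a s /andP[/andP[ja _] _] ->; rewrite ja.
Qed.

Lemma eq_csumr r lo hi f g : f =1 g -> csum r lo hi f = csum r lo hi g.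
Proof. by move=> fg; apply: eq_csum => s *; apply: fg. Qed.

Lemma csumD r lo hi f g :
  csum r lo hi (fun s => f s + g s) = csum r lo hi f + csum r lo hi g.
Proof.
elim: r lo f g => [//|r IH] lo f g /=.
by rewrite -big_split /=; apply: eq_bigr => j _; rewrite IH.
Qed.

Lemma csum0 r lo hi : csum r lo hi (fun=> 0 : V) = 0.
Proof. by elim: r lo => [//|r IH] lo /=; rewrite big1. Qed.

Lemma csum_sum (I : Type) (rs : seq I) (P : pred I) r lo hi (F : I -> seq nat -> V) :
  csum r lo hi (fun s => \sum_(i <- rs | P i) F i s)
  = \sum_(i <- rs | P i) csum r lo hi (F i).
Proof.
elim: rs => [|i rs IH].
  by rewrite big_nil -[RHS](csum0 r lo hi); apply: eq_csumr => s; rewrite big_nil.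
rewrite big_cons -IH; case: ifP => Pi; last first.
  by apply: eq_csumr => s; rewrite big_cons Pi.
by rewrite -csumD; apply: eq_csumr => s; rewrite big_cons Pi.
Qed.

Lemma csum_recl r lo hi f : (lo < hi)%N ->
  csum r.+1 lo hi f = csum r lo.+1 hi (fun s => f (lo :: s)) + csum r.+1 lo.+1 hi f.
Proof. by move=> lohi /=; rewrite big_ltn. Qed.

Lemma exchange_big_triangle lo hi (F : nat -> nat -> V) :
  \sum_(lo <= j < hi) \sum_(j.+1 <= p < hi) F j p
  = \sum_(lo <= p < hi) \sum_(lo <= j < p) F j p.
Proof.
transitivity (\sum_(lo <= j < hi) \sum_(lo <= p < hi | (j < p)%N) F j p).
  rewrite !big_nat; apply: eq_bigr => j /andP[loj jhi].
  rewrite (@big_cat_nat _ _ _ j.+1 lo) //= ?leqW //.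
  rewrite [X in _ = X + _]big_nat_cond [X in _ = X + _]big1 ?add0r; last first.
    by move=> p /andP[/andP[_ pj] jp]; move: pj; rewrite ltnS leqNgt jp.
  rewrite [LHS]big_nat [RHS]big_nat_cond; apply: eq_bigl => p.
  by rewrite andbAC andbb.
rewrite (exchange_big_dep_nat xpredT) //= !big_nat; apply: eq_bigr => p /andP[lop phi].
rewrite (@big_cat_nat _ _ _ p lo) //= 1?ltnW //.
rewrite [X in _ + X]big_nat_cond [X in _ + X]big1 ?addr0; last first.
  by move=> j /andP[/andP[pj _]]; rewrite ltnNge pj.
rewrite [RHS]big_nat [LHS]big_nat_cond; apply: eq_bigl => j.
by case: (ltnP j p); rewrite ?andbT ?andbF //.
Qed.

Lemma csum_split i k lo hi f :
  csum (i + k.+1) lo hi f =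
  \sum_(lo <= p < hi)
    csum i lo p (fun u => csum k p.+1 hi (fun v => f (u ++ p :: v))).
Proof.
elim: i lo f => [|i IH] lo f //=.
transitivity (\sum_(lo <= j < hi) \sum_(j.+1 <= p < hi)
   csum i j.+1 p (fun u => csum k p.+1 hi (fun v => f (j :: u ++ p :: v)))).
  by apply: eq_bigr => j _; rewrite IH.
by rewrite exchange_big_triangle.
Qed.

Lemma csum_rcons r lo hi f :
  csum r.+1 lo hi f =
  \sum_(lo <= p < hi) csum r lo p (fun u => f (rcons u p)).
Proof.
rewrite -addn1 csum_split; apply: eq_bigr => p _.
by apply: eq_csumr => u /=; rewrite cats1.
Qed.

Lemma csum_shift c r lo hi f :
  csum r (c + lo) (c + hi) f = csum r lo hi (fun s => f (map (addn c) s)).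
Proof.
elim: r lo f => [//|r IH] lo f /=.
rewrite [(c + lo)%N]addnC big_addn addKn; apply: eq_bigr => j _.
by rewrite addnC -addnS IH.
Qed.

Lemma csum_reflect p r hi f : (hi <= p)%N ->
  csum r 0 hi f
  = csum r (p - hi).+1 p.+1 (fun s => f (rev (map (fun d => p - d)%N s))).
Proof.
elim: r hi f => [//|r IH] hi f hip; rewrite csum_rcons /=.
rewrite big_nat_rev /= add0n -{1}(add0n (p - hi).+1) big_addn.
have -> : (p.+1 - (p - hi).+1 = hi)%N by lia.
rewrite !big_nat; apply: eq_bigr => j /= jhi.
rewrite IH; last by lia.
have -> : (p - (hi - j.+1) = j + (p - hi).+1)%N by lia.
apply: eq_csumr => s; rewrite rev_cons; congr (f (rcons _ _)); lia.
Qed.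

End ChainSums.

Lemma csumZ (K : pzRingType) (c : K) r lo hi (f : seq nat -> K) :
  csum r lo hi (fun s => c * f s) = c * csum r lo hi f.
Proof.
elim: r lo f => [//|r IH] lo f /=.
by rewrite big_distrr /=; apply: eq_bigr => j _; rewrite IH.
Qed.

Lemma csumZr (K : pzRingType) (c : K) r lo hi (f : seq nat -> K) :
  csum r lo hi (fun s => f s * c) = csum r lo hi f * c.
Proof.
elim: r lo f => [//|r IH] lo f /=.
by rewrite big_distrl /=; apply: eq_bigr => j _; rewrite IH.
Qed.

Lemma raddf_csum (U V : nmodType) (h : {additive U -> V}) r lo hi f :
  h (csum r lo hi f) = csum r lo hi (fun s => h (f s)).
Proof.
elim: r lo f => [//|r IH] lo f /=.
by rewrite raddf_sum; apply: eq_bigr => j _; rewrite IH.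
Qed.

Section TuplePaths.
Variables (V : nmodType) (T : finType) (T' : Type) (e : rel T') (g : T -> T').

Lemma big_tuple_path r p (F : seq T' -> V) :
  \sum_(x : r.+1.-tuple T | path e p (map g x)) F (map g x)
  = \sum_(y : T | e p (g y))
      \sum_(x : r.-tuple T | path e (g y) (map g x)) F (g y :: map g x).
Proof.
rewrite pair_big_dep /=.
rewrite (reindex (fun z : T * r.-tuple T => [tuple of z.1 :: z.2])) /=; last first.
  exists (fun x : r.+1.-tuple T => (thead x, [tuple of behead x])) => [[y x] _|x _].
    by congr (_, _); apply: val_inj.
  by rewrite /= -tuple_eta.
by [].
Qed.

Lemma big_tuple0_path p (F : seq T' -> V) :
  \sum_(x : 0.-tuple T | path e p (map g x)) F (map g x) = F [::].
Proof.
rewrite (big_pred1 [tuple]) //= => x.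
by rewrite tuple0 /= eqxx.
Qed.

End TuplePaths.

Lemma big_tuple_ltn (V : nmodType) B r p (F : seq nat -> V) :
  \sum_(x : r.-tuple 'I_B.+1 | path ltn p (map val x)) F (map val x)
  = csum r p.+1 B.+1 F.
Proof.
elim: r p F => [|r IH] p F; first by rewrite big_tuple0_path.
rewrite big_tuple_path.
transitivity (\sum_(y < B.+1 | (p < y)%N) csum r y.+1 B.+1 (fun s => F (val y :: s))).
  by apply: eq_bigr => y _; exact: (IH (val y) (fun s => F (val y :: s))).
rewrite -(big_mkord (ltn p) (fun y => csum r y.+1 B.+1 (fun s => F (y :: s)))).
have [pB|Bp] := leqP p.+1 B.+1; last first.
  rewrite [RHS]big_geq 1?ltnW // big_nat_cond big1 // => y /= /andP[yB py]; lia.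
rewrite (@big_cat_nat _ _ _ p.+1 0) //= big_nat_cond big1 ?add0r; last first.
  by move=> y /= /andP[yp py]; lia.
rewrite [RHS]big_nat [LHS]big_nat_cond; apply: eq_bigl => j /=.
by case: (ltnP p j); rewrite ?andbT ?andbF //.
Qed.

(** * Partial fractions *)

Lemma sumn_incr_nth n j : sumn (incr_nth n j) = (sumn n).+1.
Proof.
elim: n j => [|x n IH] [|j] //=; last by rewrite IH addnS.
by elim: j => [//|j IHj] /=; rewrite IHj.
Qed.

Lemma size_incr_nth_lt n j : (j < size n)%N -> size (incr_nth n j) = size n.
Proof. by move=> jn; rewrite size_incr_nth jn. Qed.

Lemma take_incr_nth n i j : (j < size n)%N ->
  take i (incr_nth n j) = if (j < i)%N then incr_nth (take i n) j else take i n.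
Proof.
elim: n i j => [//|x n IH] [|i] [|j] //= jn.
by rewrite IH // ltnS; case: ifP.
Qed.

Lemma drop_incr_nth n i j : (j < size n)%N ->
  drop i (incr_nth n j) = if (j < i)%N then drop i n else incr_nth (drop i n) (j - i).
Proof. by elim: n i j => [//|x n IH] [|i] [|j] //= jn; rewrite IH // ltnS. Qed.

Lemma rev_incr_nth n j : (j < size n)%N ->
  incr_nth (rev n) j = rev (incr_nth n (size n - j.+1)).
Proof.
move=> jn; have sn : size (incr_nth n (size n - j.+1)) = size n.
  by rewrite size_incr_nth_lt //; lia.
apply: (@eq_from_nth _ 0%N).
  by rewrite size_incr_nth_lt ?size_rev ?sn.
move=> i; rewrite size_incr_nth_lt ?size_rev // => ilt.
rewrite nth_incr_nth !nth_rev ?sn // nth_incr_nth; congr (_ + _)%N.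
by congr nat_of_bool; apply/eqP/eqP; lia.
Qed.

Section TaylorCoefficients.
Variable K : numFieldType.

(* The coefficient of T^a in prod_j (T + d_j)^(-n_j), computed through its
   derivative -sum_j n_j (T + d_j)^(-1) prod_i (T + d_i)^(-n_i). *)
Fixpoint tay (a : nat) (n : seq nat) (d : seq K) : K :=
  if a is a'.+1 then
    - a'.+1%:R^-1 * \sum_(j < size n) (nth 0%N n j)%:R * tay a' (incr_nth n j) d
  else \prod_(j < size n) d`_j ^- nth 0%N n j.

Definition pre (f : nat -> K) (a : nat) : K := if a is a'.+1 then f a' else 0.

Lemma tayS a n d :
  a%:R * tay a n d
  = - \sum_(j < size n) (nth 0%N n j)%:R * pre (fun b => tay b (incr_nth n j) d) a.
Proof.
case: a => [|a] /=; first by rewrite mul0r big1 ?oppr0 // => j _; rewrite mulr0.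
by rewrite mulrA mulrN divff ?pnatr_eq0 // mulN1r.
Qed.

Lemma tay_incr a n d j : (j < size n)%N -> d`_j != 0 ->
  tay a n d = d`_j * tay a (incr_nth n j) d
              + pre (fun b => tay b (incr_nth n j) d) a.
Proof.
move=> jn dj0; elim: a n jn => [|a IH] n jn.
  rewrite /= addr0 size_incr_nth_lt // (bigD1 (Ordinal jn)) //=.
  rewrite [in RHS](bigD1 (Ordinal jn)) //= mulrA nth_incr_nth eqxx add1n.
  congr (_ * _); first by rewrite exprS invfM mulrA divff // mul1r.
  apply: eq_bigr => i ij; rewrite nth_incr_nth.
  by rewrite eq_sym; case: eqP => // e; rewrite -val_eqE /= e eqxx in ij.
have a0 : a.+1%:R != 0 :> K by rewrite pnatr_eq0.
apply: (mulfI a0); rewrite tayS mulrDr mulrCA tayS /= size_incr_nth_lt //.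
pose m := incr_nth n j.
have sumE (f : nat -> K) :
    \sum_(i < size n) (nth 0%N m i)%:R * f i
    = \sum_(i < size n) (nth 0%N n i)%:R * f i + f j.
  transitivity (\sum_(i < size n) ((nth 0%N n i)%:R * f i + (j == i)%:R * f i)).
    by apply: eq_bigr => i _; rewrite nth_incr_nth natrD mulrDl addrC.
  rewrite big_split /=; congr (_ + _); rewrite (bigD1 (Ordinal jn)) //= eqxx mul1r.
  rewrite big1 ?addr0 // => i ij.
  by rewrite eq_sym; case: eqP => [e|]; rewrite ?mul0r //; rewrite -val_eqE /= e eqxx in ij.
have e1 : a.+1%:R * tay a m d
    = - \sum_(i < size n) (nth 0%N n i)%:R * pre (fun b => tay b (incr_nth m i) d) a
      + d`_j * tay a (incr_nth m j) d.
  rewrite -natr1 mulrDl mul1r tayS size_incr_nth_lt //.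
  rewrite (sumE (fun i => pre (fun b => tay b (incr_nth m i) d) a)).
  rewrite (IH m) ?size_incr_nth_lt // opprD -!addrA; congr (_ + _).
  by rewrite addrCA addNr addr0.
rewrite e1 (sumE (fun i => tay a (incr_nth m i) d)).
have -> : \sum_(i < size n) (nth 0%N n i)%:R * tay a (incr_nth n i) d
    = d`_j * (\sum_(i < size n) (nth 0%N n i)%:R * tay a (incr_nth m i) d)
      + \sum_(i < size n) (nth 0%N n i)%:R * pre (fun b => tay b (incr_nth m i) d) a.
  rewrite mulr_sumr -big_split /=; apply: eq_bigr => i _.
  by rewrite (IH (incr_nth n i)) ?size_incr_nth_lt // incr_nthC mulrDr mulrCA.
by ring.
Qed.

Lemma tay_zero a n d : all (pred1 0%N) n -> tay a n d = (a == 0%N)%:R.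
Proof.
move=> /all_nthP n0; case: a => [|a] /=.
  by rewrite big1 // => j _; rewrite (eqP (n0 0%N j _)) // expr0 invr1.
by rewrite big1 ?mulr0 // => j _; rewrite (eqP (n0 0%N j _)) // mul0r.
Qed.

Lemma eq_tay a n d d' : (forall j, (j < size n)%N -> d`_j = d'`_j) ->
  tay a n d = tay a n d'.
Proof.
elim: a n => [|a IH] n dd' /=; first by apply: eq_bigr => j _; rewrite dd'.
congr (_ * _); apply: eq_bigr => j _; rewrite IH // => i.
by rewrite size_incr_nth_lt //; apply: dd'.
Qed.

Lemma tayN a n d : size d = size n ->
  tay a n (map -%R d) = (-1) ^+ (sumn n + a) * tay a n d.
Proof.
elim: a n => [|a IH] n sd /=.
  rewrite addn0 -(big_mkord xpredT (fun j => (map -%R d)`_j ^- nth 0%N n j)).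
  rewrite -(big_mkord xpredT (fun j => d`_j ^- nth 0%N n j)).
  elim: n d sd => [|x n IHn] [|z d] //=; first by rewrite !big_nil mulr1.
  case=> sd; rewrite big_nat_recl // [in RHS]big_nat_recl //= IHn // (exprNn z) invfM exprD.
  by rewrite -exprVn invrN1 mulrACA.
rewrite [RHS]mulrCA; congr (_ * _); rewrite mulr_sumr; apply: eq_bigr => j _.
by rewrite IH ?size_incr_nth_lt // sumn_incr_nth addSn -addnS mulrCA.
Qed.

Lemma tay_rev a n d : size d = size n -> tay a (rev n) (rev d) = tay a n d.
Proof.
elim: a n => [|a IH] n sd /=.
  rewrite size_rev (reindex_inj rev_ord_inj) /=; apply: eq_bigr => j _.

  have jn := ltn_ord j.
  have e : (size n - (size n - j.+1).+1 = j)%N by lia.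
  by rewrite !nth_rev ?sd ?e //; lia.
congr (_ * _); rewrite size_rev (reindex_inj rev_ord_inj) /=; apply: eq_bigr => j _.
have jn := ltn_ord j.
rewrite nth_rev; last by lia.
have -> : (size n - (size n - j.+1).+1 = j)%N by lia.
rewrite rev_incr_nth; last by lia.
have -> : (size n - (size n - j.+1).+1 = j)%N by lia.
by rewrite IH // size_incr_nth_lt.
Qed.

(* The coefficient of T^e in the expansion of prod_(j != i) (x + y_j)^(-n_j) in
   powers of T = x + y_i. *)
Definition pfc (y : seq K) (n : seq nat) (i e : nat) : K :=
  \sum_(b < e.+1)
    tay b (take i n) [seq z - y`_i | z <- take i y]
    * tay (e - b) (drop i.+1 n) [seq z - y`_i | z <- drop i.+1 y].

Lemma pfc_incr_same y n i e : (i < size n)%N ->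
  pfc y (incr_nth n i) i e = pfc y n i e.
Proof.
move=> ilt; apply: eq_bigr => b _.
by rewrite take_incr_nth // drop_incr_nth // ltnn ltnSn.
Qed.

Lemma pfc_incr y n i j e : size y = size n -> (i < size n)%N -> (j < size n)%N ->
  i != j -> y`_j != y`_i ->
  pfc y n i e = (y`_j - y`_i) * pfc y (incr_nth n j) i e
                + pre (pfc y (incr_nth n j) i) e.
Proof.
move=> sy ilt jlt ij yij; rewrite /pfc mulr_sumr.
have dy0 : y`_j - y`_i != 0 by rewrite subr_eq0.
case: (ltngtP j i) => [ji|ij'|e']; last by rewrite e' eqxx in ij.
- have dj : [seq z - y`_i | z <- take i y]`_j = y`_j - y`_i.
    by rewrite (nth_map 0) ?nth_take // size_takel // sy ltnW.
  under eq_bigr => b _.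
    rewrite (@tay_incr _ _ _ j) ?dj //; last by rewrite size_takel // ltnW.
    rewrite mulrDl -mulrA; over.
  rewrite big_split /=; congr (_ + _).
    by apply: eq_bigr => b _; rewrite take_incr_nth // drop_incr_nth // ji ltnS (ltnW ji).
  rewrite big_ord_recl /= mul0r add0r; case: e => [|e] /=; first by rewrite big_ord0.
  by apply: eq_bigr => b _; rewrite take_incr_nth // drop_incr_nth // ji ltnS (ltnW ji).
- have j1 : (i.+1 + (j - i.+1) = j)%N by rewrite subnKC.
  have dj : [seq z - y`_i | z <- drop i.+1 y]`_(j - i.+1) = y`_j - y`_i.
    rewrite (nth_map 0) ?nth_drop ?j1 // size_drop sy; lia.
  under eq_bigr => b _.
    rewrite [X in _ * X](@tay_incr _ _ _ (j - i.+1)) ?dj //; last by rewrite size_drop; lia.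
    rewrite mulrDr mulrCA; over.
  have tE : take i (incr_nth n j) = take i n by rewrite take_incr_nth // ltnNge (ltnW ij').
  have dE : drop i.+1 (incr_nth n j) = incr_nth (drop i.+1 n) (j - i.+1).
    by rewrite drop_incr_nth // ltnNge ij'.
  rewrite big_split /=; congr (_ + _); first by rewrite tE dE.
  rewrite big_ord_recr /= subnn mulr0 addr0; case: e => [|e] /=; first by rewrite big_ord0.
  by rewrite tE dE; apply: eq_bigr => b _; rewrite subSn // -ltnS.
Qed.

Section PartialFractions.
Variables (y : seq K) (x : K).
Hypothesis y_uniq : uniq y.
Hypothesis x_pole : forall i, (i < size y)%N -> x + y`_i != 0.

Let P (n : seq nat) : K := \prod_(i < size n) (x + y`_i) ^- nth 0%N n i.

Let S (n : seq nat) (i : nat) : K :=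
  \sum_(e < nth 0%N n i) pfc y n i e * (x + y`_i) ^- (nth 0%N n i - e).

Let U (n : seq nat) (i : nat) : K :=
  \sum_(e < nth 0%N n i) pre (pfc y n i) e * (x + y`_i) ^- (nth 0%N n i - e).

Let P_incr n j : size y = size n -> (j < size n)%N ->
  P n = (x + y`_j) * P (incr_nth n j).
Proof.
move=> sy jn; pose d := [seq x + z | z <- y].
have PE m : size m = size y -> P m = tay 0 m d.
  by move=> sm; apply: eq_bigr => i _; rewrite /d (nth_map 0) // -sm.
have dj : d`_j = x + y`_j by rewrite /d (nth_map 0) // sy.
by rewrite !PE ?size_incr_nth_lt // (@tay_incr _ _ _ j) ?dj ?x_pole ?sy //= addr0.
Qed.

Let S_incr n i j : size y = size n -> (i < size n)%N -> (j < size n)%N -> i != j ->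
  S n i = (y`_j - y`_i) * S (incr_nth n j) i + U (incr_nth n j) i.
Proof.
move=> sy il jl ij; rewrite /S /U nth_incr_nth eq_sym (negbTE ij) add0n.
rewrite mulr_sumr -big_split /=; apply: eq_bigr => e _.
by rewrite (pfc_incr e sy il jl ij) ?mulrDl ?mulrA // nth_uniq ?sy // eq_sym.
Qed.

Let U_incr n i : (i < size n)%N -> U (incr_nth n i) i = S n i.
Proof.
move=> il; rewrite /S /U nth_incr_nth eqxx add1n big_ord_recl /= mul0r add0r.
by apply: eq_bigr => e _; rewrite pfc_incr_same.
Qed.

Lemma partial_fractions n : size y = size n -> (0 < sumn n)%N ->
  \prod_(i < size n) (x + y`_i) ^- nth 0%N n i
  = \sum_(i < size n) \sum_(e < nth 0%N n i)
      pfc y n i e * (x + y`_i) ^- (nth 0%N n i - e).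
Proof.
rewrite -/(P n); have [k] := ubnP (sumn n).
elim: k n => [//|k IH] n nk sy n0; change (P n = \sum_(i < size n) S n i).
have /hasP[_ /(nthP 0%N)[a an <-] na] : has (fun z => 0 < z)%N n.
  apply: contraLR n0; rewrite -all_predC -leqNgt => /allP h.
  by rewrite leqn0 sumnE big1_seq // => z /andP[_ /h] /=; rewrite -leqNgt leqn0 => /eqP.
have [/existsP[[b bn] /= /andP[ba nb]]|none] :=
  boolP [exists b : 'I_(size n), (val b != a) && (0 < nth 0%N n b)%N].
- pose m := mkseq (fun i => nth 0 n i - (i == a) - (i == b))%N (size n).
  have sm : size m = size n by rewrite size_mkseq.
  have nE : n = incr_nth (incr_nth m a) b.
    apply: (@eq_from_nth _ 0%N) => [|i il]; first by rewrite !size_incr_nth_lt ?sm.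
    rewrite !nth_incr_nth nth_mkseq // eq_sym [a == i]eq_sym.
    case: (i =P a) => [->|_].
      move: na; rewrite eq_sym (negbTE ba) /=; case: (nth _ n a) => [|c] //=.
      by rewrite subn0 subn1.
    by case: (i =P b) => [->|_] /=; lia.
  have nE' : n = incr_nth (incr_nth m b) a by rewrite incr_nthC.
  pose n1 := incr_nth m a; pose n2 := incr_nth m b.
  have s1 : size n1 = size n by rewrite size_incr_nth_lt sm.
  have s2 : size n2 = size n by rewrite size_incr_nth_lt sm.
  have q1 : sumn n = (sumn n1).+1 by rewrite {1}nE sumn_incr_nth.
  have q2 : sumn n = (sumn n2).+1 by rewrite {1}nE' sumn_incr_nth.
  have yab : y`_b - y`_a != 0 by rewrite subr_eq0 nth_uniq ?sy.
  have I1 := IH n1; have I2 := IH n2.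
  rewrite s1 in I1; rewrite s2 in I2.
  have p1 : (0 < sumn n1)%N by rewrite /n1 sumn_incr_nth.
  have p2 : (0 < sumn n2)%N by rewrite /n2 sumn_incr_nth.
  have {}I1 : P n1 = \sum_(i < size n) S n1 i by apply: I1 => //; lia.
  have {}I2 : P n2 = \sum_(i < size n) S n2 i by apply: I2 => //; lia.
  apply: (mulfI yab); rewrite mulr_sumr.
  have -> : (y`_b - y`_a) * P n = P n1 - P n2.
    rewrite (@P_incr n1 b) ?s1 // (@P_incr n2 a) ?s2 // -/n1 -nE /n2 -nE'.
    by ring.
  rewrite I1 I2 -sumrB; apply: eq_bigr => -[i il] _ /=.
  have [ia|ia] := eqVneq i a.
    subst i; rewrite (@S_incr n1 a b) ?s1 // 1?eq_sym // /n1 -nE nE' U_incr ?s2 //.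
    by rewrite -nE' addrK.
  have [ib|ib] := eqVneq i b.
    subst i; rewrite (@S_incr n2 b a) ?s2 // /n2 -nE' nE U_incr ?s1 //.
    by rewrite -nE; ring.
  rewrite (@S_incr n1 i b) ?s1 // (@S_incr n2 i a) ?s2 // /n1 /n2 -nE -nE'.
  by ring.
- have z0 i : (i < size n)%N -> i != a -> nth 0%N n i = 0%N.
    move=> il ia; apply/eqP; rewrite -leqn0 leqNgt; apply/negP => ni.
    by move/existsP: none; apply; exists (Ordinal il); rewrite /= ia ni.
  have P1 : P n = (x + y`_a) ^- nth 0%N n a.
    rewrite /P (bigD1 (Ordinal an)) //= big1 ?mulr1 // => i.
    by rewrite -val_eqE /= => ia; rewrite z0 ?expr0 ?invr1.
  rewrite P1 (bigD1 (Ordinal an)) //= [X in _ = _ + X]big1 ?addr0; last first.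
    by move=> [i il]; rewrite -val_eqE /= => ia; rewrite /S z0 // big_ord0.
  have pE e : pfc y n a e = (e == 0%N)%:R.
    rewrite /pfc; under eq_bigr => b _.
      rewrite tay_zero; last first.
        apply/(all_nthP 0%N) => i; rewrite size_takel ?(ltnW an) // => ia.
        by rewrite /= nth_take // z0 ?(ltn_trans ia) // neq_ltn ia.
      rewrite tay_zero; last first.
        apply/(all_nthP 0%N) => i; rewrite size_drop => ia.
        by rewrite /= nth_drop z0 //; [lia|rewrite neq_ltn; lia].
      over.
    rewrite big_ord_recl /= mul1r subn0 big1 ?addr0 // => b _.
    by rewrite /= mul0r.
  rewrite /S; move: na; case: (nth 0%N n a) => [//|c] _.
  rewrite big_ord_recl /= pE eqxx mul1r subn0 big1 ?addr0 // => e _.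
  by rewrite pE mul0r.
Qed.

End PartialFractions.

End TaylorCoefficients.

Section WindowSums.
Variable K : numFieldType.

Definition htay (D a : nat) (n : seq nat) : K :=
  csum (size n) 1 D.+1 (fun s => tay a n [seq d%:R | d <- s]).

Lemma htayS D a n :
  a.+1%:R * htay D a.+1 n
  = - \sum_(j < size n) (nth 0%N n j)%:R * htay D a (incr_nth n j).
Proof.
rewrite /htay -csumZ (_ : csum _ _ _ _ = csum (size n) 1 D.+1 (fun s =>
  - \sum_(j < size n) (nth 0%N n j)%:R * tay a (incr_nth n j) [seq d%:R | d <- s])).
  rewrite -(raddf_csum (GRing.opp : {additive K -> K})) csum_sum; congr (- _).
  by apply: eq_bigr => j _; rewrite csumZ size_incr_nth_lt.
by apply: eq_csumr => s; rewrite (tayS a.+1).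
Qed.

(* The partial fractions of the products of the (x + s_j)^(-n_j), summed over
   s_1 < .. < s_r: the pole is -s_i, n_i - e is its order, and J1, J2 are the
   sums over the s_j on the left and on the right of s_i. *)
Definition pfsum (V : lmodType K) (J1 J2 : nat -> seq nat -> K) (n : seq nat)
    (psi : nat -> V) : V :=
  \sum_(i < size n) \sum_(e < nth 0%N n i) \sum_(b < e.+1)
    ((-1) ^+ (sumn (take i n) + b) * J1 b (rev (take i n))
     * J2 (e - b)%N (drop i.+1 n)) *: psi (nth 0%N n i - e)%N.

Lemma htay_left p b n :
  csum (size n) 0 p (fun s => tay b n [seq z - p%:R | z <- [seq d%:R : K | d <- s]])
  = (-1) ^+ (sumn n + b) * htay p b (rev n).
Proof.
rewrite (csum_reflect (p := p)) // subnn /htay size_rev -csumZ.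
apply: eq_csum => s ss /allP sp _.
rewrite -(tay_rev b (n := n)) ?size_map ?size_rev ?size_map //.
transitivity (tay b (rev n) (map -%R [seq d%:R : K | d <- s])); last first.
  by rewrite tayN ?sumn_rev // size_map size_rev.
apply: eq_tay => j; rewrite size_rev => jn.
rewrite -!map_rev revK !(nth_map 0) ?size_map ?ss // natrB; first by ring.
by have /sp/andP[_] := mem_nth 0%N (eq_rect_r (fun k => j < k)%N jn ss).
Qed.

Lemma htay_right p k c n :
  csum (size n) p.+1 (p + k).+1 (fun s => tay c n [seq z - p%:R | z <- [seq d%:R : K | d <- s]])
  = htay k c n.
Proof.
rewrite -addn1 -addnS csum_shift; apply: eq_csum => s ss _ _.
apply: eq_tay => j jn; rewrite (nth_map 0) ?size_map ?ss //.
by rewrite !(nth_map 0%N) ?size_map ?ss // natrD addrC addKr.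
Qed.

Lemma window_sum (H : nat) (x : K) n : (0 < sumn n)%N ->
  (forall p, (p < H)%N -> x + p%:R != 0) ->
  csum (size n) 0 H (fun s => \prod_(j < size n) (x + (nth 0%N s j)%:R) ^- nth 0%N n j)
  = \sum_(p < H) pfsum (htay p) (htay (H - p.+1)) n
                   (fun k => (x + p%:R) ^- k : K^o).
Proof.
move=> n0 xp.
transitivity (csum (size n) 0 H (fun s => \sum_(i < size n) \sum_(e < nth 0%N n i)
   pfc [seq d%:R | d <- s] n i e * (x + (nth 0%N s i)%:R) ^- (nth 0%N n i - e))).
  apply: eq_csum => s ss /allP sH srt.
  have sn : size [seq d%:R : K | d <- s] = size n by rewrite size_map.
  have nE i : (i < size n)%N -> [seq d%:R : K | d <- s]`_i = (nth 0%N s i)%:R.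
    by move=> il; rewrite (nth_map 0%N) ?ss.
  transitivity (\prod_(i < size n) (x + [seq d%:R | d <- s]`_i) ^- nth 0%N n i).
    by apply: eq_bigr => i _; rewrite nE.
  rewrite partial_fractions //.
  - by apply: eq_bigr => i _; apply: eq_bigr => e _; rewrite nE.
  - rewrite map_inj_uniq; last by move=> a b /eqP; rewrite eqr_nat => /eqP.
    exact: (sorted_uniq ltn_trans ltnn).
  - move=> i; rewrite sn => il; rewrite nE //; apply: xp.
    by have /sH := mem_nth 0%N (eq_rect_r (fun k => i < k)%N il ss).
rewrite csum_sum /pfsum exchange_big /=; apply: eq_bigr => -[i il] _ /=.
have szi : size (take i n) = i by rewrite size_takel // ltnW.
have szd : size (drop i.+1 n) = (size n - i.+1)%N by rewrite size_drop.
have -> : size n = (i + (size n - i.+1).+1)%N by lia.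
rewrite csum_split big_mkord; apply: eq_bigr => -[p pH] _ /=.
transitivity (csum i 0 p (fun u => csum (size n - i.+1) p.+1 H (fun v =>
  \sum_(e < nth 0%N n i) \sum_(b < e.+1) (x + p%:R) ^- (nth 0%N n i - e) *
   (tay b (take i n) [seq z - p%:R | z <- [seq d%:R : K | d <- u]]
    * tay (e - b) (drop i.+1 n) [seq z - p%:R | z <- [seq d%:R : K | d <- v]])))).
  apply: eq_csum => u su _ _; apply: eq_csumr => v.
  have nE : nth 0%N (u ++ p :: v) i = p by rewrite nth_cat su ltnn subnn.
  have yE : [seq d%:R : K | d <- u ++ p :: v]`_i = p%:R.
    by rewrite (nth_map 0%N) ?nE // size_cat su /=; lia.
  apply: eq_bigr => e _; rewrite nE mulrC mulr_sumr; apply: eq_bigr => b _.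
  rewrite yE map_cat take_size_cat ?size_map // -cat_rcons drop_size_cat //.
  by rewrite size_rcons size_map su.
rewrite {1}(_ : H = (p + (H - p.+1)).+1); last by lia.
under eq_csumr => u.
  rewrite csum_sum; under eq_bigr => e _.
    rewrite csum_sum; under eq_bigr => b _ do rewrite csumZ csumZ.
    over.
  over.
rewrite csum_sum; apply: eq_bigr => e _.
rewrite csum_sum; apply: eq_bigr => b _.
rewrite csumZ csumZr -[X in csum X _ _ _ * _]szi -szd htay_left htay_right.
by rewrite /GRing.scale /= mulrC.
Qed.

End WindowSums.

(** * The algebra I^1 and the regularised zeta values *)

Lemma mem_ideal_gen (A : comNzRingType) (S : A -> Prop) x : S x -> ideal_gen S x.
Proof.
by move=> Sx; rewrite -[x]addr0 -[x]mul1r; apply: ideal_genD => //; apply: ideal_gen0.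
Qed.

Lemma I1_map_rel x : Irel x -> I1_map x = 0.
Proof.
move=> rx; have e : quot_map Iideal x = 0.
  apply/eqP; rewrite -(rmorph0 (quot_map Iideal)) quot_map_eq subr0.
  exact/asboolP/mem_ideal_gen.
by rewrite /I1_map /= e rmorph0.
Qed.

Lemma I1_mapE a w b : I1_map (Isym a w b) = I1_gen a w b.
Proof. by []. Qed.

Lemma I1_gen_nil a b : I1_gen a [::] b = 1.
Proof.
have /eqP := I1_map_rel (Irel_I1 a b).
by rewrite rmorphB rmorph1 subr_eq0 => /eqP.
Qed.

Lemma I1_genM a b u v :
  I1_gen a u b * I1_gen a v b = \sum_(w <- shuffle u v) I1_gen a w b.
Proof.
have /eqP := I1_map_rel (Irel_I2 a b u v).
by rewrite rmorphB rmorphM rmorph_sum subr_eq0 => /eqP.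
Qed.

Lemma I1_gen_path a b x w :
  I1_gen a w b
  = \sum_(k < (size w).+1) I1_gen a (take k w) x * I1_gen x (drop k w) b.
Proof.
have /eqP := I1_map_rel (Irel_I3 a b x w).
rewrite rmorphB rmorph_sum subr_eq0 => /eqP; rewrite I1_mapE => ->.
by apply: eq_bigr => k _; rewrite rmorphM.
Qed.

Lemma I1_gen_loop a w : w != [::] -> I1_gen a w a = 0.
Proof. by move=> w0; apply: (I1_map_rel (Irel_I4 a w0)). Qed.

Lemma I1_gen_0 : I1_gen false [:: false] true = 0.
Proof.
apply/eqP; rewrite /I1_gen -(rmorph0 (quot_map I1ideal)) quot_map_eq subr0.
exact/asboolP/mem_ideal_gen.
Qed.

Lemma nseq_cat_cons (T : Type) a (x : T) s : nseq a x ++ x :: s = nseq a.+1 x ++ s.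
Proof. by elim: a => //= a ->. Qed.

Section ShuffleSums.
Variable V : nmodType.

Lemma shuffle_nilr u : shuffle u [::] = [:: u].
Proof. by case: u. Qed.

Lemma shuffle_nill u : shuffle [::] u = [:: u].
Proof. by case: u. Qed.

Lemma big_shuffle_cons x y u v (L : word -> V) :
  \sum_(w <- shuffle (x :: u) (y :: v)) L w
  = \sum_(w <- shuffle u (y :: v)) L (x :: w)
    + \sum_(w <- shuffle (x :: u) v) L (y :: w).
Proof. by rewrite /= big_cat !big_map. Qed.

Lemma big_shuffle1_cons x y v (L : word -> V) :
  \sum_(w <- shuffle [:: x] (y :: v)) L w
  = L [:: x, y & v] + \sum_(w <- shuffle [:: x] v) L (y :: w).
Proof. by rewrite big_shuffle_cons shuffle_nill big_seq1. Qed.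

Lemma big_shuffle1_nseq x a v (L : word -> V) :
  \sum_(w <- shuffle [:: x] (nseq a x ++ v)) L w
  = L (nseq a.+1 x ++ v) *+ a
    + \sum_(w <- shuffle [:: x] v) L (nseq a x ++ w).
Proof.
elim: a L => [|a IH] L; first by rewrite mulr0n add0r.
by rewrite big_shuffle1_cons IH addrA -mulrS.
Qed.

Lemma big_shuffle0_index n (L : word -> V) : is_index n ->
  \sum_(w <- shuffle [:: false] (index_word n)) L w
  = L (false :: index_word n)
    + \sum_(j < size n) L (index_word (incr_nth n j)) *+ nth 0%N n j.
Proof.
elim: n L => [|k n IH] L; first by rewrite /= big_ord0 addr0 big_seq1.
case: k => [//|k] /= ni.
rewrite big_shuffle1_cons big_shuffle1_nseq IH // big_ord_recl /=.
congr (_ + _); rewrite addrA; congr (_ + _).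
by rewrite nseq_cat_cons mulrSr.
Qed.

End ShuffleSums.

Lemma shuffle_antipode (A : pzRingType) (w : word) (L : word -> A) : w != [::] ->
  \sum_(k < (size w).+1) (-1) ^+ k
     * (\sum_(s <- shuffle (rev (take k w)) (drop k w)) L s) = 0.
Proof.
move=> w0; pose N := size w; have N0 : (0 < N)%N by rewrite lt0n size_eq0.
pose a k := \sum_(s <- shuffle (rev (take k w)) (drop k.+1 w)) L (nth false w k :: s).
have shE k : (k <= N)%N -> \sum_(s <- shuffle (rev (take k w)) (drop k w)) L s
    = (if k is k'.+1 then a k' else 0) + (if (k < N)%N then a k else 0).
  case: k => [|k] kN.
    have e0 : rev (take 0 w) = [::] :> word by rewrite take0.
    rewrite N0 add0r /a e0 drop0 !shuffle_nill !big_seq1.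
    by case: w w0 {N N0 kN a e0} => //= x w _; rewrite drop0.
  rewrite (take_nth false) // rev_rcons.
  case: ltnP => kN'.
    rewrite (drop_nth false kN') big_shuffle_cons /a -(drop_nth false kN').
    by rewrite -rev_rcons -(take_nth false).
  rewrite drop_oversize // shuffle_nilr big_seq1 addr0 /a.
  by rewrite drop_oversize // shuffle_nilr big_seq1.
transitivity (\sum_(k < N.+1) ((-1) ^+ k * (if k : nat is k'.+1 then a k' else 0 : A)
     + (-1) ^+ k * (if (k < N)%N then a k else 0))).
  by apply: eq_bigr => -[k kN] _; rewrite /= -mulrDr; congr (_ * _); exact: shE.
rewrite big_split /= big_ord_recl mulr0 add0r [X in _ + X]big_ord_recr /= ltnn mulr0 addr0.
rewrite -big_split /= big1 // => k _.
by rewrite ltn_ord exprS mulN1r mulNr addNr.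
Qed.

Lemma index_word_cat m n : index_word (m ++ n) = index_word m ++ index_word n.
Proof. by rewrite /index_word map_cat flatten_cat. Qed.

Lemma size_index_word n : is_index n -> size (index_word n) = sumn n.
Proof.
elim: n => [//|k n IH] /= /andP[k0 ni].
by rewrite size_cat size_nseq IH // -addSn prednK.
Qed.

Lemma word_index (w : word) : exists a n, is_index n /\ w = nseq a false ++ index_word n.
Proof.
elim: w => [|x w [a [n [ni ->]]]]; first by exists 0%N, [::].
by case: x; [exists 0%N, (a.+1 :: n)|exists a.+1, n].
Qed.

Lemma H1_index (w : word) : H1_word w -> exists2 n, is_index n & w = index_word n.
Proof.
have [[|a] [n [ni ->]]] := word_index w; first by exists n.
by [].
Qed.

Lemma H1_index_word n : H1_word (index_word n).
Proof. by case: n. Qed.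

Lemma shuffle_H1 u v : H1_word u -> H1_word v -> all H1_word (shuffle u v).
Proof.
case: u => [|x u] hu; first by rewrite shuffle_nill /= => ->.
case: v => [|y v]; first by move=> _; rewrite shuffle_nilr /= andbT.
by move=> hv; rewrite /= all_cat !all_map; apply/andP; split; apply/allP => w _.
Qed.

Definition I1_lead (a : nat) (n : seq nat) : I1 :=
  I1_gen false (nseq a false ++ index_word n) true.

Lemma I1_leadS a n : is_index n ->
  I1_lead a.+1 n *+ a.+1 = - \sum_(j < size n) I1_lead a (incr_nth n j) *+ nth 0%N n j.
Proof.
move=> ni; apply/eqP; rewrite -addr_eq0.
have := I1_genM false true [:: false] (nseq a false ++ index_word n).
rewrite I1_gen_0 mul0r big_shuffle1_nseq big_shuffle0_index // addrA => /esym e.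
apply/eqP; apply: etrans e.
by rewrite nseq_cat_cons -mulrSr.
Qed.

Inductive I1_span : I1 -> Prop :=
| I1_span_index n : is_index n -> I1_span (I1_index n)
| I1_span0 : I1_span 0
| I1_spanD x y : I1_span x -> I1_span y -> I1_span (x + y)
| I1_spanZ (c : rat) x : I1_span x -> I1_span (c *: x).

Lemma I1_span_sum (J : Type) (r : seq J) (P : pred J) F :
  (forall i, P i -> I1_span (F i)) -> I1_span (\sum_(i <- r | P i) F i).
Proof.
move=> h; elim/big_ind : _ => [|x y|//]; [exact: I1_span0|exact: I1_spanD].
Qed.

Lemma I1_spanMn x k : I1_span x -> I1_span (x *+ k).
Proof. by move=> hx; rewrite -scaler_nat; apply: I1_spanZ. Qed.

Lemma I1_spanN x : I1_span x -> I1_span (- x).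
Proof. by move=> hx; rewrite -scaleN1r; apply: I1_spanZ. Qed.

Lemma I1_spanM x y : I1_span x -> I1_span y -> I1_span (x * y).
Proof.
move=> hx hy; elim: hx => {x}[m mi||x x' _ IH _ IH'|c x _ IH].
- elim: hy => {y}[n ni||y y' _ IH _ IH'|c y _ IH].
  + rewrite /I1_index I1_genM big_seq; apply: I1_span_sum => w.
    move/(allP (shuffle_H1 (H1_index_word m) (H1_index_word n))) => /H1_index[k ki ->].
    exact: I1_span_index.
  + by rewrite mulr0; exact: I1_span0.
  + by rewrite mulrDr; exact: I1_spanD.
  + by rewrite -scalerAr; exact: I1_spanZ.
- by rewrite mul0r; exact: I1_span0.
- by rewrite mulrDl; exact: I1_spanD.
- by rewrite -scalerAl; exact: I1_spanZ.
Qed.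

Lemma I1_span_lead a n : is_index n -> I1_span (I1_lead a n).
Proof.
elim: a n => [|a IH] n ni; first exact: I1_span_index.
have -> : I1_lead a.+1 n = a.+1%:R^-1 *: (I1_lead a.+1 n *+ a.+1).
  by rewrite -scaler_nat scalerA mulVf ?scale1r // pnatr_eq0.
apply: I1_spanZ; rewrite I1_leadS //; apply: I1_spanN; apply: I1_span_sum => j _.
apply: I1_spanMn; apply: IH; apply/(all_nthP 0%N) => i.
rewrite size_incr_nth_lt // => il; rewrite nth_incr_nth.
by apply: leq_trans (all_nthP 0%N ni i il) (leq_addl _ _).
Qed.

Lemma I1_span1 : I1_span 1.
Proof. by rewrite -(I1_gen_nil false true); apply: (@I1_span_index [::]). Qed.

Lemma I1_gen_rev (w : word) :
  I1_gen true w false = (-1) ^+ size w * I1_gen false (rev w) true.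
Proof.
have [k] := ubnP (size w); elim: k w => [//|k IH] w wk.
have [->|w0] := eqVneq w [::]; first by rewrite !I1_gen_nil mul1r.
have := I1_gen_path true true false w; rewrite I1_gen_loop // big_ord_recr /=.
rewrite take_size drop_size I1_gen_nil mulr1 => /esym/eqP; rewrite addrC addr_eq0 => /eqP ->.
have /eqP := shuffle_antipode (fun s => I1_gen false s true) w0.
rewrite big_ord_recr /= take_size drop_size shuffle_nilr big_seq1 addrC addr_eq0 => /eqP ->.
congr (- _); apply: eq_bigr => j _.
have jw : (j < size w)%N by [].
rewrite IH; last by rewrite size_takel; [lia|exact: ltnW].
by rewrite size_takel ?(ltnW jw) // -I1_genM mulrA.
Qed.

Lemma I1_span_gen a w b : I1_span (I1_gen a w b).
Proof.
have [->|w0] := eqVneq w [::]; first by rewrite I1_gen_nil; exact: I1_span1.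
have h01 u : I1_span (I1_gen false u true).
  by have [k [n [ni ->]]] := word_index u; exact: I1_span_lead.
case: a b => [] [] //; rewrite ?I1_gen_loop //; try exact: I1_span0.
rewrite I1_gen_rev -signr_odd; case: (odd _); last by rewrite mul1r.
by rewrite mulN1r; apply: I1_spanN.
Qed.

Section ZetaValues.
Variables (R : realType) (Zsh : word -> {poly R}).
Hypothesis hZsh : is_shuffle_regularisation Zsh.
Variable zsh : {linear I1 -> R | ratr \; *%R}.
Hypothesis hzsh : forall n, is_index n -> zsh (I1_index n) = (Zsh (index_word n))`_0.

Lemma zshM x y : I1_span x -> I1_span y -> zsh (x * y) = zsh x * zsh y.
Proof.
move=> hx hy; elim: hx => {x}[m mi||x x' _ IH _ IH'|c x _ IH].
- elim: hy => {y}[n ni||y y' _ IH _ IH'|c y _ IH].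
  + rewrite !hzsh // -coef0M (Zsh_M hZsh) ?H1_index_word //.
    rewrite /I1_index I1_genM raddf_sum coef_sum /= big_seq [RHS]big_seq.
    apply: eq_bigr => w.
    move/(allP (shuffle_H1 (H1_index_word m) (H1_index_word n))) => /H1_index[k ki ->].
    exact: hzsh.
  + by rewrite mulr0 raddf0 mulr0.
  + by rewrite mulrDr !raddfD /= IH IH' mulrDr.
  + by rewrite -scalerAr !linearZ /= IH mulrCA.
- by rewrite mul0r raddf0 mul0r.
- by rewrite mulrDl !raddfD /= IH IH' mulrDl.
- by rewrite -scalerAl !linearZ /= IH mulrA.
Qed.

Lemma zsh1 : zsh 1 = 1.
Proof.
by rewrite -(I1_gen_nil false true) (hzsh (n := [::])) // (Zsh_1 hZsh) coef1.
Qed.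

Definition xi a w b : R := zsh (I1_gen a w b).

Lemma xi_nil a b : xi a [::] b = 1.
Proof. by rewrite /xi I1_gen_nil zsh1. Qed.

Lemma xi_loop a w : w != [::] -> xi a w a = 0.
Proof. by move=> w0; rewrite /xi I1_gen_loop // raddf0. Qed.

Lemma xi_rev w : xi true w false = (-1) ^+ size w * xi false (rev w) true.
Proof.
rewrite /xi I1_gen_rev -signr_odd -[in RHS]signr_odd.
by case: (odd _); rewrite ?mul1r // !mulN1r raddfN.
Qed.

Lemma xi_path w : w != [::] ->
  \sum_(k < (size w).+1) xi true (take k w) false * xi false (drop k w) true = 0.
Proof.
move=> w0; have := I1_gen_path true true false w; rewrite I1_gen_loop // => /(congr1 zsh).
rewrite raddf0 raddf_sum /= => /esym; under eq_bigr => k _.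
  rewrite zshM; [over|exact: I1_span_gen|exact: I1_span_gen].
by [].
Qed.

Definition zlead a n : R := zsh (I1_lead a n).

Lemma zleadS a n : is_index n ->
  a.+1%:R * zlead a.+1 n = - \sum_(j < size n) (nth 0%N n j)%:R * zlead a (incr_nth n j).
Proof.
move=> ni; rewrite mulr_natl /zlead -raddfMn I1_leadS // raddfN raddf_sum /=.
by congr (- _); apply: eq_bigr => j _; rewrite raddfMn mulr_natl.
Qed.

Lemma zlead0 n : all (leq 2) n -> zlead 0 n = zeta R n.
Proof.
move=> n2; have ni : is_index n by apply: sub_all n2 => k /ltnW.
rewrite /zlead [I1_lead _ _]/(I1_index n) hzsh // (Zsh_zeta hZsh) ?coefC //.
rewrite /is_admissible ni; case: (lastP n) n2 => [//|m k].
by rewrite all_rcons last_rcons => /andP[].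
Qed.

End ZetaValues.

(** * The coproduct of I(n_1, ..., n_r) *)

Lemma tensor_evalD (R : realType) (M N : lmodType rat)
    (f : {linear M -> R | ratr \; *%R})
    (g : {linear N -> (nat -> R[i]) | ratr \; *:%R}) (t u : tensor M N) (k : nat) :
  tensor_eval f g (t + u) k = tensor_eval f g t k + tensor_eval f g u k.
Proof.
pose h (p : (M * N)%type) : R[i] := (f p.1)%:C * g p.2 k.
pose ev : {additive tensor_free M N -> R[i]} :=
  monalg.mmap (ratr : {rmorphism rat -> R[i]}) h.
have evU a b : ev (tensor_sym a b) = h (a, b).
  rewrite tensor_sym.unlock /ev /= monalg.mmapU -[RHS]mul1r; congr (_ * _).
  exact: (rmorph1 (ratr : {rmorphism rat -> R[i]})).
have evZ c x : ev (c *: x) = ratr c * ev x.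
  rewrite /ev /= (monalg.mmapEw (monalg.msuppZ_le c x)) monalg.mmapE mulr_sumr.
  apply: eq_bigr => p _; rewrite monalg.mcoeffZ [RHS]mulrA; congr (_ * _).
  exact: (rmorphM (ratr : {rmorphism rat -> R[i]})).
have evrel x : tensor_rel x -> ev x = 0.
  have ratrC (c : rat) : (ratr c : R)%:C = ratr c :> R[i].
    exact: (fmorph_rat (real_complex R)).
  have realM (y z : R) : (y * z)%:C = y%:C * z%:C :> R[i].
    exact: (rmorphM (real_complex R)).
  have evB y z : ev y = ev z -> ev (y - z) = 0 by move=> e; rewrite raddfB e subrr.
  case=> {x} [a a' b|a b b'|c a b|c a b]; apply: evB.
  - by rewrite (raddfD ev) !evU /h /= raddfD rmorphD mulrDl.
  - by rewrite (raddfD ev) !evU /h /= (raddfD g) /= mulrDr.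
  - by rewrite evZ !evU /h /= linearZ /= -ratrC realM mulrA.
  - by rewrite evZ !evU /h /= linearZ /= mulrCA.
have evspan x : tensor_span x -> ev x = 0.
  elim=> [|c s {}x rs _ IH]; first exact: raddf0.
  by rewrite raddfD evZ (evrel s rs) mulr0 add0r.
have evE v : tensor_eval f g v k = ev (repr v) by [].
rewrite !evE -raddfD; apply/eqP; rewrite -subr_eq0 -raddfB; apply/eqP/evspan.
by apply/tensor_piP; rewrite tensor_piD !tensor_piK.
Qed.

(* The sum of H over the choices of letters of w in the coproduct of I(_; _; b):
   a is the last chosen letter, u the letters skipped since, c the product of
   the factors completed so far. *)
Fixpoint gsum (V : nmodType) (a b : bool) (u w : word) (c : I1)
    (H : I1 -> word -> V) : V :=
  if w is x :: w' then
    gsum a b (rcons u x) w' c H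
    + gsum x b [::] w' (c * I1_gen a u x) (fun c' s => H c' (x :: s))
  else H (c * I1_gen a u b) [::].

Lemma big_csum_recl (V : nmodType) M lo hi (f : seq nat -> V) : (lo < hi)%N ->
  \sum_(k < M.+1) csum k lo hi f
  = \sum_(k < M.+1) csum k lo.+1 hi f
    + \sum_(k < M) csum k lo.+1 hi (fun s => f (lo :: s)).
Proof.
move=> lohi; rewrite big_ord_recl [X in _ = X + _]big_ord_recl -addrA; congr (_ + _).
rewrite -big_split /=; apply: eq_bigr => k _.
by rewrite -[LHS]/(csum k.+1 lo hi f) csum_recl // addrC.
Qed.

Section Goncharov.
Variables (a b : bool) (w : word).
Let N := size w.
Let c := a :: rcons w b.
Let seg (i j : nat) : I1 :=
  I1_gen (nth false c i) (drop i.+1 (take j c)) (nth false c j).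

Fixpoint segprod (i : nat) (s : seq nat) : I1 :=
  if s is j :: s' then seg i j * segprod j s' else seg i N.+1.

Let segprodE i s k : size s = k ->
  let ix := i :: rcons s N.+1 in
  \prod_(p < k.+1) seg (nth 0%N ix p) (nth 0%N ix p.+1) = segprod i s.
Proof.
elim: s i k => [|j s IH] i k <- /=; first by rewrite big_ord1.
by rewrite big_ord_recl /= -(IH j (size s)).
Qed.

Let gsumE (V : nmodType) (H : I1 -> word -> V) d lo i c0 M :
  (lo + d = N.+1)%N -> (i < lo)%N -> (d < M)%N ->
  \sum_(k < M) csum k lo N.+1
     (fun s => H (c0 * segprod i s) [seq nth false c j | j <- s])
  = gsum (nth false c i) b (drop i.+1 (take lo c)) (drop lo.-1 w) c0 H.
Proof.
elim: d lo i c0 M H => [|d IH] lo i c0 [//|M] H.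
  rewrite addn0 => -> iN _; rewrite drop_size big_ord_recl /= big1 ?addr0; last first.
    by move=> k _; rewrite big_geq.
  by rewrite /seg {4}/c /= nth_rcons ltnn eqxx.
move=> loN ilo dM; have lolt : (lo < N.+1)%N by lia.
rewrite big_csum_recl // (IH lo.+1 i c0 M.+1 H); [|lia|lia|lia].
have lo0 : (0 < lo)%N by exact: leq_ltn_trans ilo.
have ltw : (lo.-1 < size w)%N by rewrite -/N; lia.
have xE : nth false c lo = nth false w lo.-1.
  by rewrite /c -(prednK lo0) /= nth_rcons ltw.
have szc : size c = N.+2 by rewrite /= size_rcons.
have dE : drop i.+1 (take lo.+1 c) = rcons (drop i.+1 (take lo c)) (nth false c lo).
  rewrite (take_nth false) ?szc ?drop_rcons ?size_takel ?szc //; lia.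
rewrite dE (drop_nth false ltw) prednK // -xE; congr (_ + _).
pose H' := (fun c' s => H c' (nth false c lo :: s)).
have := IH lo.+1 lo (c0 * seg i lo) M H' ltac:(lia) ltac:(lia) ltac:(lia).
rewrite drop_oversize; last by rewrite size_take; case: ifP; lia.
move=> e; apply: etrans e.
by apply: eq_bigr => k _; apply: eq_csumr => s; rewrite /= mulrA.
Qed.

Lemma goncharov_gsum :
  goncharov a w b = gsum a b [::] w 1 (fun c s => tens c (I1_gen a s b)).
Proof.
pose H (c0 : I1) s := tens c0 (I1_gen a s b).
have -> : gsum a b [::] w 1 H = gsum (nth false c 0) b (drop 1 (take 1 c)) (drop 1.-1 w) 1 H.
  by rewrite /= !drop0 take0.
rewrite -(@gsumE _ H N 1 0 1 N.+1) //.
rewrite /goncharov; apply: eq_bigr => k _.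
rewrite -big_tuple_ltn; apply: eq_bigr => i _ /=.
by rewrite mul1r -(@segprodE _ _ k) // size_map size_tuple.
Qed.

End Goncharov.

Lemma gsum_tensor_eval (R : realType)
    (f : {linear I1 -> R | ratr \; *%R})
    (g : {linear I1 -> (nat -> R[i]) | ratr \; *:%R}) k a b u w c (h : word -> I1) :
  tensor_eval f g (gsum a b u w c (fun c s => tens c (h s))) k
  = gsum a b u w c (fun c s => (f c)%:C * g (h s) k).
Proof.
elim: w a u c h => [|x w IH] a u c h /=; first by rewrite tensor_evalE.
by rewrite tensor_evalD IH (IH _ _ _ (fun s => h (x :: s))).
Qed.

Section LetterSums.
Variables (K : numFieldType) (X : bool -> word -> bool -> K).
Hypothesis X_nil : forall a b, X a [::] b = 1.
Hypothesis X_loop : forall a w, w != [::] -> X a w a = 0.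
Hypothesis X_rev : forall w, X true w false = (-1) ^+ size w * X false (rev w) true.

Fixpoint xsum (a : bool) (u w : word) (phi : word -> K) : K :=
  if w is x :: w' then
    xsum a (rcons u x) w' phi + X a u x * xsum x [::] w' (fun s => phi (x :: s))
  else X a u true * phi [::].

Fixpoint xsum1 (u w : word) (phi : word -> K) : K :=
  if w is x :: w' then
    xsum1 (rcons u x) w' phi
    + (if x then X false u true * xsum true [::] w' (fun s => phi (true :: s)) else 0)
  else X false u true * phi [::].

Let rcons_neq0 (u : word) x : rcons u x != [::].
Proof. by case: u. Qed.

Lemma xsum_false u w phi : u != [::] -> xsum false u w phi = xsum1 u w phi.
Proof.
elim: w u phi => [//|x w IH] u phi u0 /=; rewrite IH ?rcons_neq0 //.
by case: x; rewrite // X_loop // mul0r.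
Qed.

Lemma xsum_false_nil w phi : H1_word w -> xsum false [::] w phi = xsum1 [::] w phi.
Proof. by case: w => [|[] w] //= _; rewrite xsum_false. Qed.

Lemma xsum_zeros m n phi :
  xsum false [::] (nseq m false ++ index_word n) phi
  = \sum_(j < m.+1) xsum1 [::] (nseq (m - j) false ++ index_word n)
                          (fun s => phi (nseq j false ++ s)).
Proof.
elim: m phi => [|m IH] phi; first by rewrite big_ord1 /= xsum_false_nil ?H1_index_word.
rewrite big_ord_recl /= X_nil mul1r IH xsum_false // addr0; congr (_ + _).
Qed.

Definition xchunk (n : seq nat) (phi : word -> K) : K :=
  if n is k :: n' then
    xsum true [::] (nseq k.-1 false ++ index_word n') (fun s => phi (true :: s))
  else phi [::].

Lemma xsum1_nseq u m w phi :
  xsum1 u (nseq m false ++ w) phi = xsum1 (u ++ nseq m false) w phi.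
Proof.
by elim: m u => [|m IH] u /=; rewrite ?cats0 // addr0 IH cat_rcons.
Qed.

Lemma xsum1_index u n phi :
  xsum1 u (index_word n) phi
  = \sum_(j < (size n).+1) X false (u ++ index_word (take j n)) true
                           * xchunk (drop j n) phi.
Proof.
elim: n u => [|k n IH] u; first by rewrite big_ord1 /= cats0.
rewrite big_ord_recl /= cats0 addrC xsum1_nseq IH; congr (_ + _).
by apply: eq_bigr => j _; rewrite cat_rcons -catA.
Qed.

Lemma xsum_true u m w phi :
  xsum true u (nseq m false ++ w) phi
  = \sum_(b < m) X true (u ++ nseq b false) false
        * xsum false [::] (nseq (m - b.+1) false ++ w) (fun s => phi (false :: s))
    + xsum true (u ++ nseq m false) w phi.
Proof.
elim: m u => [|m IH] u; first by rewrite big_ord0 add0r cats0.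
rewrite /= IH big_ord_recl /= cats0 subn1 /= cat_rcons addrC addrA; congr (_ + _ + _).
by apply: eq_bigr => b _; rewrite cat_rcons.
Qed.

(* The letters strictly between the first and the last 1 of index_word l ++ [1]. *)
Definition inner_word (l : seq nat) : word := behead (index_word l ++ [:: true]).

Lemma inner_wordE l : true :: inner_word l = index_word l ++ [:: true].
Proof. by case: l. Qed.

Lemma index_word1 k : index_word [:: k] = true :: nseq k.-1 false.
Proof. by rewrite /index_word /= cats0. Qed.

Lemma inner_word_rcons l k :
  inner_word (rcons l k) = rcons (inner_word l ++ nseq k.-1 false) true.
Proof.
apply: (@congr1 _ _ behead (true :: _) (true :: _)).
rewrite inner_wordE -rcons_cons -cat_cons inner_wordE -cats1 index_word_cat.
by rewrite index_word1 -!catA -cats1 -!catA.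
Qed.

Lemma rev_inner_word l : rev (inner_word l) = index_word (rev l).
Proof.
suff e : rev (index_word l ++ [:: true]) = index_word (rev l) ++ [:: true].
  by move: e; rewrite -inner_wordE rev_cons cats1 => /rcons_inj[].
elim: l => [//|k l IH] /=.
rewrite rev_cons -catA rev_cat IH rev_nseq rev_cons -cats1 -[rcons _ k]cats1 index_word_cat.
by rewrite index_word1 -!catA.
Qed.

Lemma size_inner_word l : is_index l -> size (inner_word l) = sumn l.
Proof.
move=> li; have := congr1 size (inner_wordE l).
by rewrite size_cat size_index_word // addn1 => -[].
Qed.

Definition xlead (a : nat) (n : seq nat) : K :=
  X false (nseq a false ++ index_word n) true.

Lemma X_inner l b : is_index l ->
  X true (inner_word l ++ nseq b false) false = (-1) ^+ (sumn l + b) * xlead b (rev l).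
Proof.
by move=> li; rewrite X_rev size_cat size_inner_word // size_nseq rev_cat rev_nseq rev_inner_word.
Qed.

Lemma xsum_inner l k n phi : all (leq 2) (k :: n) ->
  xsum true (inner_word l) (nseq k.-1 false ++ index_word n) phi
  = \sum_(i < (size n).+1) \sum_(b < (nth 0%N (k :: n) i).-1)
      X true (inner_word (l ++ take i (k :: n)) ++ nseq b false) false
      * xsum false [::] (nseq ((nth 0%N (k :: n) i).-1 - b.+1) false
                         ++ index_word (drop i n)) (fun s => phi (false :: s)).
Proof.
elim: n l k => [|k' n IH] l k /=; rewrite big_ord_recl /= cats0 xsum_true.
  case/andP=> k2 _; congr (_ + _); rewrite big_ord0 /= X_loop ?mul0r //.
  by case: (inner_word l) => [|? ?] //; case: k k2 => [|[]].
case/andP=> k2 nk; congr (_ + _).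
have u0 : inner_word l ++ nseq k.-1 false != [::].
  by case: (inner_word l) => [|? ?] //; case: k k2 => [|[]].
rewrite -[index_word _]/(true :: (nseq k'.-1 false ++ index_word n)) [LHS]/=.
rewrite X_loop // mul0r addr0 -inner_word_rcons IH //.
by apply: eq_bigr => i _; rewrite cat_rcons.
Qed.

Lemma exchange_big_antidiagonal (V : nmodType) n (F : nat -> nat -> V) :
  \sum_(b < n) \sum_(a < n - b) F b a = \sum_(e < n) \sum_(b < e.+1) F b (e - b)%N.
Proof.
elim: n => [|n IH]; first by rewrite !big_ord0.
rewrite [RHS]big_ord_recr /= -IH [X in _ = _ + X]big_ord_recr /= subnn addrA -big_split /=.
rewrite big_ord_recr /= subSnn big_ord1; congr (_ + _).
by apply: eq_bigr => b _; rewrite subSn ?(ltnW (ltn_ord b)) // big_ord_recr.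
Qed.

Lemma big_poles (V : nmodType) N (F : nat -> nat -> nat -> V) : (0 < N)%N ->
  (forall p b a, (p < 2)%N -> F p b a = 0) ->
  \sum_(b < N.-1) \sum_(p < (N.-1 - b.+1).+1) F p.+2 b (N.-1 - b.+1 - p)%N
  = \sum_(e < N) \sum_(b < e.+1) F (N - e)%N b (e - b)%N.
Proof.
case: N => [//|N] _ F0; rewrite [RHS]big_ord_recr /= [X in _ = _ + X]big1 ?addr0; last first.
  by move=> b _; apply: F0; rewrite subSnn.
transitivity (\sum_(b < N) \sum_(a < N - b) F (N.+1 - (b + a))%N b a).
  apply: eq_bigr => -[b bN] _ /=; rewrite -subSn // subSS.
  rewrite (reindex_inj rev_ord_inj) /=; apply: eq_bigr => -[a aN] _ /=.
  by congr F; lia.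
rewrite (exchange_big_antidiagonal N (fun b a => F (N.+1 - (b + a))%N b a)).
apply: eq_bigr => e _; apply: eq_bigr => -[b be] _ /=.
by rewrite subnKC // -ltnS.
Qed.

(* The coefficients of the coproduct of I(n_1, ..., n_r) on the words
   without the letter 11: cut n into blocks, and replace each block by its
   partial fraction poles of order at least 2. *)
Fixpoint blocksum (f : nat) (n : seq nat) (phi : seq nat -> K) : K :=
  match f, n with
  | f'.+1, _ :: _ =>
      \sum_(j < size n) pfsum xlead xlead (take j.+1 n)
        (fun k => (if (2 <= k)%N
                   then blocksum f' (drop j.+1 n) (fun s => phi (k :: s)) else 0) : K^o)
  | _, _ => phi [::]
  end.

Lemma xchunk_blocksum f n phi : (size n <= f)%N -> all (leq 2) n ->
  xchunk n phi = blocksum f n (fun s => phi (index_word s)).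
Proof.
elim: f n phi => [|f IH] [|k n] phi // nf n2.
have ni : is_index (k :: n) by apply: sub_all n2 => ? /ltnW.
rewrite [blocksum _ _ _]/=.
have -> : xchunk (k :: n) phi = xsum true (inner_word [::])
    (nseq k.-1 false ++ index_word n) (fun s => phi (true :: s)) by [].
rewrite xsum_inner //.
pose nk := k :: n; pose t := size nk.
pose G (i j : nat) (p : nat) (b a : nat) : K :=
  (-1) ^+ (sumn (take i nk) + b) * xlead b (rev (take i nk))
   * xlead a (take (j - i.+1) (drop i.+1 nk))
   * (if (2 <= p)%N
      then blocksum f (drop j nk) (fun s => phi (index_word (p :: s))) else 0).
transitivity (\sum_(i < t) \sum_(j < t - i)
    \sum_(e < nth 0%N nk i) \sum_(b < e.+1) G i (i.+1 + j)%N (nth 0%N nk i - e)%N b (e - b)%N);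
    last first.
  pose F i j := \sum_(e < nth 0%N nk i) \sum_(b < e.+1)
    G i (i.+1 + j)%N (nth 0%N nk i - e)%N b (e - b)%N.
  rewrite (exchange_big_antidiagonal t F); apply: eq_bigr => -[j jt] _.
  rewrite /= -[k :: take j n]/(take j.+1 nk) /pfsum size_takel //; apply: eq_bigr => -[i ij] _ /=.
  have ijE : (i.+1 + (j - i) = j.+1)%N by rewrite addSn subnKC.
  rewrite -[k :: take j n]/(take j.+1 nk) -[drop i (take j n)]/(drop i.+1 (take j.+1 nk)).
  rewrite /F nth_take //; apply: eq_bigr => e _; apply: eq_bigr => b _.
  have -> : drop i.+1 (take j.+1 nk) = take (j.+1 - i.+1) (drop i.+1 nk).
    by rewrite take_drop subnK.
  by rewrite /G ijE take_takel // ltnW.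
apply: eq_bigr => -[i it] _ /=; have il : (i <= size n)%N by [].
have nki : (2 <= nth 0%N nk i)%N by exact: (all_nthP 0%N n2).
rewrite exchange_big /=; under [RHS]eq_bigr => e _ do rewrite exchange_big /=.
have poleE := @big_poles _ (nth 0%N nk i) (fun p b a => \sum_(j < t - i) G i (i.+1 + j)%N p b a).
rewrite -poleE; last first.
- by move=> p b a p2; rewrite big1 // => j _; rewrite /G leqNgt p2 mulr0.
- exact: ltnW.
apply: eq_bigr => -[b bn] _ /=.
have li : is_index (take i nk).
  by apply/allP => z /mem_take zn; apply: (allP ni).
rewrite X_inner // xsum_zeros mulr_sumr; apply: eq_bigr => -[p pn] _ /=.
rewrite xsum1_nseq xsum1_index mulr_sumr size_drop.
rewrite -[in LHS]subSn // -/t; apply: eq_bigr => -[j jt] _ /=.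
have e1 : (i.+1 + j - i.+1 = j)%N by rewrite addKn.
rewrite /G e1 drop_drop [(j + i)%N]addnC mulrA.
rewrite (IH (drop (i + j) n)); first by [].
  by rewrite size_drop; apply: leq_trans (leq_subr _ _) _; rewrite -ltnS.
by apply/allP => z /mem_drop zn; apply: (allP n2); rewrite in_cons zn orbT.
Qed.

Lemma xsum_blocksum n phi : all (leq 2) n ->
  xsum false [::] (index_word n) phi
  = \sum_(j < (size n).+1) xlead 0 (take j n)
      * blocksum (size n) (drop j n) (fun s => phi (index_word s)).
Proof.
move=> n2; rewrite xsum_false_nil ?H1_index_word // xsum1_index.
apply: eq_bigr => j _; rewrite (@xchunk_blocksum (size n)) //.
  by rewrite size_drop leq_subr.
by apply/allP => z /mem_drop zn; apply: (allP n2).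
Qed.

(* Every splitting of inner_word n leaves two factors, so this is the path
   composition formula for the loop I(1; inner_word n; 1) = 0. *)
Lemma simple_poles_cancel n : n != [::] -> all (leq 2) n ->
  (forall w, w != [::] ->
     \sum_(k < (size w).+1) X true (take k w) false * X false (drop k w) true = 0) ->
  pfsum xlead xlead n (fun k => (k == 1%N)%:R : K^o) = 0.
Proof.
move=> n0 n2 X_path; have ni : is_index n by apply: sub_all n2 => ? /ltnW.
have splitE l m : is_index m ->
   \sum_(i < size m) \sum_(b < nth 0%N m i)
      X true (inner_word (l ++ take i m) ++ nseq b false) false
      * X false (nseq (nth 0%N m i - b.+1) false ++ index_word (drop i.+1 m)) true
   = \sum_(k < sumn m)
       X true (inner_word l ++ take k (behead (index_word m))) false
       * X false (drop k (behead (index_word m))) true.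
  elim: m l => [|k m IH] l; first by rewrite !big_ord0.
  case/andP=> k0 mi; rewrite big_ord_recl /= cats0 big_split_ord /=; congr (_ + _).
    apply: eq_bigr => -[b bk] _ /=; have bk' : (b <= k.-1)%N by rewrite -ltnS prednK.
    rewrite take_cat drop_cat size_nseq drop0; congr (X _ (_ ++ _) _ * X _ _ _).
      case: ltnP => kb; first by rewrite take_nseq 1?ltnW.
      have -> : b = k.-1 by lia.
      by rewrite subnn take0 cats0.
    case: ltnP => kb; first by rewrite drop_nseq; congr (nseq _ _ ++ _); lia.
    have -> : b = k.-1 by lia.
    by rewrite subnn drop0 prednK // subnn.
  transitivity (\sum_(i < size m) \sum_(b < nth 0%N m i)
      X true (inner_word (rcons l k ++ take i m) ++ nseq b false) false
      * X false (nseq (nth 0%N m i - b.+1) false ++ index_word (drop i.+1 m)) true).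
    by apply: eq_bigr => i _; rewrite cat_rcons.
  rewrite IH // inner_word_rcons; apply: eq_bigr => -[b bm] _ /=.
  have kb : (k + b - k.-1 = b.+1)%N by lia.
  have kb' : (k + b < k.-1)%N = false by lia.
  rewrite take_cat drop_cat size_nseq kb kb'.
  by case: m mi {IH} bm => [|k' m] //= _ bm; rewrite cat_rcons -!catA.
have {}splitE := splitE [::] n ni.
transitivity (\sum_(i < size n) \sum_(b < nth 0%N n i)
      X true (inner_word ([::] ++ take i n) ++ nseq b false) false
      * X false (nseq (nth 0%N n i - b.+1) false ++ index_word (drop i.+1 n)) true).
  apply: eq_bigr => -[i il] _ /=; move: (all_nthP 0%N n2 i il).
  case: (nth 0%N n i) => [//|m] _; rewrite big_ord_recr /= [X in X + _]big1 ?add0r; last first.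
    move=> -[e em] _; rewrite big1 // => b _.
    by rewrite (_ : (_ == _) = false) ?scaler0 //=; apply/eqP; lia.
  apply: eq_bigr => -[b bm] _ /=; rewrite subSnn eqxx X_inner.
    by rewrite /GRing.scale /= mulr1 subSS.
  by apply/allP => z /mem_take zn; apply: (allP ni).
rewrite splitE.
have w0 : behead (index_word n) != [::] by case: n n0 n2 {ni splitE} => [|[|[|k]] n].
have := X_path _ w0; rewrite size_behead size_index_word // prednK //.
by case: n n0 ni {n2 splitE w0} => [//|[|k] n].
Qed.

End LetterSums.

Section CoproductValues.
Variables (R : realType) (Zsh : word -> {poly R}).
Hypothesis hZsh : is_shuffle_regularisation Zsh.
Variable zsh : {linear I1 -> R | ratr \; *%R}.
Hypothesis hzsh : forall n, is_index n -> zsh (I1_index n) = (Zsh (index_word n))`_0.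
Variable gsh : {linear I1 -> (nat -> R[i]) | ratr \; *:%R}.
Variable Delta : {linear I1 -> tensor I1 I1}.
Hypothesis hDelta : forall a w b, Delta (I1_gen a w b) = goncharov a w b.

Definition cxi (a : bool) (w : word) (b : bool) : R[i] := (xi zsh a w b)%:C.

Lemma cxi_nil a b : cxi a [::] b = 1.
Proof. by rewrite /cxi (xi_nil hZsh hzsh). Qed.

Lemma cxi_loop a w : w != [::] -> cxi a w a = 0.
Proof. by move=> w0; rewrite /cxi xi_loop. Qed.

Lemma cxi_rev w : cxi true w false = (-1) ^+ size w * cxi false (rev w) true.
Proof. by rewrite /cxi xi_rev rmorphM rmorphXn rmorphN1. Qed.

Lemma cxi_path w : w != [::] ->
  \sum_(k < (size w).+1) cxi true (take k w) false * cxi false (drop k w) true = 0.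
Proof.
move=> w0; have := congr1 (real_complex R) (xi_path hZsh hzsh w0).
by rewrite rmorph0 rmorph_sum /=; under eq_bigr => k _ do rewrite rmorphM.
Qed.

Lemma gsum_xsum a u w c (phi : word -> R[i]) : I1_span c ->
  gsum a true u w c (fun c s => (zsh c)%:C * phi s)
  = (zsh c)%:C * xsum cxi a u w phi.
Proof.
elim: w a u c phi => [|x w IH] a u c phi hc /=.
  by rewrite (zshM hZsh hzsh) ?rmorphM ?mulrA //; exact: I1_span_gen.
rewrite IH // (IH _ _ _ (fun s => phi (x :: s))); last first.
  by apply: I1_spanM => //; exact: I1_span_gen.
by rewrite (zshM hZsh hzsh) ?rmorphM ?mulrDr ?mulrA //; exact: I1_span_gen.
Qed.

Lemma Gsh_blocksum n k : all (leq 2) n ->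
  Gsh Delta zsh gsh n k
  = \sum_(j < (size n).+1) (zlead zsh 0 (take j n))%:C
      * blocksum cxi (size n) (drop j n) (fun s => gsh (I1_index s) k).
Proof.
move=> n2; rewrite /Gsh /I1_index hDelta goncharov_gsum gsum_tensor_eval.
rewrite (gsum_xsum _ _ _ (fun s => gsh (I1_gen false s true) k)); last exact: I1_span1.
rewrite (zsh1 hZsh hzsh) mul1r.
exact: (xsum_blocksum cxi_nil cxi_loop cxi_rev).
Qed.

End CoproductValues.

(** * Limits of sequences *)

Section SequenceLimits.
Variable K : numFieldType.
Implicit Types (u v : nat -> K) (a b l : K).

Definition tends u l : Prop :=
  forall eps : K, 0 < eps -> exists N, forall n, (N <= n)%N -> `|l - u n| < eps.

Lemma eq_tends u v l : u =1 v -> tends u l -> tends v l.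
Proof.
by move=> uv ul eps /ul[N h]; exists N => n /h; rewrite uv.
Qed.

Lemma tends_cst a : tends (fun=> a) a.
Proof. by move=> eps eps0; exists 0%N => n _; rewrite subrr normr0. Qed.

Lemma tends2 u v l m : tends u l -> tends v m -> forall eps : K, 0 < eps ->
  exists N, forall n, (N <= n)%N -> `|l - u n| < eps /\ `|m - v n| < eps.
Proof.
move=> ul vm eps eps0; have [N1 h1] := ul _ eps0; have [N2 h2] := vm _ eps0.
by exists (maxn N1 N2) => n; rewrite geq_max => /andP[/h1 ? /h2].
Qed.

Lemma tendsD u v l m : tends u l -> tends v m -> tends (fun n => u n + v n) (l + m).
Proof.
move=> ul vm eps eps0; have e2 : 0 < eps / 2 by rewrite divr_gt0 ?ltr0n.
have [N h] := tends2 ul vm e2; exists N => n /h[h1 h2].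
rewrite opprD addrACA; apply: le_lt_trans (ler_normD _ _) _.
by rewrite [eps]splitr ltrD.
Qed.

Lemma tendsZ c u l : tends u l -> tends (fun n => c * u n) (c * l).
Proof.
move=> ul eps eps0; have c0 : 0 < `|c| + 1 by rewrite ltr_pwDr ?normr_ge0.
have [N h] := ul _ (divr_gt0 eps0 c0); exists N => n /h hn.
rewrite -mulrBr normrM; apply: le_lt_trans (_ : (`|c| + 1) * `|l - u n| < _).
  by rewrite ler_wpM2r // lerDl.
by rewrite mulrC -ltr_pdivlMr.
Qed.

Lemma tendsN u l : tends u l -> tends (fun n => - u n) (- l).
Proof.
by move=> /(tendsZ (-1)); rewrite mulN1r; apply: eq_tends => n; rewrite mulN1r.
Qed.

Lemma tendsB u v l m : tends u l -> tends v m -> tends (fun n => u n - v n) (l - m).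
Proof. by move=> ul vm; apply: tendsD ul (tendsN vm). Qed.

Lemma tends_squeeze u v l : (forall n, `|l - u n| <= v n) -> tends v 0 -> tends u l.
Proof.
move=> uv v0 eps eps0; have [N h] := v0 _ eps0; exists N => n /h.
rewrite sub0r normrN ger0_norm; first exact: le_lt_trans.
exact: le_trans (normr_ge0 _) (uv n).
Qed.

Lemma tendsM u v l m : tends u l -> tends v m -> tends (fun n => u n * v n) (l * m).
Proof.
move=> ul vm.
have h0 : tends (fun n => (l - u n) * (m - v n)) 0.
  move=> eps eps0; have e1 : 0 < eps / (eps + 1) by rewrite divr_gt0 ?addr_gt0.
  have [N h] := tends2 ul vm e1; exists N => n /h[h1 h2].
  rewrite sub0r normrN normrM; apply: le_lt_trans (ler_pM _ _ (ltW h1) (ltW h2)) _ => //.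
  apply: lt_le_trans (_ : eps / (eps + 1) * 1 <= _).
    by rewrite ltr_pM2l // ltr_pdivrMr ?addr_gt0 // mul1r ltrDl.
  by rewrite mulr1 ler_pdivrMr ?addr_gt0 // mulrDr mulr1 lerDr mulr_ge0 ?ltW.
have := tendsD h0 (tendsB (tendsD (tendsZ l vm) (tendsZ m ul)) (tends_cst (l * m))).
rewrite add0r [m * l]mulrC addrK; apply: eq_tends => n; ring.
Qed.

Lemma tendsX u l k : tends u l -> tends (fun n => u n ^+ k) (l ^+ k).
Proof.
move=> ul; elim: k => [|k IH]; first exact: tends_cst.
by rewrite exprS; apply: (eq_tends _ (tendsM ul IH)) => n; rewrite exprS.
Qed.

Lemma tendsV u l : l != 0 -> tends u l -> tends (fun n => (u n)^-1) l^-1.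
Proof.
move=> l0 ul eps eps0; have nl0 : 0 < `|l| by rewrite normr_gt0.
have l2 : 0 < `|l| / 2 by rewrite divr_gt0 ?ltr0n.
have e2 : 0 < eps * (`|l| * (`|l| / 2)) by rewrite !mulr_gt0 ?invr_gt0 ?ltr0n.
have [N1 h1] := ul _ l2; have [N2 h2] := ul _ e2.
exists (maxn N1 N2) => n; rewrite geq_max => /andP[/h1 k1 /h2 k2].
have un : `|l| / 2 <= `|u n|.
  have q : `|l| - `|l - u n| <= `|u n|.
    by have := lerB_dist l (l - u n); rewrite subKr.
  apply: le_trans q; rewrite [X in _ <= X - _]splitr -addrA lerDl subr_ge0.
  exact: ltW.
have un0 : u n != 0 by rewrite -normr_gt0; apply: lt_le_trans un.
have -> : l^-1 - (u n)^-1 = - ((l - u n) / (l * u n)) by field; rewrite l0 un0.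
rewrite normrN normrM normfV normrM ltr_pdivrMr ?mulr_gt0 ?normr_gt0 //.
apply: lt_le_trans k2 _; rewrite ler_pM2l // ler_pM2l //.
Qed.

Lemma tends_sum (I : Type) (r : seq I) (P : pred I) (F : I -> nat -> K) (l : I -> K) :
  (forall i, P i -> tends (F i) (l i)) ->
  tends (fun n => \sum_(i <- r | P i) F i n) (\sum_(i <- r | P i) l i).
Proof.
move=> h; elim: r => [|i r IH].
  by rewrite big_nil; apply: eq_tends (tends_cst 0) => n; rewrite big_nil.
rewrite big_cons; case: ifPn => Pi; last first.
  by apply: eq_tends IH => n; rewrite big_cons (negbTE Pi).
by apply: eq_tends (tendsD (h i Pi) IH) => n; rewrite big_cons Pi.
Qed.

Lemma tends_prod (I : Type) (r : seq I) (P : pred I) (F : I -> nat -> K) (l : I -> K) :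
  (forall i, P i -> tends (F i) (l i)) ->
  tends (fun n => \prod_(i <- r | P i) F i n) (\prod_(i <- r | P i) l i).
Proof.
move=> h; elim: r => [|i r IH].
  by rewrite big_nil; apply: eq_tends (tends_cst 1) => n; rewrite big_nil.
rewrite big_cons; case: ifPn => Pi; last first.
  by apply: eq_tends IH => n; rewrite big_cons (negbTE Pi).
by apply: eq_tends (tendsM (h i Pi) IH) => n; rewrite big_cons Pi.
Qed.

Lemma tends_norm u l : tends u l -> tends (fun n => `|u n|) `|l|.
Proof.
by move=> ul eps /ul[N h]; exists N => n /h; apply: le_lt_trans (ler_dist_dist _ _).
Qed.

Lemma tends_sub u l (phi : nat -> nat) : (forall n, (n <= phi n)%N) ->
  tends u l -> tends (fun n => u (phi n)) l.
Proof.
move=> hphi ul eps /ul[N h]; exists N => n Nn; apply: h; exact: leq_trans Nn (hphi n).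
Qed.

Lemma tends_le_norm u l B : (forall n, `|u n| <= B) -> tends u l -> `|l| <= B.
Proof.
move=> uB ul; have B0 : 0 <= B := le_trans (normr_ge0 _) (uB 0%N).
rewrite real_leNgt ?normr_real ?ger0_real //; apply/negP => Bl.
have d0 : 0 < `|l| - B by rewrite subr_gt0.
have [N h] := ul _ d0; have := h N (leqnn N).
have : `|l| - B <= `|l - u N|.
  by apply: le_trans (lerB_dist _ _); rewrite lerB.
by move=> /le_lt_trans h' /h'; rewrite ltxx.
Qed.

Definition small_tail (g : nat -> K) : Prop :=
  forall eps : K, 0 < eps -> exists W, forall V, \sum_(W <= m < V) g m <= eps.

Lemma small_tailZ c g : 0 < c -> small_tail g -> small_tail (fun m => c * g m).
Proof.
move=> c0 sg eps eps0; have [W h] := sg _ (divr_gt0 eps0 c0).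
by exists W => V; rewrite -big_distrr /= mulrC -ler_pdivlMr.
Qed.

Lemma tannery (f : nat -> nat -> K) (F g : nat -> K) (N : nat -> nat) :
  (forall m, tends (f ^~ m) (F m)) ->
  (forall M m, (m < N M)%N -> `|f M m| <= g m) -> (forall m, `|F m| <= g m) ->
  small_tail g -> tends (fun M => \sum_(m < N M) (f M m - F m)) 0.
Proof.
move=> fF fg Fg sg.
have g0 m : 0 <= g m by apply: le_trans (normr_ge0 _) (Fg m).
move=> eps eps0; have e4 : 0 < eps / 4 by rewrite divr_gt0 ?ltr0n.
have [W tail] := sg _ e4.
pose h M := \sum_(m < W) `|f M m - F m|.
have h0 : tends h 0.
  have <- : \sum_(m < W) (0 : K) = 0 by rewrite big1.
  apply: tends_sum => m _; have := tends_norm (tendsB (fF m) (tends_cst (F m))).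
  by rewrite subrr normr0.
have [M0 hM] := h0 _ e4; exists M0 => M /hM.
rewrite !sub0r !normrN ger0_norm ?sumr_ge0 // => hlt.
apply: le_lt_trans (ler_norm_sum _ _ _) _.
have le2 m : (m < N M)%N -> `|f M m - F m| <= 2 * g m.
  move=> mN; apply: le_trans (ler_normB _ _) _.
  by rewrite mulr_natl mulr2n lerD ?fg.
have bound : \sum_(m < N M) `|f M m - F m| <= h M + 2 * \sum_(W <= m < N M) g m.
  have [NW|WN] := leqP (N M) W.
    rewrite [X in 2 * X]big_geq // mulr0 addr0 /h -(subnKC NW) big_split_ord /=.
    by rewrite lerDl sumr_ge0.
  rewrite /h -(big_mkord xpredT (fun m => `|f M m - F m|)).
  rewrite (@big_cat_nat _ _ _ W) //= 1?ltnW // big_mkord lerD2l.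
  rewrite big_distrr /= !big_nat; apply: ler_sum => m /andP[_ mN]; exact: le2.
apply: le_lt_trans bound _; apply: lt_le_trans (_ : eps / 4 + 2 * (eps / 4) <= _).
  by rewrite ltr_leD // ler_pM2l ?ltr0n.
have -> : eps / 4 + 2 * (eps / 4) = eps * (3 / 4) by field.
by rewrite ger_pMr // ler_pdivrMr ?ltr0n // mul1r ler_nat.
Qed.

Lemma tannery_series (f : nat -> nat -> K) (F g : nat -> K) (A : nat -> K) (B : K) :
  (forall m, tends (f ^~ m) (F m)) ->
  (forall M m, `|f M m| <= g m) -> (forall m, `|F m| <= g m) -> small_tail g ->
  (forall M, tends (fun V => \sum_(m < V) f M m) (A M)) ->
  tends (fun V => \sum_(m < V) F m) B -> tends A B.
Proof.
move=> fF fg Fg sg fA FB eps eps0.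
have e4 : 0 < eps / 4 by rewrite divr_gt0 ?ltr0n.
have near M : exists V, (M <= V)%N /\
    `|A M - \sum_(m < V) f M m| < eps / 4 /\ `|B - \sum_(m < V) F m| < eps / 4.
  have [N h] := tends2 (fA M) FB e4; exists (maxn M N).
  by split; [exact: leq_maxl|apply: h; exact: leq_maxr].
pose N M := projT1 (cid (near M)).
have hN M := projT2 (cid (near M)).
have [M0 h] := tannery (N := N) fF (fun M m _ => fg M m) Fg sg e4.
exists M0 => M /h; rewrite sub0r normrN sumrB => h1.
have [_ [h2 h3]] := hN M; rewrite -/(N M) in h2 h3.
have -> : B - A M = (B - \sum_(m < N M) F m)
    - ((A M - \sum_(m < N M) f M m) + (\sum_(m < N M) f M m - \sum_(m < N M) F m)).
  by ring.
apply: le_lt_trans (ler_normB _ _) _.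
apply: le_lt_trans (lerD (lexx _) (ler_normD _ _)) _.
apply: lt_le_trans (ltrD h3 (ltrD h2 h1)) _.
have -> : eps / 4 + (eps / 4 + eps / 4) = eps * (3 / 4) by field.
by rewrite ger_pMr // ler_pdivrMr ?ltr0n // mul1r ler_nat.
Qed.

(* Pascal's rule, in the form needed for the expansion of (1 - x)^-(k + 1). *)
Lemma bin_geometricS k J (x : K) :
  (1 - x) * (\sum_(j < J) 'C(j + k.+1, k.+1)%:R * x ^+ j)
  = \sum_(j < J) 'C(j + k, k)%:R * x ^+ j - 'C(J + k, k.+1)%:R * x ^+ J.
Proof.
elim: J => [|J IH]; first by rewrite !big_ord0 mulr0 add0n bin_small // mul0r subr0.
rewrite !big_ord_recr /= mulrDr IH.
by rewrite addSn addnS !binS !natrD exprS; ring.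
Qed.

Lemma bin_geometric0 J (x : K) :
  (1 - x) * (\sum_(j < J) 'C(j + 0, 0)%:R * x ^+ j) = 1 - x ^+ J.
Proof.
rewrite -[RHS]opprB subrX1 -mulNr opprB; congr (_ * _).
by apply: eq_bigr => j _; rewrite bin0 mul1r.
Qed.

Lemma bin_geometric_le k J (x : K) : 0 <= x < 1 ->
  \sum_(j < J) 'C(j + k, k)%:R * x ^+ j <= (1 - x) ^- k.+1.
Proof.
case/andP=> x0 x1; have d0 : 0 < 1 - x by rewrite subr_gt0.
elim: k => [|k IH].
  by rewrite expr1 -(ler_pM2l d0) bin_geometric0 divff ?gt_eqF // lerBlDr lerDl exprn_ge0.
rewrite -(ler_pM2l d0) bin_geometricS [X in _ <= _ * X^-1]exprS invfM mulVKf ?gt_eqF //.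
by apply: le_trans IH; rewrite lerBlDr lerDl mulr_ge0 ?exprn_ge0.
Qed.

End SequenceLimits.

Section RealSequences.
Variable R : realType.

Lemma tends_cvg (u : nat -> R) (l : R) : u @ \oo --> l -> tends u l.
Proof.
move=> /cvgrPdist_lt h eps /h [N _ hN]; exists N => n Nn; exact: hN.
Qed.

Lemma bounded_series_cvg (g : nat -> R) B : (forall m, 0 <= g m) ->
  (forall V, \sum_(m < V) g m <= B) -> cvgn (series g).
Proof.
move=> g0 gB; apply: nondecreasing_is_cvgn.
  by apply/nondecreasing_seqP => n; rewrite seriesSr lerDl.
by exists B => _ [V _ <-]; rewrite /series /= big_mkord.
Qed.

Lemma bounded_series_small (g : nat -> R) B : (forall m, 0 <= g m) ->
  (forall V, \sum_(m < V) g m <= B) -> small_tail g.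
Proof.
move=> g0 gB eps eps0; have gc := bounded_series_cvg g0 gB.
have [W h] := tends_cvg gc eps0; exists W => V.
have le V' : series g V' <= limn (series g).
  apply: nondecreasing_cvgn_le => //.
  by apply/nondecreasing_seqP => n; rewrite seriesSr lerDl.
have [VW|WV] := leqP V W; first by rewrite big_geq // ltW.
have := h W (leqnn W); rewrite ger0_norm ?subr_ge0 // => /ltW.
apply: le_trans; rewrite lerBrDr.
apply: le_trans (le V); rewrite /series /= addrC -big_cat_nat //; exact: ltnW.
Qed.

Lemma bounded_series_terms (g : nat -> R) B : (forall m, 0 <= g m) ->
  (forall V, \sum_(m < V) g m <= B) -> tends g 0.
Proof.
by move=> g0 gB; apply: tends_cvg; apply: cvg_series_cvg_0; exact: bounded_series_cvg gB.
Qed.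

Local Notation C := R[i].

Definition cabs (z : C) : R := complex.Re `|z|.

Lemma cabsE z : `|z| = (cabs z)%:C.
Proof. by rewrite /cabs RRe_real ?normr_real. Qed.

Lemma cabs_ge0 z : 0 <= cabs z.
Proof. by rewrite -lecR -cabsE normr_ge0. Qed.

Lemma cabs_real (x : R) : cabs x%:C = `|x|.
Proof.
apply: (@complexI R); rewrite -cabsE normc_def /= expr0n addr0 sqrtr_sqr //.
Qed.

Lemma norm_real (x : R) : `|x%:C| = `|x|%:C.
Proof. by rewrite cabsE cabs_real. Qed.

Lemma cabsM y z : cabs (y * z) = cabs y * cabs z.
Proof. by apply: (@complexI R); rewrite rmorphM /= -!cabsE normrM. Qed.

Lemma cabsV z : cabs z^-1 = (cabs z)^-1.
Proof. by apply: (@complexI R); rewrite fmorphV /= -!cabsE normfV. Qed.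

Lemma cabsX z k : cabs (z ^+ k) = cabs z ^+ k.
Proof. by apply: (@complexI R); rewrite rmorphXn /= -!cabsE normrX. Qed.

Lemma cabsD y z : cabs (y + z) <= cabs y + cabs z.
Proof. by rewrite -lecR rmorphD /= -!cabsE ler_normD. Qed.

Lemma cabsB_ge y z : cabs y - cabs z <= cabs (y - z).
Proof. by rewrite -lecR rmorphB /= -!cabsE lerB_dist. Qed.

Lemma cabs_nat k : cabs k%:R = k%:R.
Proof. by rewrite -(rmorph_nat (real_complex R)) cabs_real ger0_norm. Qed.

Lemma cabs1 : cabs 1 = 1.
Proof. exact: (cabs_nat 1). Qed.

Lemma cabs0 : cabs 0 = 0.
Proof. exact: (cabs_nat 0). Qed.

Lemma cabsN z : cabs (- z) = cabs z.
Proof. by rewrite /cabs normrN. Qed.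

Lemma cabs_eq0 z : (cabs z == 0) = (z == 0).
Proof. by rewrite -(inj_eq (@complexI R)) -cabsE normr_eq0. Qed.

Lemma cabs_sqr z : cabs z ^+ 2 = complex.Re z ^+ 2 + complex.Im z ^+ 2.
Proof. by apply: (@complexI R); rewrite rmorphXn /= -cabsE add_Re2_Im2. Qed.

Lemma posc_real (e : C) : 0 < e -> exists2 r : R, 0 < r & e = r%:C.
Proof.
case: e => a b; rewrite ltcE /= => /andP[/eqP -> a0]; by exists a.
Qed.

Lemma tends_complex (u : nat -> R) (l : R) : tends u l ->
  tends (fun n => (u n)%:C : C) l%:C.
Proof.
move=> ul e /posc_real[r r0 ->]; have [N h] := ul _ r0; exists N => n /h.
by rewrite -rmorphB norm_real ltcR.
Qed.

Lemma tends_cabs (u : nat -> C) (l : C) :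
  tends u l <-> tends (fun n => cabs (l - u n)) 0.
Proof.
split=> ul.
  move=> r r0; have [|N h] := ul r%:C; first by rewrite ltcR.
  by exists N => n /h; rewrite cabsE ltcR sub0r normrN ger0_norm ?cabs_ge0.
move=> e /posc_real[r r0 ->]; have [N h] := ul _ r0; exists N => n /h.
by rewrite cabsE ltcR sub0r normrN ger0_norm ?cabs_ge0.
Qed.

Lemma small_tail_complex (g : nat -> R) : small_tail g ->
  small_tail (fun m => (g m)%:C : C).
Proof.
move=> sg e /posc_real[r r0 ->]; have [W h] := sg _ r0; exists W => V.
by rewrite -rmorph_sum lecR.
Qed.

Lemma dominated_series_tends (f : nat -> C) (g : nat -> R) B :
  (forall m, cabs (f m) <= g m) -> (forall V, \sum_(m < V) g m <= B) ->
  exists l, tends (fun V => \sum_(m < V) f m) l.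
Proof.
move=> fg gB.
have g0 m : 0 <= g m by apply: le_trans (cabs_ge0 _) (fg m).
have part (p : C -> R) : (forall z, `|p z| <= cabs z) -> {morph p : y z / y + z} ->
    exists l, tends (fun V => p (\sum_(m < V) f m)) l.
  move=> pz pD; have p0 : p 0 = 0 by apply: (addrI (p 0)); rewrite -pD !addr0.
  have pc : cvgn (series (p \o f)).
    apply: normed_cvg; apply: series_le_cvg (bounded_series_cvg g0 gB) => // m /=.
      exact: normr_ge0.
    exact: le_trans (pz _) (fg m).
  exists (limn (series (p \o f))); apply: eq_tends (tends_cvg pc) => V.
  by rewrite (big_morph p pD p0) seriesEord.
have re z : `|complex.Re z| <= cabs z by rewrite -lecR -cabsE normc_ge_Re.
have im z : `|complex.Im z| <= cabs z.
  rewrite -(ler_pXn2r (n := 2)) ?nnegrE ?cabs_ge0 // real_normK ?num_real //.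
  by rewrite cabs_sqr lerDr sqr_ge0.
have [a ha] := part _ re (fun y z => ltac:(by case: y z => ? ? [])).
have [b hb] := part _ im (fun y z => ltac:(by case: y z => ? ? [])).
exists (a%:C + 'i%C * b%:C).
apply: (eq_tends _ (tendsD (tends_complex ha) (tendsZ 'i%C (tends_complex hb)))) => V.
by rewrite -complexE.
Qed.

Lemma tends_filter (u : nat -> C) (l : C) : tends u l ->
  (u : nat -> C^o) @ \oo --> (l : C^o).
Proof.
move=> ul; apply/cvgrPdist_lt => e e0; have [N h] := ul e e0.
by exists N => // n /= Nn; apply: h.
Qed.

End RealSequences.

(** * The Lipschitz formula *)

Lemma bin_fact_prod n k : ('C(n + k, k) * k`! = \prod_(i < k) (n + i.+1))%N.
Proof.
elim: k => [|k IH]; first by rewrite bin0 big_ord0.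
rewrite big_ord_recr /= -IH factS mulnA [('C(_, _) * _)%N]mulnC addnS -mul_bin_diag.
by rewrite /= -mulnA mulnC.
Qed.

Section Lipschitz.
Variable R : realType.
Local Notation C := R[i].

Lemma cexpD (y z : C) : cexp (y + z) = cexp y * cexp z.
Proof.
case: y z => [a b] [c d]; rewrite /cexp /= expRD cosD sinD.
by apply/eqP; rewrite eq_complex /=; apply/andP; split; apply/eqP; ring.
Qed.

Lemma cexp0 : cexp 0 = 1 :> C.
Proof.
rewrite /cexp /= expR0 cos0 sin0.
by apply/eqP; rewrite eq_complex /= mulr1 !mulr0 subr0 mul0r addr0 !eqxx.
Qed.

Lemma cexpMn k (z : C) : cexp (k%:R * z) = cexp z ^+ k.
Proof.
elim: k => [|k IH]; first by rewrite mul0r cexp0.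
by rewrite -natr1 mulrDl mul1r cexpD IH exprSr.
Qed.

Definition e2pi (z : C) : C := cexp (two_pi_i R * z).

Lemma e2piD (y z : C) : e2pi (y + z) = e2pi y * e2pi z.
Proof. by rewrite /e2pi mulrDr cexpD. Qed.

Lemma e2piMn k (z : C) : e2pi (k%:R * z) = e2pi z ^+ k.
Proof. by rewrite /e2pi mulrCA cexpMn. Qed.

Lemma e2pi0 : e2pi 0 = 1.
Proof. by rewrite /e2pi mulr0 cexp0. Qed.

Lemma e2pi_nat k : e2pi k%:R = 1.
Proof.
rewrite /e2pi mulrC cexpMn; have -> : cexp (two_pi_i R) = 1; last by rewrite expr1n.
rewrite /cexp /two_pi_i /= expR0 [2 * pi]mulr_natl cos2pi sin2pi.
by apply/eqP; rewrite eq_complex /= mulr1 !mulr0 subr0 mul0r addr0 !eqxx.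
Qed.

Lemma cabs_cexp (z : C) : cabs (cexp z) = expR (complex.Re z).
Proof.
rewrite cabsM cabs_real ger0_norm ?expR_ge0 // -[RHS]mulr1; congr (_ * _).
apply: (pexpIrn (n := 2)); rewrite ?nnegrE ?cabs_ge0 // cabs_sqr /= cos2Dsin2.
by rewrite expr1n.
Qed.

Lemma cabs_e2pi (z : C) : cabs (e2pi z) = expR (- (2 * pi * complex.Im z)).
Proof. by rewrite /e2pi cabs_cexp; case: z => a b /=; rewrite mul0r sub0r. Qed.

Lemma e2pi_real (c : R) : e2pi c%:C = cos (2 * pi * c) +i* sin (2 * pi * c).
Proof.
rewrite /e2pi /cexp /two_pi_i /= !mul0r !mulr0 subr0 add0r expR0.
by apply/eqP; rewrite eq_complex /= !mul1r !mul0r subr0 addr0 !eqxx.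
Qed.

Lemma cabs_1Be_sqr (c : R) : cabs (1 - e2pi c%:C) ^+ 2 = 4 * sin (pi * c) ^+ 2.
Proof.
rewrite cabs_sqr e2pi_real /=.
have -> : 2 * pi * c = (pi * c) *+ 2 by rewrite mulr2n; ring.
rewrite sin_mulr2n cos_mulr2n sub0r sqrrN.
have := cos2Dsin2 (pi * c); set x := cos _; set y := sin _ => h.
have hx : x ^+ 2 = 1 - y ^+ 2 by rewrite -h addrK.
have -> : (x * y *+ 2) ^+ 2 = 4 * x ^+ 2 * y ^+ 2 by rewrite mulr2n; ring.
by rewrite hx mulr2n; ring.
Qed.

Lemma roots_sum N j : (0 < N)%N ->
  \sum_(p < N) e2pi (p%:R * (j%:R / N%:R)) = if (N %| j)%N then N%:R else 0 :> C.
Proof.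
move=> N0; have NC : N%:R != 0 :> C by rewrite pnatr_eq0 -lt0n.
have NR : N%:R != 0 :> R by rewrite pnatr_eq0 -lt0n.
under eq_bigr => p _ do rewrite e2piMn.
have e1 : e2pi (j%:R / N%:R) = e2pi ((j %% N)%:R / N%:R).
  rewrite {1}(divn_eq j N) natrD natrM mulrDl mulfK // e2piD.
  by rewrite e2pi_nat mul1r.
case: ifPn => [/eqP jN|jN].
  by rewrite e1 jN mul0r e2pi0 (eq_bigr (fun=> 1)) => [|p _]; rewrite ?expr1n // sumr_const card_ord.
set w := e2pi (j%:R / N%:R).
have w1 : w - 1 != 0.
  rewrite -oppr_eq0 opprB -cabs_eq0 -sqrf_eq0 /w e1.
  have -> : (j %% N)%:R / N%:R = ((j %% N)%:R / N%:R)%:C :> C.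
    by rewrite rmorphM fmorphV !rmorph_nat.
  rewrite cabs_1Be_sqr mulf_neq0 ?sqrf_eq0 ?pnatr_eq0 // gt_eqF // sin_gt0_pi //.
  have jp : 0 < (j %% N)%:R :> R by rewrite ltr0n lt0n.
  apply/andP; split; first by rewrite mulr_gt0 ?pi_gt0 // divr_gt0 // ltr0n.
  rewrite gtr_pMr ?pi_gt0 //; by rewrite ltr_pdivrMr ?ltr0n // mul1r ltr_nat ltn_mod.
apply: (mulfI w1); rewrite mulr0 -subrX1 -e2piMn mulrCA divff // mulr1.
by rewrite e2pi_nat subrr.
Qed.

Lemma sum_multiples (V : nmodType) N W (f : nat -> V) : (0 < N)%N ->
  \sum_(j < N * W) (if (N %| j)%N then f j else 0) = \sum_(w < W) f (N * w)%N.
Proof.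
move=> N0; elim: W => [|W IH]; first by rewrite muln0 !big_ord0.
rewrite big_ord_recr /= -IH mulnS addnC big_split_ord /=; congr (_ + _).
case: N N0 {IH} => // N _; rewrite big_ord_recl /= addn0 dvdn_mulr // big1 ?addr0 //.
move=> i _; rewrite dvdn_addr ?dvdn_mulr // gtnNdvd //.
by rewrite /bump /= add1n ltnS.
Qed.

Lemma cabs_e2pi_lt1 tau : 0 < complex.Im tau -> cabs (e2pi tau) < 1.
Proof.
by move=> tau_gt0; rewrite cabs_e2pi -[X in _ < X]expR0 ltr_expR oppr_lt0 !mulr_gt0 ?pi_gt0 ?ltr0n.
Qed.

Lemma bin_geometric_tends k (x : C) : cabs x < 1 ->
  tends (fun J => \sum_(j < J) 'C(j + k, k)%:R * x ^+ j) ((1 - x) ^- k.+1).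
Proof.
move=> x1; have x0 : 1 - x != 0.
  rewrite -cabs_eq0; apply/negP => /eqP h.
  by have := cabsB_ge 1 x; rewrite h cabs1 subr_le0 leNgt x1.
have x01 : 0 <= cabs x < 1 by rewrite cabs_ge0.
elim: k => [|k IH].
  have xJ : tends (fun J => x ^+ J) 0.
    apply/tends_cabs; apply: (@eq_tends _ (fun J => 'C(J + 0, 0)%:R * cabs x ^+ J)).
      by move=> J; rewrite bin0 mul1r sub0r cabsN cabsX.
    apply: (@bounded_series_terms _ _ ((1 - cabs x) ^- 1)).
      by move=> m; rewrite mulr_ge0 ?exprn_ge0 ?cabs_ge0.
    by move=> V; apply: bin_geometric_le.
  have := tendsZ (1 - x)^-1 (tendsB (tends_cst 1) xJ); rewrite subr0 mulr1 expr1.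
  by apply: eq_tends => J; rewrite -bin_geometric0 mulKf.
have xJ : tends (fun J => 'C(J + k, k.+1)%:R * x ^+ J) 0.
  apply/tends_cabs; apply: (@tends_squeeze _ _ (fun J => 'C(J + k.+1, k.+1)%:R * cabs x ^+ J)).
    move=> J; rewrite sub0r normrN ger0_norm ?cabs_ge0 // sub0r.
    rewrite cabsN cabsM cabs_nat cabsX.
    by rewrite ler_wpM2r ?exprn_ge0 ?cabs_ge0 // ler_nat addnS leq_bin2l.
  apply: (@bounded_series_terms _ _ ((1 - cabs x) ^- k.+2)).
    by move=> m; rewrite mulr_ge0 ?exprn_ge0 ?cabs_ge0.
  by move=> V; apply: bin_geometric_le.
have := tendsZ (1 - x)^-1 (tendsB IH xJ); rewrite subr0 -invfM -exprS.
by apply: eq_tends => J; rewrite -bin_geometricS mulKf.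
Qed.

Lemma tends_bounded (u : nat -> C) l : tends u l -> exists B, forall n, cabs (u n) <= B.
Proof.
move=> /tends_cabs ul; have [N h] := ul 1 ltr01.
exists (cabs l + 1 + \sum_(n < N) cabs (u n)) => n.
have S0 : 0 <= \sum_(n < N) cabs (u n) by apply: sumr_ge0 => i _; exact: cabs_ge0.
have [Nn|nN] := leqP N n.
  have := h n Nn; rewrite sub0r normrN ger0_norm ?cabs_ge0 // => hn.
  have -> : u n = l - (l - u n) by ring.
  apply: le_trans (cabsD _ _) _; rewrite cabsN -addrA lerD2l.
  by apply: le_trans (ltW hn) _; rewrite lerDl.
rewrite (bigD1 (Ordinal nN)) //= addrCA lerDl addr_ge0 ?addr_ge0 ?cabs_ge0 //.
by apply: sumr_ge0 => i _; exact: cabs_ge0.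
Qed.

Lemma inv_sqr_sum D V :
  \sum_(D <= m < V) (m.+1%:R ^- 2 : R) <= 2 / D.+1%:R.
Proof.
have [VD|DV] := leqP V D; first by rewrite big_geq // divr_ge0.
suff : \sum_(D <= m < V) (m.+1%:R ^- 2 : R) <= 2 / D.+1%:R - 2 / V.+1%:R.
  by move=> /le_trans; apply; rewrite lerBlDr lerDl divr_ge0.
rewrite -(subnKC (ltnW DV)); elim: (V - D)%N => [|d IH]; first by rewrite addn0 big_geq // subrr.
rewrite addnS big_nat_recr ?leq_addr //=.
apply: le_trans (lerD IH (lexx _)) _.
set x : R := (D + d).+1%:R; have x0 : 0 < x by rewrite ltr0n.
have x1 : 1 <= x by rewrite ler1n.
rewrite -[(D + d).+2%:R]natr1 -/x.
have y0 : 0 < x + 1 by rewrite addr_gt0.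
rewrite -subr_ge0; set z := 2 / _.
have -> : z - 2 / (x + 1) - (z - 2 / x + x ^- 2) = (x - 1) / (x ^+ 2 * (x + 1)).
  by field; rewrite !gt_eqF.
by rewrite divr_ge0 ?subr_ge0 // mulr_ge0 ?exprn_ge0 // ltW.
Qed.

Lemma lipschitz_finite k N (z : C) : (0 < N)%N -> 0 < complex.Im z ->
  tends (fun W => N%:R * \sum_(w < W) 'C(N * w + k, k)%:R * e2pi z ^+ w)
        (\sum_(p < N) (1 - e2pi ((z + p%:R) / N%:R)) ^- k.+1).
Proof.
move=> N0 z0; have NC : N%:R != 0 :> C by rewrite pnatr_eq0 -lt0n.
have xN p : e2pi ((z + p%:R) / N%:R) ^+ N = e2pi z.
  by rewrite -e2piMn mulrC divfK // e2piD e2pi_nat mulr1.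
have x1 p : cabs (e2pi ((z + p%:R) / N%:R)) < 1.
  rewrite ltNge; apply/negP => /(@exprn_ege1 _ N); rewrite -cabsX xN leNgt.
  by rewrite cabs_e2pi_lt1.
have h : tends (fun J => \sum_(p < N) \sum_(j < J)
     'C(j + k, k)%:R * e2pi ((z + p%:R) / N%:R) ^+ j)
   (\sum_(p < N) (1 - e2pi ((z + p%:R) / N%:R)) ^- k.+1).
  by apply: tends_sum => p _; apply: bin_geometric_tends.
have := tends_sub (phi := fun W => (N * W)%N) (fun W => leq_pmull W N0) h.
apply: eq_tends => W; rewrite exchange_big /=.
transitivity (\sum_(j < N * W) (if (N %| j)%N then
    N%:R * ('C(j + k, k)%:R * e2pi (z / N%:R) ^+ j) else 0)).
  apply: eq_bigr => j _.
  transitivity ('C(j + k, k)%:R * e2pi (z / N%:R) ^+ j *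
      \sum_(p < N) e2pi (p%:R * (j%:R / N%:R))).
    rewrite mulr_sumr; apply: eq_bigr => p _.
    rewrite mulrDl e2piD exprMn -(e2piMn j (p%:R / N%:R)) [LHS]mulrA; congr (_ * e2pi _).
    by rewrite mulrCA.
  by rewrite roots_sum //; case: ifP; rewrite ?mulr0 // mulrC.
rewrite (sum_multiples W (fun j => N%:R * ('C(j + k, k)%:R * e2pi (z / N%:R) ^+ j)) N0).
rewrite mulr_sumr; apply: eq_bigr => w _; rewrite exprM -e2piMn.
by rewrite [N%:R * (z / _)]mulrC divfK.
Qed.

Lemma bin_scaled_tends k w :
  tends (fun M => (M.*2.+1%:R : C) ^- k * 'C(M.*2.+1 * w + k, k)%:R)
        (w%:R ^+ k / k`!%:R).
Proof.
have f0 : k`!%:R != 0 :> C by rewrite pnatr_eq0 -lt0n fact_gt0.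
have h (i : nat) : tends (fun M => (w%:R + i.+1%:R / M.*2.+1%:R : C)) w%:R.
  rewrite -[X in tends _ X]addr0; apply: tendsD; first exact: tends_cst.
  rewrite -[X in tends _ X](mulr0 i.+1%:R); apply: tendsZ.
  apply: (@eq_tends _ (fun M => (@harmonic R M.*2)%:C)).
    by move=> M; rewrite /harmonic /= fmorphV rmorph_nat.
  apply: (@tends_sub _ (fun n => (@harmonic R n)%:C) 0 double).
    by move=> n; rewrite -addnn leq_addr.
  have := tends_complex (tends_cvg (@cvg_harmonic R)); by rewrite rmorph0.
have : tends (fun M => (\prod_(i < k) (w%:R + i.+1%:R / M.*2.+1%:R : C)) * k`!%:R^-1)
    ((\prod_(i < k) w%:R) * k`!%:R^-1).
  by apply: tendsM; [apply: tends_prod => i _; exact: h|exact: tends_cst].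
rewrite prodr_const card_ord; apply: eq_tends => M.
have M0 : M.*2.+1%:R != 0 :> C by rewrite pnatr_eq0.
apply: (mulIf f0); rewrite mulfVK // -mulrA -natrM bin_fact_prod natr_prod.
rewrite -exprVn -[X in _ ^+ X]card_ord -prodr_const -big_split /=.
by apply: eq_bigr => i _; rewrite natrD natrM mulrDr mulrA mulVf // mul1r mulrC.
Qed.

Lemma bin_scaled_le k w M :
  cabs ((M.*2.+1%:R : C) ^- k * 'C(M.*2.+1 * w + k, k)%:R) <= 'C(w + k, k)%:R.
Proof.
rewrite cabsM cabsV cabsX !cabs_nat ler_pdivrMl ?exprn_gt0 ?ltr0n //.
have f0 : 0 < k`!%:R :> R by rewrite ltr0n fact_gt0.
rewrite -(ler_pM2r f0) -mulrA -!natrM !bin_fact_prod -natrX -natrM ler_nat.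
rewrite -[X in (_ ^ X)%N]card_ord -prod_nat_const -big_split /=.
apply: leq_prod => i _; rewrite mulnDr leq_add2l leq_pmull //.
Qed.

Lemma derive0_tends (h : R -> R) a : is_derive (0 : R) 1 h a ->
  tends (fun n => n.+1%:R * (h n.+1%:R^-1 - h 0)) a.
Proof.
move=> [dh ah].
have : (fun t => t^-1 *: (h (t *: 1 + 0) - h 0)) @ 0^' --> a by rewrite -ah; exact: dh.
move=> /cvgrPdist_lt hl eps e0; have /= := hl eps e0.
move=> /nbhs_ballP[d d0 hd].
have [N hN] := tends_cvg (@cvg_harmonic R) d0; exists N => n /hN; rewrite /harmonic /= => hn.
have n0 : n.+1%:R^-1 != 0 :> R by rewrite invr_eq0 pnatr_eq0.
by have := hd n.+1%:R^-1 hn n0; rewrite /= invrK addr0 /GRing.scale /= mulr1.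
Qed.

Lemma cexp_scaled_tends (w : C) :
  tends (fun n => n.+1%:R * (cexp (w / n.+1%:R) - 1)) w.
Proof.
case: w => a b.
pose h1 (t : R) := expR (a * t) * cos (b * t).
pose h2 (t : R) := expR (a * t) * sin (b * t).
have dl c : is_derive (0 : R) 1 (fun t : R => c * t) c.
  by apply: is_derive_eq; rewrite /GRing.scale /= mulr1.
have de : is_derive (0 : R) 1 (fun t => expR (a * t)) a.
  have := @is_derive1_comp R expR (fun t => a * t) 0 _ _ (is_derive_expR _) (dl a).
  by rewrite mulr0 expR0 mul1r.
have dc : is_derive (0 : R) 1 (fun t => cos (b * t)) 0.
  have := @is_derive1_comp R cos (fun t => b * t) 0 _ _ (is_derive_cos _) (dl b).
  by rewrite mulr0 sin0 oppr0 mul0r.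
have ds : is_derive (0 : R) 1 (fun t => sin (b * t)) b.
  have := @is_derive1_comp R sin (fun t => b * t) 0 _ _ (is_derive_sin _) (dl b).
  by rewrite mulr0 cos0 mul1r.
have d1 : is_derive (0 : R) 1 h1 a.
  have := is_deriveM de dc; rewrite !mulr0 expR0 cos0 /GRing.scale /= mulr0 add0r mul1r.
  exact.
have d2 : is_derive (0 : R) 1 h2 b.
  have := is_deriveM de ds; rewrite !mulr0 expR0 sin0 /GRing.scale /= mul0r addr0 mul1r.
  exact.
have := tendsD (tends_complex (derive0_tends d1))
               (tendsZ 'i%C (tends_complex (derive0_tends d2))).
rewrite -[a%:C + _](complexE (a +i* b)); apply: eq_tends => n.
rewrite /h1 /h2 !mulr0 expR0 cos0 sin0 mul1r mulr0 subr0.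
have -> : (a +i* b) / n.+1%:R = (a * n.+1%:R^-1) +i* (b * n.+1%:R^-1).
  rewrite -(rmorph_nat (real_complex R)) -fmorphV.
  by apply/eqP; rewrite eq_complex /= !mulr0 subr0 add0r !eqxx.
rewrite /cexp /= -(rmorph_nat (real_complex R) n.+1).
by apply/eqP; rewrite eq_complex /=; apply/andP; split; apply/eqP; ring.
Qed.

Lemma e2pi_scaled_tends (z : C) :
  tends (fun M => M.*2.+1%:R * (1 - e2pi (z / M.*2.+1%:R))) (- two_pi_i R * z).
Proof.
have := tendsN (cexp_scaled_tends (two_pi_i R * z)); rewrite -mulNr => h.
have := tends_sub (phi := double) (fun n => ltac:(by rewrite -addnn leq_addr)) h.
by apply: eq_tends => M; rewrite -mulrN opprB /e2pi mulrA.
Qed.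

Lemma sin_ge_linear : exists2 kappa : R, 0 < kappa &
  forall t, 0 <= t <= pi / 2 -> kappa * t <= sin t.
Proof.
have c1 : 0 < cos 1 :> R := cos1_gt0 R.
have pi4 : pi / 4 <= 1 :> R.
  by rewrite ler_pdivrMr ?ltr0n // mul1r; have := @pihalf_lt2 R; lra.
have cosge s : 0 <= s <= 1 -> cos 1 <= cos s :> R.
  case/andP=> s0 s1; rewrite leNgt; apply/negP.
  have pi1 : 1 <= pi :> R by have := @pi_ge2 R; lra.
  rewrite ltr_cos ?in_itv /= ?ler01 ?s0 ?(le_trans s1) // => ?; lra.
have singe s : 0 <= s <= 1 -> cos 1 * s <= sin s :> R.
  case/andP=> s0 s1; case: (ltrgtP 0 s) s0 => // [s0 _|<-]; last by rewrite sin0 mulr0.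
  have [x] := @MVT R sin cos 0 s s0 (fun x _ => is_derive_sin x)
     (continuous_subspaceT (@continuous_sin R)).
  rewrite in_itv /= => /andP[x0 xs]; rewrite sin0 !subr0 => ->.
  by rewrite ler_pM2r // cosge // (ltW x0) (le_trans (ltW xs)).
exists (cos 1 ^+ 2); first by rewrite exprn_gt0.
move=> t /andP[t0 t2]; have -> : t = (t / 2) *+ 2 by rewrite mulr2n -splitr.
have h01 : 0 <= t / 2 <= 1 by apply/andP; split; [lra|have := @pihalf_lt2 R; lra].
rewrite sin_mulr2n mulrnAr ler_wMn2r //.
case/andP: (h01) => h0 _; rewrite expr2 -mulrA.
by apply: ler_pM; [exact: ltW|rewrite mulr_ge0 // ltW|exact: cosge|exact: singe].
Qed.

Lemma cabs_e2pi_real (c : R) : cabs (e2pi c%:C) = 1.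
Proof. by rewrite cabs_e2pi /= mulr0 oppr0 expR0. Qed.

Lemma e2pi_lower (tau : C) : 0 < complex.Im tau -> exists2 kappa : R, 0 < kappa &
  forall M (c : R), `|c| <= M%:R ->
  kappa * (1 + `|c|) <= cabs (M.*2.+1%:R * (1 - e2pi ((tau + c%:C) / M.*2.+1%:R))).
Proof.
move=> tau0; have [B hB] := tends_bounded (e2pi_scaled_tends tau).
have [k1 k10 hsin] := sin_ge_linear.
have B0 : 0 <= B by apply: le_trans (hB 0%N); exact: cabs_ge0.
pose c0 := 1 - cabs (e2pi tau).
have c00 : 0 < c0 by rewrite subr_gt0 cabs_e2pi_lt1.
pose k2 := 4 * k1.
have k20 : 0 < k2 by rewrite mulr_gt0.
have low1 M (c : R) : c0 <= cabs (M.*2.+1%:R * (1 - e2pi ((tau + c%:C) / M.*2.+1%:R))).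
  set N := M.*2.+1; rewrite cabsM cabs_nat; set x := e2pi _.
  have NC : N%:R != 0 :> C by rewrite pnatr_eq0.
  have xN : cabs x ^+ N = cabs (e2pi tau).
    by rewrite -cabsX -e2piMn mulrC divfK // e2piD cabsM cabs_e2pi_real mulr1.
  have x1 : cabs x <= 1.
    rewrite leNgt; apply/negP => h.
    have : 1 < cabs x ^+ N by rewrite exprn_egt1.
    by rewrite xN ltNge ltW ?cabs_e2pi_lt1.
  rewrite /c0 -xN; apply: le_trans (_ : N%:R * (1 - cabs x) <= _); last first.
    by rewrite ler_pM2l ?ltr0n // -cabs1 cabsB_ge.
  rewrite -opprB subrX1 -mulNr opprB mulrC ler_wpM2r ?subr_ge0 //.
  rewrite -[X in _ <= X%:R]card_ord -sumr_const; apply: ler_sum => i _.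
  by rewrite exprn_ile1 // cabs_ge0.
have low2 M (c : R) : `|c| <= M%:R ->
    k2 * `|c| - B <= cabs (M.*2.+1%:R * (1 - e2pi ((tau + c%:C) / M.*2.+1%:R))).
  move=> cM; set N := M.*2.+1.
  have N0 : 0 < N%:R :> R by rewrite ltr0n.
  set t := pi * (`|c| / N%:R).
  have t0 : 0 <= t by rewrite mulr_ge0 ?pi_ge0 // divr_ge0 // ltW.
  have tpi : t <= pi / 2.
    rewrite ler_pM2l ?pi_gt0 // ler_pdivrMr // mulrC -ler_pdivrMr ?invr_gt0 // invrK.
    have -> : N%:R = M%:R * 2 + 1 :> R by rewrite -natrM natr1 muln2.
    by lra.
  have s1 : cabs (1 - e2pi ((c / N%:R)%:C)) = 2 * `|sin t|.
    apply: (pexpIrn (n := 2)); rewrite ?nnegrE ?cabs_ge0 ?mulr_ge0 //.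
    rewrite cabs_1Be_sqr exprMn real_normK ?num_real // -natrX /t.
    case: (ger0P c) => _; first by [].
    by rewrite mulNr mulrN sinN sqrrN.
  have s2 : k2 * `|c| <= N%:R * cabs (1 - e2pi ((c / N%:R)%:C)).
    have ht : k1 * t <= sin t by apply: hsin; rewrite t0 tpi.
    have st0 : 0 <= sin t by apply: le_trans ht; rewrite mulr_ge0 // ltW.
    rewrite s1 (ger0_norm st0).
    apply: le_trans (_ : N%:R * (2 * (k1 * t)) <= _); last first.
      by rewrite ler_pM2l // ler_pM2l.
    have -> : N%:R * (2 * (k1 * t)) = (2 * pi * k1) * `|c|.
      by rewrite /t; field; rewrite gt_eqF.
    rewrite ler_wpM2r // ler_pM2r //; have := @pi_ge2 R; lra.
  rewrite mulrDl e2piD.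
  have -> : c%:C / N%:R = (c / N%:R)%:C :> C by rewrite rmorphM fmorphV rmorph_nat.
  set y := e2pi (c / N%:R)%:C; set x := e2pi (tau / N%:R).
  have y1 : cabs y = 1 := cabs_e2pi_real _.
  have -> : N%:R * (1 - x * y) = N%:R * (1 - y) - - (y * (N%:R * (1 - x))) by ring.
  apply: le_trans (cabsB_ge _ _); rewrite cabsN (cabsM N%:R (1 - y)) cabs_nat (cabsM y) y1 mul1r.
  exact: lerB s2 (hB M).
pose D := 2 * (B + 1) / k2 + 1.
have D0 : 0 < D by rewrite addr_gt0 ?divr_gt0 ?mulr_gt0 ?ltr_wpDl.
pose kappa := Num.min (k2 / 4) (c0 / (1 + D)).
have kappa0 : 0 < kappa.
  by rewrite lt_min !divr_gt0 ?ltr0n // addr_gt0.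
exists kappa => // M c cM.
have [cD|Dc] := leP `|c| D.
  apply: le_trans (low1 M c); apply: le_trans (_ : c0 / (1 + D) * (1 + D) <= _).
    apply: ler_pM; [exact: ltW|by rewrite addr_ge0| |by rewrite lerD2l].
    by rewrite ge_min lexx orbT.
  by rewrite divfK // gt_eqF // addr_gt0.
apply: le_trans (low2 M c cM); apply: le_trans (_ : k2 / 4 * (1 + `|c|) <= _).
  by apply: ler_wpM2r; [rewrite addr_ge0|rewrite ge_min lexx].
have : k2 * D < k2 * `|c| by rewrite ltr_pM2l.
have -> : k2 * D = 2 * (B + 1) + k2 by rewrite /D; field; rewrite gt_eqF.
by move=> h; lra.
Qed.

Lemma two_pi_i_neq0 : two_pi_i R != 0.
Proof.
by rewrite /two_pi_i eq_complex /= eqxx mulf_neq0 // gt_eqF ?pi_gt0.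
Qed.

Lemma sum_window (V : nmodType) M (F : nat -> V) :
  \sum_(p < M.*2.+1) F p
  = \sum_(m < M.+1) F (M + m)%N + \sum_(m < M) F (M - m.+1)%N.
Proof.
rewrite -addnn -addnS big_split_ord /= addrC; congr (_ + _).
by rewrite (reindex_inj rev_ord_inj).
Qed.

Section LipschitzLimit.
Variables (tau : C) (k : nat).
Hypotheses (tau0 : 0 < complex.Im tau) (k0 : (0 < k)%N).
Let f M (c : R) : C := (M.*2.+1%:R * (1 - e2pi ((tau + c%:C) / M.*2.+1%:R))) ^- k.+1.
Let F (c : R) : C := (- two_pi_i R * (tau + c%:C)) ^- k.+1.

Let tau_real (c : R) : tau + c%:C != 0.
Proof.
by case: tau tau0 => a b /= b0; rewrite eq_complex /= addr0 [b == 0]gt_eqF ?andbF.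
Qed.

Let fF c : tends (f ^~ c) (F c).
Proof.
apply: tendsV; last exact: (tendsX k.+1 (e2pi_scaled_tends _)).
by rewrite expf_neq0 // mulf_neq0 ?oppr_eq0 ?two_pi_i_neq0 ?tau_real.
Qed.

Let dominated : exists2 kappa : R, 0 < kappa &
  (forall M c, `|c| <= M%:R -> cabs (f M c) <= kappa * (1 + `|c|) ^- 2)
  /\ forall c, cabs (F c) <= kappa * (1 + `|c|) ^- 2.
Proof.
have [kappa kappa0 hk] := e2pi_lower tau0.
have fb M c : `|c| <= M%:R -> cabs (f M c) <= kappa ^- k.+1 * (1 + `|c|) ^- 2.
  move=> cM; rewrite cabsV cabsX -invfM.
  have c1 : 1 <= 1 + `|c| by rewrite lerDl.
  have c0 : 0 < 1 + `|c| by apply: lt_le_trans c1.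
  rewrite lef_pV2 ?posrE ?mulr_gt0 ?exprn_gt0 //; last first.
    by apply: lt_le_trans (hk M c cM); rewrite mulr_gt0.
  apply: le_trans (_ : (kappa * (1 + `|c|)) ^+ k.+1 <= _).
    rewrite exprMn ler_pM2l ?exprn_gt0 // ler_weXn2l //.
  by rewrite lerXn2r ?nnegrE ?cabs_ge0 ?hk // mulr_ge0 // ltW.
exists (kappa ^- k.+1); first by rewrite invr_gt0 exprn_gt0.
split=> // c; rewrite -lecR -cabsE.
pose M0 := Num.bound `|c|.
have hM n : `|c| <= (M0 + n)%:R.
  rewrite natrD; apply: le_trans (_ : M0%:R <= _); last by rewrite lerDl.
  by rewrite ltW // archi_boundP.
apply: (tends_le_norm _ (tends_sub (phi := fun n => (M0 + n)%N) (fun n => leq_addl _ _) (fF c))).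
by move=> n /=; rewrite cabsE lecR; exact: fb.
Qed.

Lemma lipschitz : exists2 L : C,
  tends (fun W => \sum_(w < W) w%:R ^+ k / k`!%:R * e2pi tau ^+ w) L
  & tends (fun M => \sum_(p < M.*2.+1) (tau - M%:R + p%:R) ^- k.+1)
          ((- two_pi_i R) ^+ k.+1 * L).
Proof.
set q := e2pi tau; have q1 : cabs q < 1 by rewrite cabs_e2pi_lt1.
pose g w : R := 'C(w + k, k)%:R * cabs q ^+ w.
have g0 w : 0 <= g w by rewrite mulr_ge0 ?exprn_ge0 ?cabs_ge0.
have gB V : \sum_(w < V) g w <= (1 - cabs q) ^- k.+1.
  by apply: bin_geometric_le; rewrite cabs_ge0.
pose a M w : C := (M.*2.+1%:R ^- k * 'C(M.*2.+1 * w + k, k)%:R) * q ^+ w.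
pose b w : C := w%:R ^+ k / k`!%:R * q ^+ w.
have ab w : tends (a ^~ w) (b w).
  by apply: tendsM (bin_scaled_tends k w) (tends_cst _).
have ag M w : cabs (a M w) <= g w.
  by rewrite cabsM cabsX ler_wpM2r ?exprn_ge0 ?cabs_ge0 // bin_scaled_le.
have bg w : cabs (b w) <= g w.
  rewrite -lecR -cabsE; apply: (tends_le_norm _ (ab w)) => M.
  by rewrite cabsE lecR.
have [L bL] := dominated_series_tends bg gB.
exists L => //.
pose A M : C := \sum_(p < M.*2.+1) f M (p%:R - M%:R).
have aA M : tends (fun V => \sum_(w < V) a M w) (A M).
  have N0 : M.*2.+1%:R != 0 :> C by rewrite pnatr_eq0.
  have z0 : 0 < complex.Im (tau - M%:R).
    by rewrite -(rmorph_nat (real_complex R)); case: tau tau0 => ? ? /=; rewrite subr0.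
  have hq : e2pi (tau - M%:R) = q.
    have : e2pi (tau - M%:R + M%:R) = e2pi (tau - M%:R) by rewrite e2piD e2pi_nat mulr1.
    by rewrite subrK.
  have := tendsZ (M.*2.+1%:R ^- k.+1) (lipschitz_finite k (ltn0Sn M.*2) z0).
  rewrite mulr_sumr => h.
  have -> : A M = \sum_(p < M.*2.+1) M.*2.+1%:R ^- k.+1
      * (1 - e2pi ((tau - M%:R + p%:R) / M.*2.+1%:R)) ^- k.+1.
    apply: eq_bigr => p _; rewrite /f.
    have -> : tau + (p%:R - M%:R)%:C = tau - M%:R + p%:R.
      by rewrite rmorphB !rmorph_nat addrA addrAC.
    by rewrite exprMn invfM.
  apply: eq_tends h => V; rewrite hq mulrA exprSr invfM mulfVK // mulr_sumr.
  by apply: eq_bigr => w _; rewrite mulrA.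
have AL : tends A L.
  apply: (tannery_series (f := a) (F := b) (g := fun w => (g w)%:C)) ab _ _ _ aA bL.
  - by move=> M w; rewrite cabsE lecR.
  - by move=> w; rewrite cabsE lecR.
  - exact: small_tail_complex (bounded_series_small g0 gB).
have [kappa kappa0 [fk Fk]] := dominated.
pose g' m : C := (kappa * m.+1%:R ^- 2)%:C.
have sg' : small_tail g'.
  apply: small_tail_complex; apply: small_tailZ => //.
  apply: (@bounded_series_small _ _ 2) => [m|V]; first by rewrite invr_ge0 exprn_ge0.
  rewrite -(big_mkord xpredT (fun m => m.+1%:R ^- 2)); apply: le_trans (inv_sqr_sum 0 V) _.
  by rewrite divr1.
have boundP (m : nat) (c : R) : m%:R <= `|c| -> kappa * (1 + `|c|) ^- 2 <= kappa * m.+1%:R ^- 2.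
  move=> mc; rewrite ler_pM2l // lef_pV2 ?posrE ?exprn_gt0 ?ltr0n ?ltr_pwDl //.
  by rewrite lerXn2r ?nnegrE ?addr_ge0 // -natr1 addrC lerD2l.
have h1 : tends (fun M => \sum_(m < M.+1) (f M m%:R - F m%:R)) 0.
  apply: (tannery (N := succn) (f := fun M m => f M m%:R) (F := fun m => F m%:R) (g := g')) => //.
  - move=> M m mM; rewrite cabsE lecR; apply: le_trans (fk M m%:R _) (boundP _ _ _).
      by rewrite normr_nat ler_nat.
    by rewrite normr_nat.
  - move=> m; rewrite cabsE lecR; apply: le_trans (Fk m%:R) (boundP _ _ _).
    by rewrite normr_nat.
have h2 : tends (fun M => \sum_(m < M) (f M (- m.+1%:R) - F (- m.+1%:R))) 0.
  apply: (tannery (N := id) (f := fun M m => f M (- m.+1%:R))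
    (F := fun m => F (- m.+1%:R)) (g := g')) => //.
  - move=> M m mM; rewrite cabsE lecR; apply: le_trans (fk M (- m.+1%:R) _) (boundP _ _ _).
      by rewrite normrN normr_nat ler_nat.
    by rewrite normrN normr_nat ler_nat.
  - move=> m; rewrite cabsE lecR; apply: le_trans (Fk (- m.+1%:R)) (boundP _ _ _).
    by rewrite normrN normr_nat ler_nat.
have := tendsB AL (tendsD h1 h2); rewrite addr0 subr0 => h.
apply: (eq_tends _ (tendsZ ((- two_pi_i R) ^+ k.+1) h)) => M.
rewrite !sumrB /A (sum_window M (fun p => f M (p%:R - M%:R))).
rewrite (sum_window M (fun p => (tau - M%:R + p%:R) ^- k.+1)).
have e1 m : (M + m)%:R - M%:R = m%:R :> R by rewrite natrD addrC addKr.
have e2 m : (m < M)%N -> (M - m.+1)%:R - M%:R = - m.+1%:R :> R.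
  by move=> mM; rewrite natrB //; ring.
under eq_bigr => m _ do rewrite e1.
rewrite (eq_bigr (fun m : 'I_M => f M (- m.+1%:R))); last by move=> m _; rewrite e2.
set S1 := \sum_(m < M.+1) f M _; set S2 := \sum_(m < M) f M _.
set S3 := \sum_(m < M.+1) F _; set S4 := \sum_(m < M) F _.
have -> : S1 + S2 - (S1 - S3 + (S2 - S4)) = S3 + S4 by ring.
have t0 : (- two_pi_i R) ^+ k.+1 != 0 by rewrite expf_neq0 // oppr_eq0 two_pi_i_neq0.
rewrite mulrDr !mulr_sumr; congr (_ + _); apply: eq_bigr => m _.
  rewrite /F exprMn invfM mulVKf // natrD rmorph_nat.
  by have -> : tau - M%:R + (M%:R + m%:R) = tau + m%:R :> C by ring.
rewrite /F exprMn invfM mulVKf // natrB // rmorphN rmorph_nat.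
by have -> : tau - M%:R + (M%:R - m.+1%:R) = tau - m.+1%:R :> C by ring.
Qed.

End LipschitzLimit.
End Lipschitz.

(** * Multitangent functions *)

Section ZetaRates.
Variable R : realType.
Local Notation C := R[i].

Definition zsum (n : seq nat) (B : nat) : R :=
  csum (size n) 1 B.+1 (fun s => \prod_(j < size n) (nth 0%N s j)%:R ^- nth 0%N n j).

Lemma zeta_partialE n B : zeta_partial R n B = zsum n B.
Proof.
rewrite /zsum -big_tuple_ltn; apply: eq_bigr => m _; apply: eq_bigr => j _.
by rewrite (nth_map 0) ?size_tuple // -tnth_nth.
Qed.

Lemma zsum_nil B : zsum [::] B = 1.
Proof. by rewrite /zsum /= big_ord0. Qed.

Lemma zsum_rcons n k B :
  zsum (rcons n k) B = \sum_(m < B) m.+1%:R ^- k * zsum n m.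
Proof.
rewrite /zsum size_rcons csum_rcons big_add1 big_mkord; apply: eq_bigr => m _.
rewrite -csumZ; apply: eq_csum => s ss _ _.
rewrite big_ord_recr /= !nth_rcons ss !ltnn !eqxx mulrC; congr (_ * _).
by apply: eq_bigr => j _; rewrite !nth_rcons ss ltn_ord.
Qed.

Lemma zsum_ge0 n B : 0 <= zsum n B.
Proof.
elim/last_ind: n B => [|n k IH] B; first by rewrite zsum_nil.
by rewrite zsum_rcons sumr_ge0 // => m _; rewrite mulr_ge0 ?invr_ge0 ?exprn_ge0.
Qed.

Let inv_pow_le (k m : nat) : (2 <= k)%N -> m.+1%:R ^- k <= m.+1%:R ^- 2 :> R.
Proof.
move=> k2; rewrite lef_pV2 ?posrE ?exprn_gt0 ?ltr0n //.
by rewrite ler_weXn2l // ler1n.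
Qed.

Lemma zsum_le n B : all (leq 2) n -> zsum n B <= 2 ^+ size n.
Proof.
elim/last_ind: n B => [|n k IH] B; first by rewrite zsum_nil.
rewrite all_rcons => /andP[k2 n2]; rewrite zsum_rcons size_rcons exprS.
apply: le_trans (_ : (\sum_(m < B) m.+1%:R ^- 2) * 2 ^+ size n <= _).
  rewrite mulr_suml; apply: ler_sum => m _; rewrite ler_pM ?zsum_ge0 ?IH ?inv_pow_le //.
rewrite ler_wpM2r ?exprn_ge0 // -(big_mkord xpredT (fun m => m.+1%:R ^- 2)).
by apply: le_trans (inv_sqr_sum _ 0 B) _; rewrite divr1.
Qed.

Lemma zsum_diff n D V : all (leq 2) n -> (D <= V)%N ->
  0 <= zsum n V - zsum n D <= 2 ^+ size n / D.+1%:R.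
Proof.
case/lastP: n => [|n k]; first by rewrite !zsum_nil subrr lexx divr_ge0.
rewrite all_rcons => /andP[k2 n2] DV; rewrite !zsum_rcons size_rcons.
pose f m : R := m.+1%:R ^- k * zsum n m.
rewrite -!(big_mkord xpredT f).
have -> : \sum_(0 <= m < V) f m = \sum_(0 <= m < D) f m + \sum_(D <= m < V) f m.
  by rewrite -big_cat_nat.
rewrite [_ + _ - _]addrC addKr /f; apply/andP; split.
  by rewrite sumr_ge0 // => m _; rewrite mulr_ge0 ?zsum_ge0 ?invr_ge0 ?exprn_ge0.
apply: le_trans (_ : (\sum_(D <= m < V) m.+1%:R ^- 2) * 2 ^+ size n <= _).
  rewrite mulr_suml; apply: ler_sum => m _; rewrite ler_pM ?zsum_ge0 ?zsum_le ?inv_pow_le //.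
rewrite exprS mulrAC ler_wpM2r ?exprn_ge0 //; exact: inv_sqr_sum.
Qed.

Lemma zeta_tends n : all (leq 2) n -> tends (zsum n) (zeta R n).
Proof.
move=> n2; have e : zeta_partial R n = zsum n by apply/funext => B; exact: zeta_partialE.
rewrite /zeta e.
apply: tends_cvg; apply: nondecreasing_is_cvgn.
  by move=> D V /(zsum_diff n2)/andP[]; rewrite subr_ge0.
by exists (2 ^+ size n) => _ [B _ <-]; exact: zsum_le.
Qed.

Definition rated (u : nat -> C) (l : C) : Prop :=
  exists c : R, forall D, cabs (u D - l) <= c / D.+1%:R.

Lemma ratedZ z u l : rated u l -> rated (fun D => z * u D) (z * l).
Proof.
move=> [c h]; exists (cabs z * c) => D.
by rewrite -mulrBr cabsM -mulrA ler_wpM2l ?cabs_ge0.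
Qed.

Lemma rated_sum (I : Type) (r : seq I) (F : I -> nat -> C) (l : I -> C) :
  (forall i, rated (F i) (l i)) -> rated (fun D => \sum_(i <- r) F i D) (\sum_(i <- r) l i).
Proof.
move=> h; elim: r => [|i r [c IH]].
  by exists 0 => D; rewrite !big_nil subrr cabs0 mul0r.
have [d hd] := h i; exists (d + c) => D; rewrite !big_cons opprD addrACA mulrDl.
by apply: le_trans (cabsD _ _) _; rewrite lerD.
Qed.

Section Lead.
Variable J : nat -> seq nat -> R.
Hypothesis J0 : forall n, all (leq 2) n -> J 0 n = zeta R n.
Hypothesis JS : forall a n, is_index n ->
  a.+1%:R * J a.+1 n = - \sum_(j < size n) (nth 0%N n j)%:R * J a (incr_nth n j).

Lemma all_incr_nth n j : (j < size n)%N -> all (leq 2) n -> all (leq 2) (incr_nth n j).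
Proof.
move=> jn n2; apply/(all_nthP 0%N) => i; rewrite size_incr_nth_lt // => il.
by rewrite nth_incr_nth; apply: leq_trans (all_nthP 0%N n2 i il) (leq_addl _ _).
Qed.

Lemma htay_rated a n : all (leq 2) n -> rated (fun D => htay C D a n) (J a n)%:C.
Proof.
elim: a n => [|a IH] n n2.
  exists (2 ^+ size n) => D; rewrite J0 //.
  have -> : htay C D 0 n = (zsum n D)%:C.
    rewrite /zsum (raddf_csum (real_complex R : {additive R -> C})).
    apply: eq_csum => s ss _ _ /=; rewrite rmorph_prod; apply: eq_bigr => j _.
    by rewrite (nth_map 0%N) ?ss // fmorphV rmorphXn rmorph_nat.
  rewrite -rmorphB cabs_real distrC.
  have h : tends (fun V => zsum n (D + V) - zsum n D) (zeta R n - zsum n D).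
    apply: tendsB (tends_cst _).
    exact: (tends_sub (phi := fun V => (D + V)%N) (fun V => leq_addl _ _) (zeta_tends n2)).
  apply: (tends_le_norm _ h) => V.
  by have /andP[h0 h1] := zsum_diff n2 (leq_addr V D); rewrite ger0_norm.
have a0 : a.+1%:R != 0 :> C by rewrite pnatr_eq0.
have -> : (J a.+1 n)%:C = - a.+1%:R^-1
    * \sum_(j < size n) (nth 0%N n j)%:R * (J a (incr_nth n j))%:C.
  apply: (mulfI a0); rewrite mulrA mulrN divff // mulN1r.
  have := congr1 (real_complex R) (JS a (sub_all (fun k => @ltnW 1 k) n2)).
  rewrite rmorphM rmorph_nat rmorphN rmorph_sum => ->; congr (- _).
  by apply: eq_bigr => j _; rewrite rmorphM rmorph_nat.
have [|c h] := @ratedZ (- a.+1%:R^-1) (fun D => \sum_(j < size n)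
    (nth 0%N n j)%:R * htay C D a (incr_nth n j))
  (\sum_(j < size n) (nth 0%N n j)%:R * (J a (incr_nth n j))%:C).
  by apply: rated_sum => j; apply: ratedZ; apply: IH; apply: all_incr_nth.
exists c => D; have <- : - a.+1%:R^-1 * (\sum_(j < size n)
    (nth 0%N n j)%:R * htay C D a (incr_nth n j)) = htay C D a.+1 n; last exact: h.
by apply: (mulfI a0); rewrite mulrA mulrN divff // mulN1r htayS.
Qed.

(* The error of the truncations at distance p on the left and q on the right. *)
Definition rated2 (u : nat -> nat -> C) (l : C) : Prop :=
  exists c : R, forall p q, cabs (u p q - l) <= c * (p.+1%:R^-1 + q.+1%:R^-1).

Lemma ratedM (u v : nat -> C) l m : rated u l -> rated v m ->
  rated2 (fun p q => u p * v q) (l * m).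
Proof.
move=> [c hu] [d hv].
have c0 : 0 <= c by have := hu 0%N; rewrite divr1; apply: le_trans; exact: cabs_ge0.
have d0 : 0 <= d by have := hv 0%N; rewrite divr1; apply: le_trans; exact: cabs_ge0.
have vb q : cabs (v q) <= d + cabs m.
  rewrite -[v q](subrK m); apply: le_trans (cabsD _ _) _; rewrite lerD2r.
  by apply: le_trans (hv q) _; rewrite ler_pdivrMr ?ltr0n // ler_peMr // ler1n.
exists (c * (d + cabs m) + cabs l * d) => p q.
have -> : u p * v q - l * m = (u p - l) * v q + l * (v q - m) by ring.
apply: le_trans (cabsD _ _) _; rewrite !cabsM.
apply: le_trans (_ : c / p.+1%:R * (d + cabs m) + cabs l * (d / q.+1%:R) <= _).
  rewrite lerD ?ler_pM ?cabs_ge0 ?ler_wpM2l //.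
have p0 : 0 <= p.+1%:R^-1 :> R by rewrite invr_ge0.
have q0 : 0 <= q.+1%:R^-1 :> R by rewrite invr_ge0.
have a0 : 0 <= c * (d + cabs m) * q.+1%:R^-1.
  by rewrite !mulr_ge0 // addr_ge0 ?cabs_ge0.
have b0 : 0 <= cabs l * d * p.+1%:R^-1 by rewrite !mulr_ge0 ?cabs_ge0.
rewrite -subr_ge0; set A := p.+1%:R^-1 in p0 b0 *; set B := q.+1%:R^-1 in q0 a0 *.
have -> : (c * (d + cabs m) + cabs l * d) * (A + B)
    - (c * A * (d + cabs m) + cabs l * (d * B))
  = c * (d + cabs m) * B + cabs l * d * A by ring.
exact: addr_ge0.
Qed.

End Lead.
End ZetaRates.

Section Multitangents.
Variable R : realType.
Local Notation C := R[i].

Let hsum (N : nat) : R := \sum_(m < N) m.+1%:R^-1.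

Let hsum_tends : tends (fun M => hsum M.*2.+1 / M.+1%:R) 0.
Proof.
have h := tends_sub (phi := double) (fun n => ltac:(by rewrite -addnn leq_addr))
  (tends_cvg (cesaro (@cvg_harmonic R))).
apply: (@tends_squeeze _ _ (fun M => 2 * arithmetic_mean (@harmonic R) M.*2)); last first.
  by have := tendsZ 2 h; rewrite mulr0.
have hs0 N : 0 <= hsum N by apply: sumr_ge0 => m _; rewrite invr_ge0.
move=> M; rewrite sub0r normrN ger0_norm ?divr_ge0 //.
rewrite /arithmetic_mean /series /= big_mkord -/(hsum _) mulrA mulrC ler_wpM2r //.
rewrite ler_pdivlMr ?ltr0n // mulrC ler_pdivrMr ?ltr0n // -natrM ler_nat.
by rewrite mul2n doubleS ltnW.
Qed.

Let dist M (p : nat) : R := 1 + `|p%:R - M%:R|.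

Let window_tends :
  tends (fun M => \sum_(p < M.*2.+1)
    (p.+1%:R^-1 + (M.*2 - p).+1%:R^-1) / dist M p) 0.
Proof.
have dist_gt0 M p : 0 < dist M p by rewrite ltr_pwDl.
have distE M p : (p < M.*2.+1)%N -> dist M p = dist M (M.*2 - p).
  move=> pM; rewrite /dist natrB // -addnn natrD -normrN; congr (1 + `|_|); ring.
have hs M : \sum_(p < M.*2.+1) (dist M p)^-1 <= 2 * hsum M.*2.+1.
  have mono a b : (a <= b)%N -> hsum a <= hsum b.
    move=> ab; rewrite /hsum -(subnKC ab) big_split_ord /= lerDl sumr_ge0 // => m _.
  rewrite (sum_window M (fun p => (dist M p)^-1)) mulr_natl mulr2n lerD //.
    apply: le_trans (mono M.+1 _ _); last by rewrite ltnS -addnn leq_addr.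
    apply: ler_sum => m _; rewrite /dist.
    have -> : (M + m)%:R - M%:R = m%:R :> R by rewrite natrD; ring.
    by rewrite normr_nat -[m.+1]add1n natrD.
  apply: le_trans (mono M _ _); last by rewrite -addnn -addnS leq_addr.
  apply: ler_sum => m _; rewrite /dist.
  have -> : (M - m.+1)%:R - M%:R = - m.+1%:R :> R by rewrite natrB //; ring.
  rewrite normrN normr_nat.
  by rewrite lef_pV2 ?posrE ?ltr0n ?ltr_pwDl // lerDr.
have frac (u v : R) : 0 < u -> 0 < v -> u^-1 / v = (u^-1 + v^-1) / (u + v).
  move=> u0 v0; have uv := lt0r_neq0 (addr_gt0 u0 v0).
  have := lt0r_neq0 u0; have := lt0r_neq0 v0 => {}v0 {}u0.
  apply: (canRL (mulfK uv)); apply: (mulIf u0); apply: (mulIf v0).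
  by rewrite -!mulrA mulrDl; field; rewrite u0 v0.
have key M p : (p < M.*2.+1)%N ->
    p.+1%:R^-1 / dist M p <= (p.+1%:R^-1 + (dist M p)^-1) / M.+1%:R.
  move=> pM; set x : R := p.+1%:R; set y := dist M p.
  have x0 : 0 < x by rewrite ltr0n.
  have y0 : 0 < y by exact: dist_gt0.
  have xy : M.+1%:R <= x + y.
    rewrite /x /y /dist -!natr1; have := ler_norm (M%:R - p%:R : R).
    by rewrite distrC => h; lra.
  have -> : x^-1 / y = (x^-1 + y^-1) / (x + y) by exact: frac.
  by rewrite ler_pM2l ?addr_gt0 ?invr_gt0 // lef_pV2 ?posrE ?ltr0n // addr_gt0.
have tri M : \sum_(p < M.*2.+1) p.+1%:R^-1 / dist M p <= 3 * (hsum M.*2.+1 / M.+1%:R).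
  apply: le_trans (_ : (\sum_(p < M.*2.+1) (p.+1%:R^-1 + (dist M p)^-1)) / M.+1%:R <= _).
    by rewrite mulr_suml; apply: ler_sum => p _; exact: key.
  rewrite mulrA ler_wpM2r ?invr_ge0 // big_split /=.
  by have := hs M; rewrite -/(hsum _); lra.
apply: (@tends_squeeze _ _ (fun M => 6 * (hsum M.*2.+1 / M.+1%:R))); last first.
  by have := tendsZ 6 hsum_tends; rewrite mulr0.
move=> M; rewrite sub0r normrN ger0_norm; last first.
  by apply: sumr_ge0 => p _; rewrite divr_ge0 ?addr_ge0 ?invr_ge0 // ltW.
under eq_bigr => p _ do rewrite mulrDl.
rewrite big_split /= [X in _ + X](reindex_inj rev_ord_inj) /=.
rewrite [X in _ + X](eq_bigr (fun p : 'I_M.*2.+1 => p.+1%:R^-1 / dist M p)).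
  have -> : 6 * (hsum M.*2.+1 / M.+1%:R)
    = 3 * (hsum M.*2.+1 / M.+1%:R) + 3 * (hsum M.*2.+1 / M.+1%:R) by ring.
  by rewrite lerD ?tri.
by move=> p _; rewrite subSS -distE // subKn // -ltnS.
Qed.

Variable tau : C.
Hypothesis tau0 : 0 < complex.Im tau.

Let tau_lower : exists2 kappa : R, 0 < kappa &
  forall c : R, kappa * (1 + `|c|) <= cabs (tau + c%:C).
Proof.
have im c : complex.Im tau <= cabs (tau + c%:C).
  rewrite -(ler_pXn2r (n := 2)) ?nnegrE ?cabs_ge0 //; last exact: ltW.
  by rewrite cabs_sqr; case: tau => a b /=; rewrite addr0 lerDr sqr_ge0.
have b0 := tau0; set b := complex.Im tau in im b0 *; pose D := 2 * cabs tau + 1.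
have t0 : 0 <= cabs tau := cabs_ge0 _.
have D0 : 0 < D by rewrite ltr_wpDl // mulr_ge0.
exists (Num.min (1 / 4) (b / (1 + D))).
  by rewrite lt_min !divr_gt0 // addr_gt0.
move=> c; have [cD|Dc] := leP `|c| D.
  apply: le_trans (im c); apply: le_trans (_ : b / (1 + D) * (1 + D) <= _).
    apply: ler_pM; [|by rewrite addr_ge0| |by rewrite lerD2l].
      have D1 : 0 <= 1 + D by rewrite addr_ge0 // ltW.
      by rewrite le_min !divr_ge0 // ltW.
    by rewrite ge_min lexx orbT.
  by rewrite divfK // gt_eqF // addr_gt0.
have := cabsB_ge c%:C (- tau); rewrite opprK cabs_real cabsN [c%:C + _]addrC.
apply: le_trans; apply: le_trans (_ : 1 / 4 * (1 + `|c|) <= _).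
  by apply: ler_wpM2r; [rewrite addr_ge0|rewrite ge_min lexx].
by rewrite /D in Dc; lra.
Qed.

Let x M (p : nat) : C := tau - M%:R + p%:R.

Let xE M p : x M p = tau + (p%:R - M%:R : R)%:C.
Proof. by rewrite rmorphB !rmorph_nat /x addrA addrAC. Qed.

Let error_tends (u : nat -> nat -> C) l k : rated2 u l -> (0 < k)%N ->
  tends (fun M => \sum_(p < M.*2.+1) (u p (M.*2 - p)%N - l) * x M p ^- k) 0.
Proof.
move=> [c hc] k0; have [kappa kappa0 hk] := tau_lower.
have c0 : 0 <= c.
  have := le_trans (cabs_ge0 _) (hc 0%N 0%N); rewrite invr1 => h; lra.
apply/tends_cabs.
apply: (@tends_squeeze _ _ (fun M => c * kappa ^- k * (\sum_(p < M.*2.+1)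
    (p.+1%:R^-1 + (M.*2 - p).+1%:R^-1) / dist M p))); last first.
  by have := tendsZ (c * kappa ^- k) window_tends; rewrite mulr0.
move=> M; rewrite !sub0r normrN cabsN ger0_norm ?cabs_ge0 //.
apply: le_trans (_ : \sum_(p < M.*2.+1) cabs ((u p (M.*2 - p)%N - l) * x M p ^- k) <= _).
  elim/big_ind2: _ => [|a b a' b' ha hb|//]; first by rewrite cabs0.
  by apply: le_trans (cabsD _ _) _; rewrite lerD.
rewrite mulr_sumr; apply: ler_sum => p _; rewrite cabsM cabsV cabsX.
rewrite mulrACA; apply: ler_pM => //; rewrite ?cabs_ge0 ?invr_ge0 ?exprn_ge0 ?cabs_ge0 //.
have d1 : 1 <= dist M p by rewrite lerDl.
have d0 : 0 < dist M p by apply: lt_le_trans d1.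
rewrite -invfM lef_pV2 ?posrE ?mulr_gt0 ?exprn_gt0 //; last first.
  by rewrite xE; apply: lt_le_trans (hk _); rewrite mulr_gt0.
apply: le_trans (_ : (kappa * dist M p) ^+ k <= _).
  by rewrite exprMn ler_pM2l ?exprn_gt0 // -{1}(expr1 (dist M p)) ler_weXn2l.
rewrite (ler_pXn2r k0) ?nnegrE ?cabs_ge0 ?mulr_ge0 ?(ltW d0) ?(ltW kappa0) // xE; exact: hk.
Qed.

Variable J : nat -> seq nat -> R.
Hypothesis J0 : forall n, all (leq 2) n -> J 0 n = zeta R n.
Hypothesis JS : forall a n, is_index n ->
  a.+1%:R * J a.+1 n = - \sum_(j < size n) (nth 0%N n j)%:R * J a (incr_nth n j).
Let JC a n : C := (J a n)%:C.

Lemma multitangent_tends n (Psi : nat -> C) : n != [::] -> all (leq 2) n ->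
  (forall k, (2 <= k)%N -> tends (fun M => \sum_(p < M.*2.+1) x M p ^- k) (Psi k)) ->
  pfsum JC JC n (fun k => (k == 1%N)%:R : C^o) = 0 ->
  tends (fun M => csum (size n) 0 M.*2.+1
           (fun s => \prod_(j < size n) (tau - M%:R + (nth 0%N s j)%:R) ^- nth 0%N n j))
        (pfsum JC JC n (fun k => (if (2 <= k)%N then Psi k else 0) : C^o)).
Proof.
move=> n0 n2 hPsi hK.
have nsum : (0 < sumn n)%N by case: n n0 n2 {hK} => [|[|k] n].
pose S M k : C := \sum_(p < M.*2.+1) x M p ^- k.
pose term (J1 J2 : nat -> seq nat -> C) i e b : C :=
  (-1) ^+ (sumn (take i n) + b) * J1 b (rev (take i n)) * J2 (e - b)%N (drop i.+1 n).
pose err M : C := \sum_(i < size n) \sum_(e < nth 0%N n i) \sum_(b < e.+1)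
  \sum_(p < M.*2.+1) (term (htay C p) (htay C (M.*2 - p)) i e b - term JC JC i e b)
    * x M p ^- (nth 0%N n i - e).
have err0 : tends err 0.
  rewrite /err.
  rewrite [X in tends _ X](_ : 0 = \sum_(i < size n) \sum_(e < nth 0%N n i)
      \sum_(b < e.+1) (0 : C)); last first.
    by rewrite big1 // => i _; rewrite big1 // => e _; rewrite big1.
  apply: tends_sum => i _; apply: tends_sum => e _; apply: tends_sum => b _.
  apply: (@error_tends (fun p q => term (htay C p) (htay C q) i e b)); last by rewrite subn_gt0.
  apply: ratedM.
    apply: ratedZ; apply: (htay_rated J0 JS).
    by rewrite all_rev; apply/allP => z /mem_take /(allP n2).
  by apply: (htay_rated J0 JS); apply/allP => z /mem_drop /(allP n2).
have KE (psi : nat -> C) : pfsum JC JC n (fun k => psi k : C^o)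
    = pfsum JC JC n (fun k => (if (2 <= k)%N then psi k else 0) : C^o).
  suff -> : pfsum JC JC n (fun k => psi k : C^o)
      = pfsum JC JC n (fun k => (if (2 <= k)%N then psi k else 0) : C^o)
      + psi 1%N * pfsum JC JC n (fun k => (k == 1%N)%:R : C^o) by rewrite hK mulr0 addr0.
  rewrite /pfsum mulr_sumr -big_split /=.
  apply: eq_bigr => i _; rewrite mulr_sumr -big_split /=; apply: eq_bigr => e _.
  rewrite mulr_sumr -big_split /=; apply: eq_bigr => b _; rewrite /GRing.scale /=.
  have : (0 < nth 0%N n i - e)%N by rewrite subn_gt0.
  case: (nth 0%N n i - e)%N => [|[|k]] //= _; first by rewrite mulr0 mulr1 add0r mulrC.
  by rewrite !mulr0 addr0.
have main : tends (fun M => pfsum JC JC n (fun k => S M k : C^o) : C)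
    (pfsum JC JC n (fun k => (if (2 <= k)%N then Psi k else 0) : C^o)).
  apply: (@eq_tends _ (fun M => pfsum JC JC n (fun k => (if (2 <= k)%N then S M k else 0) : C^o))).
    by move=> M; rewrite -KE.
  rewrite /pfsum; apply: tends_sum => i _; apply: tends_sum => e _; apply: tends_sum => b _.
  apply: tendsZ; case: ifP => k2; [exact: hPsi|exact: tends_cst].
have := tendsD err0 main; rewrite add0r; apply: eq_tends => M.
rewrite (window_sum nsum); last first.
  move=> p _; rewrite -/(x M p) xE; case: tau tau0 => a b /= b0.
  by rewrite eq_complex /= addr0 [b == 0]gt_eqF ?andbF.
rewrite /pfsum [RHS]exchange_big /= /err -big_split /=; apply: eq_bigr => i _.
rewrite [RHS]exchange_big /= -big_split /=; apply: eq_bigr => e _.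
rewrite [RHS]exchange_big /= -big_split /=; apply: eq_bigr => b _.
rewrite /S /GRing.scale /= mulr_sumr -big_split /=; apply: eq_bigr => p _.
by rewrite subSS mulrBl /term subrK.
Qed.

End Multitangents.

(** * Multiple Eisenstein series *)

Section Blocks.
Variable K : pzRingType.

Definition rowsum (X : nat -> nat -> K) (N lo : nat) (n : seq nat) : K :=
  csum (size n) lo N (fun s => \prod_(j < size n) X (nth 0%N n j) (nth 0%N s j)).

Lemma rowsum_nil X N lo : rowsum X N lo [::] = 1.
Proof. by rewrite /rowsum /= big_ord0. Qed.

Lemma rowsum_cons X N lo k n :
  rowsum X N lo (k :: n) = \sum_(lo <= m < N) X k m * rowsum X N m.+1 n.
Proof.
rewrite /rowsum /=; apply: eq_bigr => m _; rewrite -csumZ.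
by apply: eq_csumr => s; rewrite big_ord_recl.
Qed.

(* The sum over the ways to cut n into blocks and to put these on increasing
   rows l < l_1 < l_2 < .. <= L; a block m on the row l contributes T l m. *)
Fixpoint rowblocks (T : nat -> seq nat -> K) (L f l : nat) (n : seq nat) : K :=
  match f, n with
  | f'.+1, _ :: _ =>
      \sum_(j < size n) \sum_(l.+1 <= l' < L.+1)
        T l' (take j.+1 n) * rowblocks T L f' l' (drop j.+1 n)
  | _, _ => 1
  end.

(* The sum over the increasing paths in the lexicographic order on the
   lattice points (l, m) with l <= L and m < N *)
Fixpoint lexsum (X : nat -> nat -> nat -> K) (L N l m : nat) (n : seq nat) : K :=
  if n is k :: n' then
    \sum_(m.+1 <= m' < N) X l k m' * lexsum X L N l m' n'
    + \sum_(l.+1 <= l' < L.+1) \sum_(m' < N) X l' k m' * lexsum X L N l' m' n'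
  else 1.

Lemma lexsum_rowblocks X L N f l m n : (size n <= f)%N ->
  lexsum X L N l m n = \sum_(j < (size n).+1)
    rowsum (X l) N m.+1 (take j n)
    * rowblocks (fun l' => rowsum (X l') N 0) L f l (drop j n).
Proof.
elim: n f l m => [|k n IH] [|f] l m //=; try by rewrite big_ord1 /= rowsum_nil mulr1.
rewrite ltnS => nf; rewrite big_ord_recl /= rowsum_nil mul1r addrC; congr (_ + _).
  rewrite [RHS]exchange_big /=; apply: eq_bigr => l' _.
  under eq_bigr => m' _ do rewrite (IH f) // mulr_sumr.
  rewrite exchange_big /=; apply: eq_bigr => j _.
  rewrite rowsum_cons big_mkord mulr_suml; apply: eq_bigr => m' _; exact: mulrA.
under eq_bigr => m' _ do rewrite (IH f.+1) 1?ltnW // mulr_sumr.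
rewrite exchange_big /=; apply: eq_bigr => j _.
rewrite add0n rowsum_cons mulr_suml.
by apply: eq_bigr => m' _; exact: mulrA.
Qed.

End Blocks.

Lemma sum_lattice (V : nmodType) (L M l m : nat) (f : int * int -> V) : (l <= L)%N ->
  \sum_(y : 'I_L.*2.+1 * 'I_M.*2.+1 |
      lattice_lt (l%:Z, m%:Z - M%:Z) (box_val y)) f (box_val y)
  = \sum_(m.+1 <= m' < M.*2.+1) f (l%:Z, m'%:Z - M%:Z)
    + \sum_(l.+1 <= l' < L.+1) \sum_(m' < M.*2.+1) f (l'%:Z, m'%:Z - M%:Z).
Proof.
move=> lL; pose g (i j : nat) := f (i%:Z - L%:Z, j%:Z - M%:Z).
pose c (i j : nat) := (L + l < i)%N || (i == L + l)%N && (m < j)%N.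
transitivity (\sum_(0 <= i < L.*2.+1) \sum_(0 <= j < M.*2.+1 | c i j) g i j).
  rewrite big_mkord; under [RHS]eq_bigr => i _ do rewrite big_mkord.
  rewrite pair_big_dep /=; apply: eq_bigl => -[i j] /=.
  rewrite /lattice_lt /lattice_pos /box_val /c /=.
  by apply/idP/idP; lia.
have L2 : (L + l < L.*2.+1)%N by lia.
rewrite (@big_cat_nat _ _ _ (L + l)) //=; last exact: ltnW.
rewrite big_nat big1 ?add0r; last first.
  by move=> i /andP[_ il]; rewrite big_pred0 // => j; rewrite /c; lia.
rewrite big_ltn //; congr (_ + _).
  rewrite (@big_nat_widenl _ _ _ m.+1 0) //.
  apply: eq_big => [j|j _]; first by rewrite /c eqxx ltnn.
  by congr (f (_, _)); rewrite PoszD; lia.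
rewrite -addnS addnC big_addn (_ : (L.*2.+1 - L = L.+1)%N); last by lia.
rewrite !big_nat; apply: eq_bigr => i /andP[li _].
rewrite big_mkord; apply: eq_big => [j|j _]; first by rewrite /c; lia.
by congr (f (_, _)); rewrite PoszD; lia.
Qed.

Section GPartial.
Variable R : realType.
Local Notation C := R[i].
Variable tau : C.

Definition lpoint (M l k m : nat) : C := (l%:R * tau - M%:R + m%:R) ^- k.

Lemma lattice_valE (l M m : nat) :
  lattice_val tau (l%:Z, m%:Z - M%:Z) = l%:R * tau - M%:R + m%:R.
Proof. by rewrite /lattice_val /= rmorphB /= addrA addrAC. Qed.

Lemma G_partial_lexsum L M l m n : (l <= L)%N ->
  \sum_(x : (size n).-tuple ('I_(L.*2.+1) * 'I_(M.*2.+1))%type |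
      path lattice_lt (l%:Z, m%:Z - M%:Z) (map (@box_val L M) x))
    \prod_(j < size n) (lattice_val tau (nth (0, 0) (map (@box_val L M) x) j) ^- nth 0%N n j)
  = lexsum (lpoint M) L M.*2.+1 l m n.
Proof.
elim: n l m => [|k n IH] l m lL.
  by under eq_bigr => x _ do rewrite big_ord0; rewrite (big_tuple0_path _ _ _ (fun=> 1)).
pose F n (s : seq (int * int)) : C :=
  \prod_(j < size n) (lattice_val tau (nth (0, 0) s j) ^- nth 0%N n j).
apply: (etrans (big_tuple_path _ _ _ _ (F (k :: n)))).
pose H (z : int * int) : C := lattice_val tau z ^- k
  * \sum_(x : (size n).-tuple ('I_(L.*2.+1) * 'I_(M.*2.+1))%type |
      path lattice_lt z (map (@box_val L M) x)) F n (map (@box_val L M) x).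
transitivity (\sum_(y : 'I_L.*2.+1 * 'I_M.*2.+1 |
    lattice_lt (l%:Z, m%:Z - M%:Z) (box_val y)) H (box_val y)).
  apply: eq_bigr => y _; rewrite /H mulr_sumr; apply: eq_bigr => x _.
  by rewrite /F big_ord_recl.
rewrite sum_lattice //; congr (_ + _).
  by apply: eq_bigr => m' _; rewrite /H lattice_valE IH.
rewrite !big_nat; apply: eq_bigr => l' /andP[_ l'L].
by apply: eq_bigr => m' _; rewrite /H lattice_valE IH.
Qed.

Lemma G_partial_rowblocks L M n :
  G_partial n tau L M = \sum_(j < (size n).+1) (zsum R (take j n) M)%:C
    * rowblocks (fun l => rowsum (lpoint M l) M.*2.+1 0) L (size n) 0 (drop j n).
Proof.
transitivity (lexsum (lpoint M) L M.*2.+1 0 M n).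
  rewrite -G_partial_lexsum // subrr; apply: eq_bigr => x _; apply: eq_bigr => j _.
  by rewrite (nth_map (tnth x j)) ?size_tuple // -tnth_nth.
rewrite (@lexsum_rowblocks _ _ _ _ (size n)) //; apply: eq_bigr => j _; congr (_ * _).
rewrite /rowsum /zsum (raddf_csum (real_complex R : {additive R -> C})).
rewrite -[M.+1 in LHS]addn1 -[M.*2.+1](_ : (M + M.+1 = _)%N); last by lia.
rewrite csum_shift; apply: eq_csum => s ss _ _ /=.
rewrite rmorph_prod; apply: eq_bigr => i _.
rewrite /lpoint (nth_map 0%N) ?ss // fmorphV rmorphXn rmorph_nat natrD mul0r sub0r.
by rewrite addrA addNr add0r.
Qed.

Lemma rowblocks_tends (T : nat -> nat -> seq nat -> C) (T' : nat -> seq nat -> C) L f l n :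
  (forall l n, (0 < l)%N -> n != [::] -> all (leq 2) n ->
     tends (fun M => T M l n) (T' l n)) ->
  all (leq 2) n ->
  tends (fun M => rowblocks (T M) L f l n) (rowblocks T' L f l n).
Proof.
move=> hT; elim: f l n => [|f IH] l [|k n] n2; [exact: (tends_cst 1)..|].
apply: tends_sum => j _.
rewrite big_seq; under eq_fun => M do rewrite big_seq.
apply: tends_sum => l'; rewrite mem_index_iota => /andP[ll' _]; apply: tendsM.
  by apply: hT => //; [exact: leq_ltn_trans ll'|apply/allP => z /mem_take /(allP n2)].
by apply: IH; apply/allP => z /mem_drop /(allP n2).
Qed.

Section Inner.
Hypothesis tau0 : 0 < complex.Im tau.
Variable J : nat -> seq nat -> R.
Hypothesis J0 : forall n, all (leq 2) n -> J 0 n = zeta R n.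
Hypothesis JS : forall a n, is_index n ->
  a.+1%:R * J a.+1 n = - \sum_(j < size n) (nth 0%N n j)%:R * J a (incr_nth n j).
Let JC a n : C := (J a n)%:C.
Hypothesis JK : forall n, n != [::] -> all (leq 2) n ->
  pfsum JC JC n (fun k => (k == 1%N)%:R : C^o) = 0.
Variable Psi : nat -> nat -> C.
Hypothesis hPsi : forall l k, (0 < l)%N -> (2 <= k)%N ->
  tends (fun M => \sum_(p < M.*2.+1) (l%:R * tau - M%:R + p%:R) ^- k) (Psi l k).

Lemma G_partial_tends L n : all (leq 2) n ->
  tends (G_partial n tau L) (\sum_(j < (size n).+1) (zeta R (take j n))%:C
    * rowblocks (fun l m => pfsum JC JC m
                   (fun k => (if (2 <= k)%N then Psi l k else 0) : C^o))
        L (size n) 0 (drop j n)).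
Proof.
move=> n2; apply: (eq_tends (fun M => esym (G_partial_rowblocks L M n))).
apply: tends_sum => j _; apply: tendsM.
  by apply/tends_complex/zeta_tends/allP => z /mem_take /(allP n2).
apply: rowblocks_tends; last by apply/allP => z /mem_drop /(allP n2).
move=> l m l0 m0 m2; apply: (multitangent_tends _ J0 JS) => //; last 2 first.
- by move=> k; exact: hPsi.
- exact: JK.
by rewrite mulr_natl raddfMn pmulrn_lgt0.
Qed.

End Inner.
End GPartial.

Section RowblocksBlocksum.
Variable K : numFieldType.
Variables (X : bool -> word -> bool -> K) (Psi : nat -> nat -> K) (L : nat).

Fixpoint rowseries (l : nat) (s : seq nat) : K :=
  if s is k :: s' then \sum_(l.+1 <= l' < L.+1) Psi l' k * rowseries l' s' else 1.

Lemma eq_pfsum (J1 J2 : nat -> seq nat -> K) n (psi psi' : nat -> K^o) :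
  psi =1 psi' -> pfsum J1 J2 n psi = pfsum J1 J2 n psi'.
Proof. by move=> h; do 3!(apply: eq_bigr => ? _); rewrite h. Qed.

Lemma pfsum_sum (I : Type) (r : seq I) (J1 J2 : nat -> seq nat -> K) n
    (psi : I -> nat -> K) (c : I -> K) :
  pfsum J1 J2 n (fun k => (\sum_(i <- r) psi i k * c i) : K^o)
  = \sum_(i <- r) pfsum J1 J2 n (fun k => psi i k : K^o) * c i.
Proof.
rewrite /pfsum; under [RHS]eq_bigr => i _.
  rewrite mulr_suml; under eq_bigr => j _.
    rewrite mulr_suml; under eq_bigr => e _ do rewrite mulr_suml.
    over.
  over.
rewrite [RHS]exchange_big; apply: eq_bigr => j _.
rewrite [RHS]exchange_big; apply: eq_bigr => e _.
rewrite [RHS]exchange_big; apply: eq_bigr => b _.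
by rewrite /GRing.scale /= mulr_sumr; apply: eq_bigr => i _; rewrite mulrA.
Qed.

Lemma eq_blocksum f n (phi phi' : seq nat -> K) :
  phi =1 phi' -> blocksum X f n phi = blocksum X f n phi'.
Proof.
elim: f n phi phi' => [|f IH] [|k n] phi phi' h /=; try exact: h.
apply: eq_bigr => j _; apply: eq_pfsum => p; case: ifP => // _.
by apply: IH => s; exact: h.
Qed.

Lemma blocksum_sum (I : Type) (r : seq I) f n (phi : I -> seq nat -> K) (c : I -> K) :
  blocksum X f n (fun s => \sum_(i <- r) phi i s * c i)
  = \sum_(i <- r) blocksum X f n (phi i) * c i.
Proof.
elim: f n phi => [|f IH] [|k n] phi //=.
under [RHS]eq_bigr => i _ do rewrite mulr_suml.
rewrite [RHS]exchange_big; apply: eq_bigr => j _; rewrite -pfsum_sum.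
apply: eq_pfsum => p; case: ifP => _; first exact: IH.
by rewrite big1 // => i _; rewrite mul0r.
Qed.

Lemma rowblocks_blocksum f l n :
  rowblocks (fun l m => pfsum (xlead X) (xlead X) m
     (fun k => (if (2 <= k)%N then Psi l k else 0) : K^o)) L f l n
  = blocksum X f n (rowseries l).
Proof.
elim: f l n => [|f IH] l [|k n] //=; apply: eq_bigr => j _.
under eq_bigr => l' _ do rewrite IH.
rewrite -pfsum_sum; apply: eq_pfsum => p; case: ifP => _.
  under eq_bigr => l' _ do rewrite mulrC.
  by rewrite -blocksum_sum; apply: eq_blocksum => s /=; apply: eq_bigr => l' _; rewrite mulrC.
by rewrite big1 // => i _; rewrite mul0r.
Qed.

End RowblocksBlocksum.

Lemma blocksum_tends (K : numFieldType) (X : bool -> word -> bool -> K) f n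
    (phi : nat -> seq nat -> K) (phi' : seq nat -> K) :
  (forall s, all (leq 2) s -> tends (phi^~ s) (phi' s)) ->
  tends (fun N => blocksum X f n (phi N)) (blocksum X f n phi').
Proof.
elim: f n phi phi' => [|f IH] [|k n] phi phi' h /=; try exact: h.
apply: tends_sum => j _; rewrite /pfsum.
apply: tends_sum => i _; apply: tends_sum => e _; apply: tends_sum => b _.
apply: tendsZ; case: ifP => k2; last exact: tends_cst.
by apply: IH => s s2; apply: h; rewrite /= k2.
Qed.

(** * The q-series g^sh *)

Section Multinomial.
Variables (A : comAlgType rat) (I : finType).

(* Compare the coefficients of T^d in prod_i exp(T y_i) = exp(T sum_i y_i). *)
Lemma multinomial (y : I -> A) D d : (d < D)%N ->
  \sum_(f : {ffun I -> 'I_D} | (\sum_i f i)%N == d)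
    \prod_i ((f i)`!%:R^-1 *: y i ^+ f i)
  = d`!%:R^-1 *: (\sum_i y i) ^+ d.
Proof.
move=> dD; pose E (z : A) : {poly A} := \poly_(b < D) (b`!%:R^-1 *: z ^+ b).
have expE (s : seq I) e : (e < D)%N ->
    (\prod_(i <- s) E (y i))`_e = e`!%:R^-1 *: (\sum_(i <- s) y i) ^+ e.
  elim: s e => [|i s IH] e eD.
    by rewrite !big_nil coefC expr0n; case: e eD => [|e] _; rewrite ?fact0 ?invr1 ?scale1r ?scaler0.
  rewrite !big_cons coefM addrC exprDn scaler_sumr; apply: eq_bigr => -[b be] _ /=.
  have be' : (b <= e)%N by rewrite -ltnS.
  rewrite IH; last exact: leq_ltn_trans (leq_subr _ _) eD.
  rewrite coef_poly (leq_ltn_trans be' eD) -scalerAl -scalerAr scalerA.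
  rewrite -scaler_nat scalerA [y i ^+ b * _]mulrC; congr (_ *: _).
  have := bin_fact be' => /(congr1 (fun m => m%:R : rat)) <-.
  rewrite !natrM; field.
  by rewrite !pnatr_eq0 -!lt0n !fact_gt0 bin_gt0 be'.
rewrite -[\sum_i y i]big_enum -expE // big_enum.
have -> : \prod_i E (y i) = \sum_(f : {ffun I -> 'I_D})
    (\prod_i ((f i)`!%:R^-1 *: y i ^+ f i)) *: 'X^(\sum_i f i)%N.
  under eq_bigr => i _ do rewrite /E poly_def.
  rewrite bigA_distr_bigA; apply: eq_bigr => f _.
  by rewrite scaler_prod -prodrXr.
rewrite coef_sum big_mkcond; apply: eq_bigr => f _.
by rewrite coefZ coefXn eq_sym; case: eqP; rewrite ?mulr1 ?mulr0.
Qed.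

End Multinomial.

Lemma sum_bmultinom (V : nmodType) m D (F : multinom m -> V) :
  \sum_(b : bmultinom m D.+1) F b
  = \sum_(d < D.+1) \sum_(f : {ffun 'I_m -> 'I_D.+1} | (\sum_i f i)%N == d)
      F (Multinom [tuple (f i : nat) | i < m]).
Proof.
pose mn (f : {ffun 'I_m -> 'I_D.+1}) := Multinom [tuple (f i : nat) | i < m].
have mnE f i : mn f i = f i by rewrite mpoly.multinomE tnth_mktuple.
have mdegE' f : mpoly.mdeg (mn f) = (\sum_i f i)%N.
  by rewrite mpoly.mdegE; apply: eq_bigr => i _; rewrite mnE.
transitivity (\sum_(f : {ffun 'I_m -> 'I_D.+1} | (\sum_i f i < D.+1)%N) F (mn f)).
  have b0 : (mpoly.mdeg (@mpoly.mnm0 m) < D.+1)%N by rewrite mpoly.mdeg0.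
  pose h (b : bmultinom m D.+1) := [ffun i => inord (b i) : 'I_D.+1].
  have hE b i : (h b i : nat) = b i.
    rewrite ffunE inordK //; apply: leq_ltn_trans (mpoly.bmdeg b).
    by rewrite mpoly.mdegE (bigD1 i) //= leq_addr.
  have mnh b : mn (h b) = b by apply/mpoly.mnmP => i; rewrite mnE hE.
  rewrite (reindex_onto h (fun f => insubd (BMultinom b0) (mn f))) /=; last first.
    move=> f fD; apply/ffunP => i; apply: val_inj; rewrite /= hE.
    by rewrite val_insubd mdegE' fD mnE.
  apply: eq_big => [b|b _]; last by rewrite mnh.
  rewrite mnh -mdegE' mnh mpoly.bmdeg /=; apply/esym/eqP/val_inj.
  by rewrite val_insubd mpoly.bmdeg.
rewrite (exchange_big_dep (fun f : {ffun 'I_m -> 'I_D.+1} => (\sum_i f i < D.+1)%N)) /=; last first.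
  by move=> d f _ /eqP ->.
by apply: eq_bigr => f fD; rewrite (big_pred1 (Ordinal fD)).
Qed.

Section ExponentialSubstitution.
Variables (m r : nat) (v : 'I_m -> rat) (L : 'I_m -> mpoly r rat) (w : 'I_r -> rat).

(* Substituting linear forms in exp(sum_j v_j y_j) gives exp(sum_i w_i x_i). *)
Lemma exp_subst (alpha : multinom r) :
  \sum_j v j *: L j = \sum_i w i *: xvar i ->
  \sum_(b : bmultinom m (mpoly.mdeg alpha).+1)
    (\prod_j (v j ^+ b j / (b j)`!%:R)) * mpoly.mcoeff alpha (\prod_j L j ^+ b j)
  = \prod_i (w i ^+ alpha i / (alpha i)`!%:R).
Proof.
move=> vw; set D := mpoly.mdeg alpha.
have mnE n (f : {ffun 'I_n -> 'I_D.+1}) i :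
    Multinom [tuple (f i : nat) | i < n] i = f i by rewrite mpoly.multinomE tnth_mktuple.
rewrite (sum_bmultinom D (fun b => (\prod_j (v j ^+ b j / (b j)`!%:R))
  * mpoly.mcoeff alpha (\prod_j L j ^+ b j))).
transitivity (\sum_(d < D.+1) mpoly.mcoeff alpha (d`!%:R^-1 *: (\sum_j v j *: L j) ^+ d)).
  apply: eq_bigr => d _; rewrite -(multinomial _ (ltn_ord d)) raddf_sum.
  apply: eq_bigr => f _ /=.
  rewrite [in RHS](eq_bigr (fun j => (v j ^+ f j / (f j)`!%:R) *: L j ^+ f j)); last first.
    by move=> j _; rewrite exprZn scalerA mulrC.
  rewrite scaler_prod mpoly.mcoeffZ; congr (_ * _); last congr (mpoly.mcoeff _ _).
    by apply: eq_bigr => j _; rewrite mnE.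
  by apply: eq_bigr => j _; rewrite mnE.
transitivity (\sum_(b : bmultinom r D.+1)
    (\prod_i (w i ^+ b i / (b i)`!%:R)) * (bmnm b == alpha)%:R).
  rewrite (sum_bmultinom D (fun b => (\prod_i (w i ^+ b i / (b i)`!%:R)) * (b == alpha)%:R)).
  apply: eq_bigr => d _; rewrite vw -(multinomial _ (ltn_ord d)) raddf_sum.
  apply: eq_bigr => f _ /=.
  rewrite [in LHS](eq_bigr (fun i => (w i ^+ f i / (f i)`!%:R) *: xvar i ^+ f i)); last first.
    by move=> j _; rewrite exprZn scalerA mulrC.
  rewrite scaler_prod mpoly.mcoeffZ; congr (_ * _); first by apply: eq_bigr => j _; rewrite mnE.
  rewrite -mpoly.mcoeffX mpoly.mpolyXE_id; congr (mpoly.mcoeff _ _).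
  by apply: eq_bigr => j _; rewrite mnE.
rewrite (bigD1 (BMultinom (leqnn D.+1))) //= eqxx mulr1 [X in _ + X]big1 ?addr0 // => b.
by rewrite -val_eqE /= => /negbTE ->; rewrite mulr0.
Qed.

End ExponentialSubstitution.

Section CoefficientsOfG.
Variables (r k : nat).

Definition comp_block m (i : seq nat) (j : 'I_m) (l : 'I_r) : bool :=
  (sumn (take j i) <= l < sumn (take j.+1 i))%N.

Definition comp_weight m (i : seq nat) (u : m.-tuple 'I_k.+1) (l : 'I_r) : rat :=
  \sum_(j < m | comp_block i j l) (tnth u j)%:R.

Definition comp_coef m (i : seq nat) (u : m.-tuple 'I_k.+1) : rat :=
  (\prod_(j < m) (\sum_(1 <= d < k.+1) 'X^(d * tnth u j)) ^+ nth 0%N i j : {poly rat})`_k.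

Definition back_diff (w : 'I_r -> rat) (i : 'I_r) : rat :=
  w (rev_ord i) - \sum_(l < r | l.+1 == rev_ord i :> nat) w l.

Lemma hseriesE (b : multinom r) : hseries b k =
  \sum_(m < r.+1) \sum_(i : m.-tuple 'I_r.+1 |
      all (leq 1) (map val i) && (sumn (map val i) == r))
    \sum_(u : m.-tuple 'I_k.+1 | path ltn 0 (map val u))
      ((\prod_(j < m) (tnth i j)`!%:R)^-1 * comp_coef (map val i) u)
      * \prod_l (comp_weight (map val i) u l ^+ b l / (b l)`!%:R).
Proof.
apply: eq_bigr => m _; apply: eq_bigr => i _; rewrite /qx_subst /Hseries.
rewrite mulr_sumr; under [LHS]eq_bigr => c _ do rewrite mulr_suml mulr_sumr.
rewrite exchange_big; apply: eq_bigr => u _ /=.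
rewrite -(@exp_subst m r (fun j => (tnth u j)%:R)
  (fun j => \sum_(l < r | comp_block (map val i) j l) xvar l)); last first.
  transitivity (\sum_(j < m) \sum_(l < r | comp_block (map val i) j l) (tnth u j)%:R *: xvar l).
    by apply: eq_bigr => j _; rewrite scaler_sumr.
  rewrite (exchange_big_dep xpredT) //=; apply: eq_bigr => l _.
  by rewrite scaler_suml.
rewrite mulr_sumr; apply: eq_bigr => c _.
rewrite [RHS]mulrACA [X in _ = X * _]mulrC -[RHS]mulrA [LHS]mulrCA -[LHS]mulrA; congr (_ * _).
have -> : comp_coef (map val i) u = (\prod_(j < m)
    (\sum_(1 <= d < k.+1) 'X^(d * tnth u j)) ^+ tnth [tuple of map val i] j : {poly rat})`_k.
  rewrite /comp_coef; apply: (congr1 (fun p : {poly rat} => p`_k)).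
  by apply: eq_bigr => j _; rewrite (tnth_nth 0%N).
exact: mulrCA.
Qed.

Lemma g_sh_compositions (a : multinom r) : g_sh a k =
  \sum_(m < r.+1) \sum_(i : m.-tuple 'I_r.+1 |
      all (leq 1) (map val i) && (sumn (map val i) == r))
    \sum_(u : m.-tuple 'I_k.+1 | path ltn 0 (map val u))
      ((\prod_(j < m) (tnth i j)`!%:R)^-1 * comp_coef (map val i) u)
      * \prod_l (back_diff (comp_weight (map val i) u) l ^+ a l / (a l)`!%:R).
Proof.
have stepE (w : 'I_r -> rat) :
    \sum_j w j *: (xvar (rev_ord j) - \sum_(l < r | l.+1 == rev_ord j :> nat) xvar l)
    = \sum_i back_diff w i *: xvar i.
  rewrite /back_diff; under eq_bigr => j _ do rewrite scalerBr.
  under [RHS]eq_bigr => j _ do rewrite scalerBl.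
  rewrite !sumrB; congr (_ - _).
    rewrite (reindex_inj rev_ord_inj) /=; apply: eq_bigr => j _; by rewrite rev_ordK.
  under eq_bigr => j _ do rewrite scaler_sumr.
  rewrite (exchange_big_dep xpredT) //=; apply: eq_bigr => l _.
  rewrite scaler_suml; apply: eq_bigl => j; lia.
rewrite /g_sh /qx_subst; under [LHS]eq_bigr => b _ do rewrite hseriesE mulr_suml.
rewrite exchange_big; apply: eq_bigr => m _.
under [LHS]eq_bigr => b _ do rewrite mulr_suml.
rewrite exchange_big; apply: eq_bigr => i _.
under [LHS]eq_bigr => b _ do rewrite mulr_suml.
rewrite exchange_big; apply: eq_bigr => u _ /=.
rewrite -(exp_subst _ (stepE _)) mulr_sumr; apply: eq_bigr => b _.
by rewrite mulrA.
Qed.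

(* Two consecutive variables of a block have the same weight, so the
   compositions with a part bigger than 1 do not contribute. *)
Lemma g_shE (a : multinom r) : (forall i, 0 < a i)%N -> g_sh a k =
  \sum_(u : r.-tuple 'I_k.+1 | path ltn 0 (map val u))
    (\prod_l (back_diff (fun j => (tnth u j)%:R) l ^+ a l / (a l)`!%:R))
    * (\prod_(j < r) (\sum_(1 <= d < k.+1) 'X^(d * tnth u j)) : {poly rat})`_k.
Proof.
move=> a0; rewrite g_sh_compositions big_ord_recr /= big1 ?add0r; last first.
  move=> m _; apply: big1 => i /andP[/allP i1 /eqP ir]; apply: big1 => u _.
  have [j ij] : exists j : 'I_m, (1 < tnth i j)%N.
    apply/existsP; apply: contraTT (ltn_ord m); rewrite negb_exists => /forallP h.
    have le1 : {in map val i, forall z, (z <= 1)%N}.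
      by move=> z /mapP[y /tnthP[j ->] ->]; rewrite leqNgt h.
    have : (sumn (map val i) <= size (map val i))%N.
      elim: (map val i) le1 => // x t IH le1 /=.
      rewrite -add1n leq_add ?le1 ?mem_head ?IH // => z zt.
      by apply: le1; rewrite in_cons zt orbT.
    by rewrite ir size_map size_tuple -leqNgt.
  pose s j := sumn (take j (map val i)).
  have sS (j' : 'I_m) : s j'.+1 = (s j' + tnth i j')%N.
    rewrite /s (take_nth 0%N) ?size_map ?size_tuple // sumn_rcons (nth_map ord0) ?size_tuple //.
    by rewrite -tnth_nth.
  have smon j1 j2 : (j1 <= j2)%N -> (s j1 <= s j2)%N.
    by move=> h; rewrite /s -(subnKC h) takeD sumn_cat leq_addr.
  have sr : (s j.+1 <= r)%N 
    by have := leq_addr (sumn (drop j.+1 (map val i))) (s j.+1); rewrite -sumn_cat cat_take_drop ir.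
  have l1r : ((s j).+1 < r)%N.
    by apply: leq_trans sr; rewrite sS; lia.
  pose l1 := Ordinal l1r; pose l0 := Ordinal (ltnW l1r).
  have bl (j' : 'I_m) (c : nat) : (c < 2)%N ->
      (s j' <= s j + c < s j'.+1)%N = (j' == j).
    move=> c2; rewrite -val_eqE; case: (ltngtP j' j) => jj.
    - have := smon _ _ jj; rewrite /=; lia.
    - have := smon _ _ jj; rewrite sS /=; lia.
    - by move/val_inj: jj => ->; rewrite sS; lia.
  have we : comp_weight (map val i) u l1 = comp_weight (map val i) u l0.
    apply: eq_bigl => j'; have := bl j' 1%N isT; have := bl j' 0%N isT.
    by rewrite addn0 addn1 => <-.
  rewrite (bigD1 (rev_ord l1)) //= /back_diff rev_ordK (big_pred1 l0); last first.
    by move=> l; rewrite /= eqSS -val_eqE.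
  by rewrite we subrr expr0n eqn0Ngt a0 mul0r mul0r mulr0.
pose i1 : r.-tuple 'I_r.+1 := [tuple of nseq r (inord 1)].
have i1E : map val i1 = nseq r 1%N.
  rewrite map_nseq; case: r => [//|r']; by rewrite /= inordK.
rewrite (big_pred1 i1); last first.
  move=> i; apply/andP/eqP => [[/allP h1 /eqP hr]|->]; last first.
    by rewrite i1E sumn_nseq mul1n eqxx all_nseq orbT.
  apply: val_inj; apply: (inj_map val_inj); rewrite i1E.
  have sz : size (map val i) = r by rewrite size_map size_tuple.
  move: h1 hr sz; move: (map val i) => t {i}.
  have ge t' : {in t', forall z, (0 < z)%N} -> (size t' <= sumn t')%N.
    elim: t' => // x t' IH h /=; rewrite -add1n leq_add ?IH ?h ?mem_head // => z zt.
    by apply: h; rewrite in_cons zt orbT.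
  move=> h1 hr sz; rewrite -sz in hr *; elim: t h1 hr {sz} => [//|x t IH] h1 /= hr.
  have h1' : {in t, forall z, (0 < z)%N} by move=> z zt; apply: h1; rewrite in_cons zt orbT.
  have x0 : (0 < x)%N := h1 x (mem_head _ _).
  have st : (size t <= sumn t)%N := ge _ h1'.
  have x1 : x = 1%N.
    by apply/eqP; rewrite eqn_leq x0 andbT -(leq_add2r (size t)) add1n -hr leq_add2l.
  have tS : sumn t = size t by apply/eqP; rewrite -eqSS -hr x1.
  by rewrite x1 {1}(IH h1' tS).
apply: eq_bigr => u _; rewrite [prod in prod^-1]big1 ?invr1 ?mul1r; last first.
  move=> j _; have := congr1 (fun t => nth 0%N t j) i1E.
  by rewrite (nth_map ord0) ?size_tuple // -tnth_nth nth_nseq ltn_ord => ->.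
rewrite i1E mulrC; congr (_ * _).
  apply: eq_bigr => l _; rewrite (_ : back_diff _ _ = back_diff (fun j => (tnth u j)%:R) l) //.
  have we j : comp_weight (nseq r 1%N) u j = (tnth u j)%:R.
    rewrite /comp_weight (big_pred1 j) // => j'.
    rewrite /comp_block !take_nseq ?(ltnW (ltn_ord _)) //.
    by rewrite !sumn_nseq !mul1n /= -val_eqE /=; lia.
  by rewrite /back_diff we; congr (_ - _); apply: eq_bigr => j _.
apply: (congr1 (fun p : {poly rat} => p`_k)).
by apply: eq_bigr => j _; rewrite nth_nseq ltn_ord expr1.
Qed.

End CoefficientsOfG.

Section Boxes.

Fixpoint boxes (r N : nat) : seq (seq nat) :=
  if r is r'.+1 then [seq x :: s | x <- iota 1 N, s <- boxes r' N] else [:: [::]].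

Lemma mem_boxes r N s :
  (s \in boxes r N) = (size s == r) && all (fun x => 0 < x <= N)%N s.
Proof.
elim: r s => [|r IH] s; first by rewrite inE; case: s.
apply/allpairsP/idP => [[[x t] /= [xN tr ->]]|].
  by move: xN tr; rewrite mem_iota add1n ltnS IH /= eqSS => -> /andP[-> ->].
case: s => //= x t /andP[tr /andP[xN tN]]; exists (x, t).
by rewrite mem_iota add1n ltnS IH -eqSS tr tN xN.
Qed.

Lemma size_boxes r N s : s \in boxes r N -> size s = r.
Proof. by rewrite mem_boxes => /andP[/eqP]. Qed.

Lemma nth_boxes r N s j : s \in boxes r N -> (j < r)%N -> (0 < nth 0%N s j <= N)%N.
Proof. by rewrite mem_boxes => /andP[/eqP <- /all_nthP h] /h. Qed.

Lemma boxes_uniq r N : uniq (boxes r N).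
Proof.
elim: r => // r IH; apply: allpairs_uniq => //; first exact: iota_uniq.
by move=> [x s] [y t] _ _ /= [-> ->].
Qed.

Section BoxSums.
Variable V : nmodType.
Implicit Types f g : seq nat -> V.

Lemma big_boxesS r N f :
  \sum_(s <- boxes r.+1 N) f s
  = \sum_(1 <= x < N.+1) \sum_(s <- boxes r N) f (x :: s).
Proof. by rewrite /= big_allpairs_dep /= /index_iota subSS subn0. Qed.

Lemma big_boxes_rev r N f :
  \sum_(s <- boxes r N) f (rev s) = \sum_(s <- boxes r N) f s.
Proof.
rewrite -(big_map rev xpredT f); apply: perm_big; apply: uniq_perm.
- by rewrite map_inj_uniq ?boxes_uniq //; exact: inv_inj revK.
- exact: boxes_uniq.
move=> s; rewrite -[s in LHS]revK mem_map; last exact: inv_inj revK.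
by rewrite !mem_boxes size_rev all_rev.
Qed.

Lemma big_boxes_widen r W B f : (W <= B)%N ->
  \sum_(s <- boxes r W) f s = \sum_(s <- boxes r B | all (fun x => x <= W)%N s) f s.
Proof.
move=> WB; rewrite -[RHS]big_filter; apply: perm_big; apply: uniq_perm.
- exact: boxes_uniq.
- exact/filter_uniq/boxes_uniq.
move=> s; rewrite mem_filter !mem_boxes andbCA; congr (_ && _).
rewrite -all_predI; apply: eq_all => x /=; lia.
Qed.

(* An increasing sequence is determined by its successive differences. *)
Lemma csum_boxes r c N f :
  (forall s, size s = r -> has (ltn N) s -> f s = 0) ->
  csum r c.+1 N.+1 f = \sum_(d <- boxes r N) f (scanl addn c d).
Proof.
elim: r c f => [|r IH] c f f0; first by rewrite big_seq1.
rewrite big_boxesS /=; pose h j := \sum_(d <- boxes r N) f (j :: scanl addn j d).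
transitivity (\sum_(c.+1 <= j < N.+1) h j).
  apply: eq_bigr => j _; apply: (IH _ (fun s => f (j :: s))) => s ss sN.
  by apply: f0; rewrite /= ?ss ?sN ?orbT.
have h0 j : (N < j)%N -> h j = 0.
  move=> Nj; rewrite /h big_seq big1 // => d /size_boxes ds.
  by apply: f0; rewrite /= ?size_scanl ?ds ?Nj.
have -> : \sum_(1 <= x < N.+1) h (c + x)%N = \sum_(c.+1 <= j < c + N.+1) h j.
  rewrite -[c.+1]add1n big_addn addKn.
  by apply: eq_bigr => x _; rewrite addnC.
have [cN|Nc] := leqP c N.
  rewrite [RHS](@big_cat_nat _ _ _ N.+1) //=; last by rewrite leq_addl.
  by rewrite [X in _ = _ + X]big_nat [X in _ = _ + X]big1 ?addr0 // => j /andP[/h0].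
rewrite big_geq; last by rewrite ltnS ltnW.
by rewrite big_nat big1 // => j /andP[cj _]; rewrite h0 // (ltn_trans Nc).
Qed.

End BoxSums.

Lemma boxes_prod (K : comPzRingType) r N (f : nat -> nat -> K) :
  \sum_(s <- boxes r N) \prod_(j < r) f j (nth 0%N s j)
  = \prod_(j < r) \sum_(1 <= x < N.+1) f j x.
Proof.
elim: r f => [|r IH] f; first by rewrite big_seq1 !big_ord0.
rewrite big_boxesS big_ord_recl mulr_suml; apply: eq_bigr => x _.
by rewrite -(IH (fun j => f j.+1)) mulr_sumr; apply: eq_bigr => s _; rewrite big_ord_recl.
Qed.

Definition dot (u v : seq nat) : nat :=
  (\sum_(j < size u) nth 0 u j * nth 0 v j)%N.

Lemma dot_cons x u y v : dot (x :: u) (y :: v) = (x * y + dot u v)%N.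
Proof. by rewrite /dot big_ord_recl. Qed.

Lemma dot_rcons x u y v : size u = size v ->
  dot (rcons u x) (rcons v y) = (dot u v + x * y)%N.
Proof.
move=> uv; rewrite /dot size_rcons big_ord_recr /= !nth_rcons -uv ltnn eqxx.
by congr (_ + _)%N; apply: eq_bigr => j _; rewrite !nth_rcons -uv ltn_ord.
Qed.

Lemma dot_scanl c d u : size d = size u ->
  dot d (scanl addn c u) = (c * sumn d + dot d (scanl addn 0 u))%N.
Proof.
elim: d u c => [|y d IH] [|x u] c //=; first by rewrite /dot !big_ord0 muln0.
move=> [du]; rewrite !dot_cons (IH _ (c + x)%N) // add0n (IH _ x) //; nia.
Qed.

Lemma nth_scanl_addn c d j : (j < size d)%N ->
  nth 0%N (scanl addn c d) j = (c + sumn (take j.+1 d))%N.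
Proof.
elim: d c j => // x d IH c [|j] /= jd; first by rewrite take0 addn0.
by rewrite IH // addnA.
Qed.

Lemma scanl_addn_rcons c d y :
  scanl addn c (rcons d y) = rcons (scanl addn c d) (c + sumn d + y)%N.
Proof.
elim: d c => [|x d IH] c /=; first by rewrite addn0.
by rewrite IH addnA.
Qed.

(* sum_j d_j (u_1 + .. + u_j) = sum_i u_i (d_i + .. + d_r) *)
Lemma dot_scanl_rev d u : size d = size u ->
  dot d (scanl addn 0 u) = dot (rev u) (scanl addn 0 (rev d)).
Proof.
elim: d u => [|y d IH] [|x u] //= [du].
rewrite dot_cons !rev_cons scanl_addn_rcons dot_rcons; last by rewrite size_scanl !size_rev.
rewrite -IH // !add0n (dot_scanl x) // sumn_rev mulnDr [RHS]addnC [(y * x)%N]mulnC.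
by rewrite addnA [(x * sumn d + _)%N]addnC.
Qed.

Lemma leq_dot u v j : (j < size u)%N -> (nth 0 u j * nth 0 v j <= dot u v)%N.
Proof. by move=> ju; rewrite /dot (bigD1 (Ordinal ju)) //= leq_addr. Qed.

End Boxes.

Definition weight (K : numFieldType) (n w : seq nat) : K :=
  \prod_(i < size n) ((nth 0%N w i)%:R ^+ (nth 0%N n i).-1 / ((nth 0%N n i).-1)`!%:R).

(* The coefficient of x^N in the sum over 0 < l_1 < .. < l_r <= L and
   1 <= w_i <= W of prod_i w_i^(n_i - 1) / (n_i - 1)! x^(w_i l_i) *)
Definition acoef (K : numFieldType) (L W : nat) (n : seq nat) (N : nat) : K :=
  csum (size n) 1 L.+1 (fun l => \sum_(w <- boxes (size n) W)
    weight K n w * (dot w l == N)%:R).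

Lemma prod_geometric (u : seq nat) k :
  \prod_(x <- u) (\sum_(1 <= d < k.+1) 'X^(d * x)) =
  \sum_(d <- boxes (size u) k) 'X^(dot d u) :> {poly rat}.
Proof.
elim: u => [|x u IH]; first by rewrite big_nil big_seq1 /dot big_ord0 expr0.
rewrite big_cons big_boxesS IH mulr_suml; apply: eq_bigr => d _.
by rewrite mulr_sumr; apply: eq_bigr => s _; rewrite dot_cons exprD.
Qed.

Lemma g_sh_acoef (n : seq nat) k : all (leq 2) n ->
  g_sh (Multinom [tuple (nth 0%N n j).-1 | j < size n]) k = acoef rat k k n k.
Proof.
move=> n2; set r := size n; rewrite g_shE; last first.
  move=> i; rewrite mpoly.multinomE tnth_mktuple.
  by have := all_nthP 0%N n2 i (ltn_ord i); case: (nth 0%N n i) => [|[]].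
pose D (s : seq nat) : rat := \prod_(l < r)
  (back_diff (fun j : 'I_r => (nth 0%N s j)%:R) l ^+ (nth 0%N n l).-1
   / ((nth 0%N n l).-1)`!%:R).
pose g (s : seq nat) : rat := D s * \sum_(d <- boxes (size s) k) (dot d s == k)%:R.
transitivity (csum r 1 k.+1 g).
  rewrite -big_tuple_ltn; apply: eq_bigr => u _; rewrite /g; congr (_ * _).
    apply: eq_bigr => l _; rewrite mpoly.multinomE tnth_mktuple; congr (_ ^+ _ / _).
    by rewrite /back_diff; congr (_ - _); [|apply: eq_bigr => j _];
      rewrite (nth_map ord0) ?size_tuple // -tnth_nth.
  transitivity ((\sum_(d <- boxes (size (map val u)) k) 'X^(dot d (map val u)) : {poly rat})`_k).
    rewrite -prod_geometric big_map big_tuple; apply: (congr1 (fun p : {poly rat} => p`_k)).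
    by apply: eq_bigr => j _.
  rewrite coef_sum; apply: eq_bigr => d _; by rewrite coefXn eq_sym.
rewrite csum_boxes; last first.
  move=> s ss /(has_nthP 0%N)[j js jk]; rewrite /g big_seq big1 ?mulr0 // => d db.
  have dj := nth_boxes db js; have := leq_dot s (j := j) (u := d).
  rewrite (size_boxes db) => /(_ js) h.
  by case: eqP => // e; move: jk dj h; rewrite /= e; nia.
have Dscan d : size d = r -> D (scanl addn 0 d) = weight rat n (rev d).
  move=> dr; apply: eq_bigr => l _; congr (_ ^+ _ / _); rewrite /back_diff.
  have rl : (rev_ord l < size d)%N by rewrite dr.
  rewrite nth_rev ?dr // nth_scanl_addn // add0n.
  have -> : \sum_(l0 < r | l0.+1 == rev_ord l :> nat) (nth 0%N (scanl addn 0 d) l0)%:R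
      = (sumn (take (rev_ord l) d))%:R :> rat.
    case e : (nat_of_ord (rev_ord l)) => [|i]; first by rewrite take0 big_pred0.
    have ir : (i < r)%N by rewrite -dr ltnW // -e.
    by rewrite (big_pred1 (Ordinal ir)) // nth_scanl_addn ?dr.
  by rewrite (take_nth 0%N) // sumn_rcons natrD addrC addKr.
under eq_big_seq => d db.
  rewrite /g size_scanl (size_boxes db) (Dscan _ (size_boxes db)).
  rewrite (eq_big_seq (fun e => (dot (rev d) (scanl addn 0 (rev e)) == k)%:R)); last first.
    have ds := size_boxes db; move=> e /size_boxes es; congr (_ == _)%:R.
    by apply: dot_scanl_rev; rewrite ds es.
  over.
rewrite (big_boxes_rev r k (fun d => weight rat n d *
  \sum_(e <- boxes r k) (dot d (scanl addn 0 (rev e)) == k)%:R)).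
under eq_bigr => d _.
  rewrite (big_boxes_rev r k (fun e => (dot d (scanl addn 0 e) == k)%:R)) mulr_sumr.
  over.
rewrite exchange_big /= /acoef csum_boxes // => s ss /(has_nthP 0%N)[j js jk].
rewrite big_seq big1 // => d db; rewrite -ss in db.
have dj := nth_boxes db js; have := leq_dot s (j := j) (u := d).
rewrite (size_boxes db) => /(_ js) h.
by case: eqP => [e|]; rewrite ?mulr0 //; move: jk dj h; rewrite /= e; nia.
Qed.

Lemma rmorph_weight (K K' : numFieldType) (f : {rmorphism K -> K'}) n w :
  f (weight K n w) = weight K' n w.
Proof.
rewrite /weight rmorph_prod; apply: eq_bigr => i _.
by rewrite rmorphM fmorphV rmorphXn !rmorph_nat.
Qed.

Lemma rmorph_acoef (K K' : numFieldType) (f : {rmorphism K -> K'}) L W n N :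
  f (acoef K L W n N) = acoef K' L W n N.
Proof.
rewrite /acoef (raddf_csum f); apply: eq_csumr => l /=; rewrite rmorph_sum.
by apply: eq_bigr => w _; rewrite rmorphM rmorph_weight rmorph_nat.
Qed.

Section CoefficientBounds.
Variable K : numFieldType.

Lemma ler_csum r lo hi (f g : seq nat -> K) : (forall s, f s <= g s) ->
  csum r lo hi f <= csum r lo hi g.
Proof.
elim: r lo f g => [|r IH] lo f g fg //=.
by apply: ler_sum => j _; apply: IH.
Qed.

Lemma csum_widen r lo hi hi' (f : seq nat -> K) : (hi <= hi')%N ->
  csum r lo hi f
  = csum r lo hi' (fun s => if all (fun x => x < hi)%N s then f s else 0).
Proof.
move=> hh; elim: r lo f => [|r IH] lo f //=.
rewrite (big_nat_widen _ _ hi') // big_mkcond; apply: eq_bigr => j _.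
rewrite (IH j.+1 (fun s => f (j :: s))).
by case: ltnP => // _; rewrite csum0.
Qed.

Lemma weight_ge0 n w : 0 <= weight K n w.
Proof. by rewrite prodr_ge0 // => i _; rewrite divr_ge0 ?exprn_ge0. Qed.

Let term n N l w : K := weight K n w * (dot w l == N)%:R.

Let term_ge0 n N l w : 0 <= term n N l w.
Proof. by rewrite mulr_ge0 ?weight_ge0. Qed.

Let acoef_widen L W B n N : (L <= B)%N -> (W <= B)%N ->
  acoef K L W n N = csum (size n) 1 B.+1 (fun l =>
    if all (fun x => x < L.+1)%N l
    then \sum_(w <- boxes (size n) B | all (fun x => x <= W)%N w) term n N l w else 0).
Proof.
move=> LB WB; rewrite /acoef (csum_widen _ _ _ (LB : L < B.+1)%N).
by apply: eq_csumr => l; rewrite (big_boxes_widen _ _ WB).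
Qed.

Lemma acoef_ge0 L W n N : 0 <= acoef K L W n N.
Proof.
rewrite -(csum0 K (size n) 1 L.+1); apply: ler_csum => l.
by apply: sumr_ge0 => w _; exact: term_ge0.
Qed.

Let acoef_le_box L W B n N : (L <= B)%N -> (W <= B)%N ->
  acoef K L W n N <= acoef K B B n N.
Proof.
move=> LB WB; rewrite (acoef_widen _ _ LB WB); apply: ler_csum => l.
case: ifP => _; last by apply: sumr_ge0 => w _; exact: term_ge0.
by rewrite big_mkcond; apply: ler_sum => w _; case: ifP => // _; exact: term_ge0.
Qed.

Lemma acoef_stable L W n N : (N <= L)%N -> (N <= W)%N ->
  acoef K L W n N = acoef K N N n N.
Proof.
suff stable L' W' B : (N <= L' <= B)%N -> (N <= W' <= B)%N ->
    acoef K L' W' n N = acoef K B B n N.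
  move=> NL NW; rewrite (@stable _ _ (maxn L W)); last 2 first.
  - by rewrite NL leq_maxl.
  - by rewrite NW leq_maxr.
  by apply/esym/stable; rewrite leqnn leq_max NL.
move=> /andP[NL LB] /andP[NW WB]; rewrite (acoef_widen _ _ LB WB).
have big_dot l w j : (j < size w)%N -> (N < nth 0 w j * nth 0 l j)%N -> term n N l w = 0.
  move=> jw Nj; rewrite /term; case: eqP => [e|]; rewrite ?mulr0 //.
  by have := leq_dot l jw; rewrite e leqNgt Nj.
apply: eq_csum => l ln /allP l0 _; case: ifPn => [_|/allPn[x xl]].
  rewrite big_mkcond; apply: eq_big_seq => w wb; case: ifPn => // /allPn[x xw].
  rewrite -ltnNge => Wx; apply/esym; have jw : (index x w < size w)%N by rewrite index_mem.
  apply: (big_dot l w _ jw); rewrite nth_index //.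
  have lj : (0 < nth 0%N l (index x w))%N.
    have /l0/andP[] // : nth 0%N l (index x w) \in l.
    by rewrite mem_nth // ln -(size_boxes wb).
  nia.
rewrite -ltnNge ltnS => Lx; apply/esym; rewrite big_seq big1 // => w wb.
have jl : (index x l < size l)%N by rewrite index_mem.
have /andP[wj _] : (0 < nth 0 w (index x l) <= B)%N by apply: (nth_boxes wb); rewrite -ln.
apply: (big_dot l w (index x l)); first by rewrite (size_boxes wb) -ln.
rewrite nth_index //; nia.
Qed.

Lemma acoef_le L W n N : acoef K L W n N <= acoef K N N n N.
Proof.
rewrite -(@acoef_stable (maxn N (maxn L W)) (maxn N (maxn L W))) ?leq_maxl //.
by apply: acoef_le_box; rewrite !leq_max leqnn ?orbT.
Qed.

Definition phisum (x : K) (W k l : nat) : K :=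
  \sum_(1 <= w < W.+1) w%:R ^+ k.-1 / (k.-1)`!%:R * x ^+ (w * l).

Lemma rowsum_acoef (x : K) L W n B : (size n * (W * L) < B)%N ->
  \sum_(N < B) acoef K L W n N * x ^+ N = rowsum (phisum x W) L.+1 1 n.
Proof.
move=> hB; under eq_bigr => N _ do rewrite -csumZr.
rewrite -csum_sum; apply: eq_csum => l ln /allP lL _.
under eq_bigr => N _ do rewrite mulr_suml.
rewrite exchange_big /= -(boxes_prod (size n) W (fun j w =>
  w%:R ^+ (nth 0%N n j).-1 / ((nth 0%N n j).-1)`!%:R * x ^+ (w * nth 0%N l j))).
apply: eq_big_seq => w wb.
have dB : (dot w l < B)%N.
  apply: leq_ltn_trans hB; rewrite /dot (size_boxes wb).
  rewrite -[size n in X in (_ <= X)%N]card_ord -sum_nat_const; apply: leq_sum => j _.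
  have /andP[_ wj] := nth_boxes wb (ltn_ord j).
  by rewrite leq_mul // -ltnS; have /lL/andP[] : nth 0%N l j \in l by rewrite mem_nth ?ln.
rewrite (bigD1 (Ordinal dB)) //= eqxx mulr1 big1 ?addr0; last first.
  move=> N; rewrite -val_eqE /= eq_sym => /negbTE ->; by rewrite mulr0 mul0r.
by rewrite big_split /= prodrXr /dot (size_boxes wb).
Qed.

Lemma rowsum_le (X : nat -> nat -> K) (S : nat -> K) N lo n :
  (forall k m, 0 <= X k m) -> (0 < lo)%N ->
  (forall k lo, (0 < lo)%N -> \sum_(lo <= m < N) X k m <= S k) ->
  0 <= rowsum X N lo n <= \prod_(k <- n) S k.
Proof.
move=> X0 + XS; elim: n lo => [|k n IH] lo lo0.
  by rewrite rowsum_nil big_nil ler01 lexx.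
rewrite rowsum_cons big_cons; apply/andP; split.
  by apply: sumr_ge0 => m _; have /andP[r0 _] := IH m.+1 isT; rewrite mulr_ge0.
apply: le_trans (_ : (\sum_(lo <= m < N) X k m) * \prod_(j <- n) S j <= _).
  rewrite mulr_suml; apply: ler_sum => m _; have /andP[_ r1] := IH m.+1 isT.
  by rewrite ler_wpM2l.
have /andP[r0 r1] := IH 1%N isT.
by rewrite ler_wpM2r ?XS // (le_trans r0 r1).
Qed.

Lemma pow_fact_le k w : w%:R ^+ k / k`!%:R <= 'C(w + k, k)%:R :> K.
Proof.
rewrite ler_pdivrMr ?ltr0n ?fact_gt0 // -natrX -natrM ler_nat bin_fact_prod.
rewrite -[X in (_ ^ X)%N]card_ord -prod_nat_const.
by apply: leq_prod => i _; rewrite leq_addr.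
Qed.

Lemma phisum_ge0 x W k l : 0 <= x -> 0 <= phisum x W k l.
Proof.
by move=> x0; apply: sumr_ge0 => w _; rewrite mulr_ge0 ?divr_ge0 ?exprn_ge0.
Qed.

(* For l, w > 0, l w >= (l - 1) + w. *)
Lemma phisum_le x W k lo N : 0 <= x < 1 -> (0 < lo)%N ->
  \sum_(lo <= l < N) phisum x W k l <= (1 - x)^-1 * (1 - x) ^- (k.-1).+1.
Proof.
move=> /andP[x0 x1] lo0; have x01 : 0 <= x < 1 by rewrite x0.
pose c w : K := 'C(w + k.-1, k.-1)%:R * x ^+ w.
have c0 w : 0 <= c w by rewrite mulr_ge0 ?exprn_ge0.
have tail (g : nat -> K) a b : (forall i, 0 <= g i) -> \sum_(a <= i < b) g i <= \sum_(i < b) g i.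
  move=> g0; rewrite -(big_mkord xpredT) (@big_nat_widenl _ _ _ a 0) // big_mkcond.
  by apply: ler_sum => i _; case: ifP.
have step l : (0 < l)%N -> phisum x W k l <= x ^+ l.-1 * \sum_(1 <= w < W.+1) c w.
  move=> l0; rewrite /phisum mulr_sumr !big_nat; apply: ler_sum => w /andP[w0 _].
  rewrite /c mulrCA; apply: ler_pM; rewrite ?divr_ge0 ?exprn_ge0 ?pow_fact_le //.
  rewrite -exprD; apply: ler_wiXn2l; rewrite ?x0 ?(ltW x1) //; nia.
apply: le_trans (_ : (\sum_(lo <= l < N) x ^+ l.-1) * \sum_(1 <= w < W.+1) c w <= _).
  rewrite mulr_suml [leLHS]big_nat [leRHS]big_nat; apply: ler_sum => l /andP[l0 _].
  by apply: step; exact: leq_trans l0.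
apply: ler_pM; [by apply: sumr_ge0 => l _; rewrite exprn_ge0|exact: sumr_ge0| |].
  case: lo lo0 => // lo _; rewrite big_add1 /=.
  apply: le_trans (tail _ _ _ _) _; first by move=> i; rewrite exprn_ge0.
  have := bin_geometric_le 0 N.-1 x01; rewrite expr1; apply: le_trans.
  by apply: ler_sum => i _; rewrite bin0 mul1r.
exact: le_trans (tail _ _ _ c0) (bin_geometric_le _ _ x01).
Qed.

Lemma rowsum_tends (X : nat -> nat -> nat -> K) (X' : nat -> nat -> K) N lo n :
  (forall k l, (2 <= k)%N -> (0 < l)%N -> tends (fun W => X W k l) (X' k l)) ->
  all (leq 2) n -> (0 < lo)%N ->
  tends (fun W => rowsum (X W) N lo n) (rowsum X' N lo n).
Proof.
move=> hX; elim: n lo => [|k n IH] lo.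
  by move=> _ _; rewrite rowsum_nil; apply: (eq_tends _ (tends_cst 1)) => W; rewrite rowsum_nil.
move=> /= /andP[k2 n2] lo0; rewrite rowsum_cons.
apply: (eq_tends (fun W => esym (rowsum_cons (X W) N lo k n))).
rewrite big_seq; under eq_fun => W do rewrite big_seq.
apply: tends_sum => l; rewrite mem_index_iota => /andP[ll _]; apply: tendsM.
  by apply: hX => //; exact: leq_trans ll.
exact: IH.
Qed.

Lemma rowsum_scale (X : nat -> nat -> K) c N lo n :
  rowsum (fun k l => c ^+ k * X k l) N lo n = c ^+ sumn n * rowsum X N lo n.
Proof.
elim: n lo => [|k n IH] lo; first by rewrite !rowsum_nil mulr1.
rewrite !rowsum_cons mulr_sumr; apply: eq_bigr => m _.
by rewrite IH exprD mulrACA.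
Qed.

Lemma rowseries_rowsum (Psi : nat -> nat -> K) L l n :
  rowseries Psi L l n = rowsum (fun k l => Psi l k) L.+1 l.+1 n.
Proof.
elim: n l => [|k n IH] l /=; first by rewrite rowsum_nil.
by rewrite rowsum_cons; apply: eq_bigr => m _; rewrite IH.
Qed.

End CoefficientBounds.

Section QSeries.
Variable R : realType.
Local Notation C := R[i].

Lemma g_sh_coefE n k : all (leq 2) n ->
  g_sh_coef R n k = (- two_pi_i R) ^+ sumn n * acoef C k k n k.
Proof.
move=> n2; rewrite /g_sh_coef g_sh_acoef // -(rmorph_acoef (ratr : {rmorphism rat -> C})).
congr (_ * _); rewrite -exprD; congr (_ ^+ _); elim: n n2 => //= x n IH /andP[x2 n2].
rewrite addSn addnCA -{2}(prednK (ltnW x2)) addSn; congr S; rewrite -IH //; lia.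
Qed.

Lemma acoef_series_bound n (x : R) : 0 <= x < 1 ->
  exists B, forall V, \sum_(N < V) acoef R N N n N * x ^+ N <= B.
Proof.
move=> x01; have /andP[x0 x1] := x01.
exists (\prod_(k <- n) ((1 - x)^-1 * (1 - x) ^- (k.-1).+1)) => V.
have [B VB hB] : exists2 B, (V <= B)%N & (size n * (V * V) < B)%N.
  by exists (V + (size n * (V * V)).+1)%N; rewrite ?leq_addr // addnS ltnS leq_addl.
have /andP[_] := rowsum_le (N := V.+1) n (fun k m => phisum_ge0 V k m x0) (ltnSn 0)
  (fun k lo => @phisum_le _ x V k lo V.+1 x01).
apply: le_trans; rewrite -(rowsum_acoef x hB) -(subnKC VB) big_split_ord /=.
rewrite -[leLHS]addr0 lerD //; last first.
  by apply: sumr_ge0 => N _; rewrite mulr_ge0 ?acoef_ge0 ?exprn_ge0.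
by apply: ler_sum => N _; rewrite (@acoef_stable _ V V) // ltnW.
Qed.

Lemma acoef_limit n (q : C) (Phi : nat -> nat -> C) : cabs q < 1 -> all (leq 2) n ->
  (forall k l, (2 <= k)%N -> (0 < l)%N -> tends (fun W => phisum q W k l) (Phi k l)) ->
  exists2 S, tends (fun V => \sum_(N < V) acoef C N N n N * q ^+ N) S
    & tends (fun L => rowsum Phi L.+1 1 n) S.
Proof.
move=> q1 n2 hPhi; have q01 : 0 <= cabs q < 1 by rewrite cabs_ge0.
have [B hB] := acoef_series_bound n q01.
pose f N : C := acoef C N N n N * q ^+ N.
pose g N : R := acoef R N N n N * cabs q ^+ N.
have cabs_acoef L W N : cabs (acoef C L W n N) = acoef R L W n N.
  by rewrite -(rmorph_acoef (real_complex R)) cabs_real ger0_norm ?acoef_ge0.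
have fg N : cabs (f N) <= g N by rewrite /f cabsM cabs_acoef cabsX.
have [S hS] := dominated_series_tends fg hB.
exists S => //.
have g0 N : 0 <= g N := le_trans (cabs_ge0 _) (fg N).
have sg := bounded_series_small g0 hB.
suff h0 : tends (fun L => rowsum Phi L.+1 1 n - \sum_(N < L) f N) 0.
  by have := tendsD h0 hS; rewrite add0r; apply: eq_tends => L; rewrite subrK.
move=> e e0; have e2 : 0 < e / 2 by rewrite divr_gt0 ?ltr0n.
have [r r0 re] := posc_real e2; have [W0 hW0] := sg _ r0.
exists W0 => L W0L; apply: le_lt_trans (_ : e / 2 < e); last first.
  by rewrite ltr_pdivrMr ?ltr0n // ltr_pMr // ltr1n.
rewrite sub0r normrN re.
pose u W := rowsum (phisum q (L + W)) L.+1 1 n - \sum_(N < L) f N.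
apply: (@tends_le_norm _ u); last first.
  apply: tendsB (tends_cst _).
  apply: (rowsum_tends (X := fun W => phisum q (L + W))) => // k l k2 l0.
  exact: (tends_sub (phi := fun W => (L + W)%N) (fun W => leq_addl _ _) (hPhi k l k2 l0)).
move=> W; rewrite cabsE lecR.
have [D DL] : exists D, (size n * ((L + W) * L) < L + D)%N.
  by exists (size n * ((L + W) * L)).+1; rewrite addnS ltnS leq_addl.
rewrite /u -(rowsum_acoef q DL) big_split_ord /=.
have -> : \sum_(N < L) acoef C L (L + W) n N * q ^+ N = \sum_(N < L) f N.
  by apply: eq_bigr => N _; rewrite acoef_stable // ltnW // (leq_trans (ltn_ord N)) // leq_addr.
rewrite addrAC subrr add0r.
apply: le_trans (_ : \sum_(i < D) g (L + i)%N <= _).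
  elim/big_ind2: _ => [|a b a' b' ha hb|i _]; first by rewrite cabs0.
    by apply: le_trans (cabsD _ _) _; rewrite lerD.
  by rewrite cabsM cabs_acoef cabsX ler_wpM2r ?exprn_ge0 ?cabs_ge0 ?acoef_le.
apply: le_trans (hW0 (L + D)%N).
have -> : \sum_(i < D) g (L + i)%N = \sum_(L <= m < L + D) g m.
  rewrite -[X in \sum_(X <= _ < _) _]add0n big_addn addKn big_mkord.
  by apply: eq_bigr => i _; rewrite addnC.
by rewrite [leRHS](@big_cat_nat _ _ _ L) //= ?leq_addr // lerDr sumr_ge0.
Qed.

Lemma qseries_tends (tau : C) (Psi : nat -> nat -> C) n : 0 < complex.Im tau ->
  all (leq 2) n ->
  (forall l k, (0 < l)%N -> (2 <= k)%N ->
     exists2 P, tends (fun W => \sum_(w < W) w%:R ^+ k.-1 / (k.-1)`!%:R * e2pi (l%:R * tau) ^+ w) P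
     & Psi l k = (- two_pi_i R) ^+ k * P) ->
  exists2 S, tends (fun V => \sum_(N < V) g_sh_coef R n N * e2pi tau ^+ N) S
    & tends (fun L => rowseries Psi L 0 n) S.
Proof.
move=> tau0 n2 hPsi; set c := - two_pi_i R; set q := e2pi tau.
have c0 : c != 0 by rewrite oppr_eq0 two_pi_i_neq0.
pose Phi k l := c ^- k * Psi l k.
have [||S h1 h2] := @acoef_limit n q Phi _ n2.
- exact: cabs_e2pi_lt1.
- move=> k l k2 l0; have [P hP eP] := hPsi l k l0 k2.
  rewrite /Phi eP mulKf ?expf_neq0 //.
  have := tends_sub (phi := succn) (fun n => leqnSn n) hP; apply: eq_tends => W.
  rewrite big_ord_recl expr0n -[k.-1 == 0%N]negbK -lt0n -ltnS (prednK (ltnW k2)) k2 /=.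
  rewrite !mul0r add0r /phisum big_add1 /= big_mkord; apply: eq_bigr => w _.
  by rewrite /bump /= add1n e2piMn -exprM mulnC.
exists (c ^+ sumn n * S).
  have := tendsZ (c ^+ sumn n) h1; apply: eq_tends => V; rewrite mulr_sumr.
  by apply: eq_bigr => N _; rewrite g_sh_coefE // mulrA.
have := tendsZ (c ^+ sumn n) h2; apply: eq_tends => L.
rewrite rowseries_rowsum -rowsum_scale /rowsum; apply: eq_csumr => s.
by apply: eq_bigr => j _; rewrite /Phi mulVKf ?expf_neq0.
Qed.

End QSeries.

Theorem theorem1p3 (R : realType)
  (Zsh : word -> {poly R}) (hZsh : is_shuffle_regularisation Zsh)
  (zsh : {linear I1 -> R | ratr \; *%R})
  (hzsh : forall n, is_index n -> zsh (I1_index n) = (Zsh (index_word n))`_0)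
  (gsh : {linear I1 -> (nat -> R[i]) | ratr \; *:%R})
  (hgsh : forall n, is_index n -> gsh (I1_index n) = g_sh_coef R n)
  (Delta : {linear I1 -> tensor I1 I1})
  (hDelta : forall a w b, Delta (I1_gen a w b) = goncharov a w b)
  (r : nat) (n : r.-tuple nat)
  (hr : (1 <= r)%N) (hn : forall i, (2 <= tnth n i)%N)
  (tau : R[i]) (htau : 0 < complex.Im tau) :
  let q := cexp (two_pi_i R * tau) in
  [/\ forall L, cvgn (G_partial n tau L),
      cvgn (G_inner n tau)
    & (series (fun k => Gsh Delta zsh gsh n k * q ^+ k) : nat -> R[i]^o) @ \oo
        --> G n tau].
Proof.
move=> q; have n2 : all (leq 2) n by apply/all_tnthP => i; exact: hn.
have part2 j : all (leq 2) (take j n) /\ all (leq 2) (drop j n).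
  by split; apply/allP => z; [move/mem_take|move/mem_drop]; apply: (allP n2).
have limP (u : nat -> R[i]) l : tends u l ->
    cvgn (u : nat -> R[i]^o) /\ limn (u : nat -> R[i]^o) = l.
  move=> /tends_filter ul; split; first exact: cvgP ul.
  exact: (cvg_lim (@norm_hausdorff _ _) ul).
have [P hP] : exists P : nat -> nat -> R[i], forall l k, (0 < l)%N -> (2 <= k)%N ->
    tends (fun W => \sum_(w < W) w%:R ^+ k.-1 / (k.-1)`!%:R * e2pi (l%:R * tau) ^+ w) (P l k)
    /\ tends (fun M => \sum_(p < M.*2.+1) (l%:R * tau - M%:R + p%:R) ^- k)
         ((- two_pi_i R) ^+ k * P l k).
  have ex (lk : nat * nat) : exists P, (0 < lk.1)%N -> (2 <= lk.2)%N ->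
      tends (fun W => \sum_(w < W) w%:R ^+ lk.2.-1 / (lk.2.-1)`!%:R
                        * e2pi (lk.1%:R * tau) ^+ w) P
      /\ tends (fun M => \sum_(p < M.*2.+1) (lk.1%:R * tau - M%:R + p%:R) ^- lk.2)
           ((- two_pi_i R) ^+ lk.2 * P).
    case: lk => [[|l] [|[|k]]] /=; try by exists 0.
    have tl : 0 < complex.Im (l.+1%:R * tau) by rewrite mulr_natl raddfMn pmulrn_lgt0.
    by have [P h1 h2] := lipschitz tl (ltn0Sn k); exists P.
  have [P hP] := choice ex; exists (fun l k => P (l, k)) => l k; exact: (hP (l, k)).
pose Psi l k := (- two_pi_i R) ^+ k * P l k.
have [S hS] : exists S : seq nat -> R[i], forall s, all (leq 2) s ->
    tends (fun V => \sum_(k < V) g_sh_coef R s k * q ^+ k) (S s)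
    /\ tends (fun L => rowseries Psi L 0 s) (S s).
  have ex s : exists S : R[i], all (leq 2) s ->
      tends (fun V => \sum_(k < V) g_sh_coef R s k * q ^+ k) S
      /\ tends (fun L => rowseries Psi L 0 s) S.
    case s2 : (all (leq 2) s); last by exists 0.
    have [|S h1 h2] := qseries_tends (Psi := Psi) htau s2; last by exists S.
    by move=> l k l0 k2; exists (P l k); [have [] := hP l k l0 k2|].
  have [S hS] := choice ex; by exists S.
pose z j : R[i] := (zeta R (take j n))%:C.
pose bs j phi := blocksum (cxi zsh) (size n) (drop j n) phi.
have inner L : tends (G_partial n tau L)
    (\sum_(j < (size n).+1) z j * bs j (rowseries Psi L 0)).
  have := G_partial_tends htau (J := zlead zsh) (zlead0 hZsh hzsh) (zleadS zsh)
    (fun m m0 m2 => simple_poles_cancel (cxi_rev zsh) m0 m2 (cxi_path hZsh hzsh))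
    (Psi := Psi) (fun l k l0 k2 => proj2 (hP l k l0 k2)) L n2.
  congr (tends _ _); apply: eq_bigr => j _; congr (_ * _); exact: rowblocks_blocksum.
have outer : tends (G_inner n tau) (\sum_(j < (size n).+1) z j * bs j S).
  apply: (eq_tends (fun L => esym (proj2 (limP _ _ (inner L))))).
  apply: tends_sum => j _; apply: tendsZ; apply: blocksum_tends => s s2.
  exact: (proj2 (hS s s2)).
split; first by move=> L; exact: (proj1 (limP _ _ (inner L))).
  exact: (proj1 (limP _ _ outer)).
rewrite /G (proj2 (limP _ _ outer)); apply: tends_filter.
apply: (@eq_tends _ (fun V => \sum_(j < (size n).+1) z j
    * bs j (fun s => \sum_(k < V) gsh (I1_index s) k * q ^+ k))).
  move=> V; rewrite /series /= big_mkord.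
  under [RHS]eq_bigr => k _ do rewrite (Gsh_blocksum hZsh hzsh _ hDelta) // mulr_suml.
  rewrite exchange_big; apply: eq_bigr => j _.
  rewrite /bs blocksum_sum mulr_sumr; apply: eq_bigr => k _.
  by rewrite mulrA (zlead0 hZsh hzsh) //; have [] := part2 j.
apply: tends_sum => j _; apply: tendsZ; apply: blocksum_tends => s s2.
rewrite hgsh; last by apply: sub_all s2 => k /ltnW.
exact: (proj1 (hS s s2)).
Qed.
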